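(* Consider the $2$-user Gaussian symmetric Z interference channel with unidirectional transmitter cooperation of rate $C_G$ from transmitter $2$ to transmitter $1$ and with the secrecy constraint at receiver $1$. Let $\mathrm{SNR}=h_d^2P$ and $\mathrm{INR}=h_c^2P$. Then every rate pair $(R_1,R_2)$ in the secrecy capacity region satisfies $$R_1\le \tfrac12\log(1+\mathrm{SNR}),$$ $$R_2\le\max_{-1\le\rho\le 1}\tfrac12\log\left(1+\mathrm{SNR}-\frac{\left(\rho\,\mathrm{SNR}+\sqrt{\mathrm{SNR}\cdot\mathrm{INR}}\right)^2}{1+\mathrm{SNR}+\mathrm{INR}+2\rho\sqrt{\mathrm{SNR}\cdot\mathrm{INR}}}\right),$$ $$R_1+R_2\le\max_{-1\le\rho\le 1}\left\{\tfrac12\log\left(1+\mathrm{SNR}+\mathrm{INR}+2\rho\sqrt{\mathrm{SNR}\cdot\mathrm{INR}}-\frac{\left(\rho\,\mathrm{SNR}+\sqrt{\mathrm{SNR}\cdot\mathrm{INR}}\right)^2}{1+\mathrm{SNR}}\right)+\tfrac12\log\Sigma_{\mathbf{y}_2|\mathbf{s}}\right\}+C_G,$$ where, for each $\rho$, $$\Sigma_{\mathbf{y}_2|\mathbf{s}}=1+\mathrm{SNR}-\Sigma_{\mathbf{y}_2,\mathbf{s}}\,\Sigma_{\mathbf{s},\mathbf{s}}^{-1}\,\Sigma_{\mathbf{y}_2,\mathbf{s}}^T,\qquad \Sigma_{\mathbf{y}_2,\mathbf{s}}=\left[\rho\,\mathrm{SNR}\quad \rho\,\mathrm{SNR}+\sqrt{\mathrm{SNR}\cdot\mathrm{INR}}\right],$$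 $$\Sigma_{\mathbf{s},\mathbf{s}}=\begin{bmatrix}1+\mathrm{SNR} & \mathrm{SNR}+\rho\sqrt{\mathrm{SNR}\cdot\mathrm{INR}}\\ \mathrm{SNR}+\rho\sqrt{\mathrm{SNR}\cdot\mathrm{INR}} & 1+\mathrm{SNR}+\mathrm{INR}+2\rho\sqrt{\mathrm{SNR}\cdot\mathrm{INR}}\end{bmatrix}.$$
   Context: Gaussian symmetric Z interference channel: in each channel use the real inputs $x_1,x_2$ produce $$y_1=h_dx_1+h_cx_2+z_1,\qquad y_2=h_dx_2+z_2,$$ where $h_d,h_c$ are fixed real channel gains of the direct and interfering links, and $z_1,z_2$ are $\mathcal{N}(0,1)$ noises, i.i.d. over channel uses, independent of each other and of the messages and of all randomness used by the transmitters. The inputs satisfy the power constraint $E[|x_i|^2]\le P$, $i=1,2$, with $P>0$. The channel is used $N$ times; $\mathbf{x}_i^N,\mathbf{y}_i^N$ denote the blocks of $N$ inputs and outputs. Messages and encoding: $W_1,W_2$ are independent and uniformly distributed, $W_i$ on a set of size $2^{NR_i}$. A noiseless and secure cooperative link of rate $C_G\ge 0$ bits per channel use goes from transmitter $2$ to transmitter $1$; the (discrete) signal sent on it during the block is $\mathbf{v}_{21}^N$, with $H(\mathbf{v}_{21}^N)\le NC_G$. The signals $\mathbf{x}_2^N$ and $\mathbf{v}_{21}^N$ are functions of $W_2$ and possibly local randomness at transmitter $2$, so they are independent of $W_1$. The input of transmitter $1$ is a function of $W_1$, of the cooperative signal received so far (causality: it may not depend on cooperative signals sent in the future), and possibly of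 local randomness (artificial noise). The local randomness at the two transmitters is independent of each other and of the messages. In particular, $(W_1,\mathbf{x}_1^N)\to\mathbf{v}_{21}^N\to(W_2,\mathbf{x}_2^N)$ is a Markov chain. Secrecy capacity region: $(R_1,R_2)$ is achievable if there is a sequence of such codes with $N\to\infty$ for which receiver $i$ decodes $W_i$ from $\mathbf{y}_i^N$ with error probability tending to $0$ ($i=1,2$) and weak secrecy holds: $\frac1N I(W_2;\mathbf{y}_1^N)\to 0$. (Secrecy of $W_1$ at receiver $2$ is automatic, since transmitter $1$ is not connected to receiver $2$.) The secrecy capacity region is the closure of the set of achievable pairs. Logarithms are base $2$. *)

(* Defs.v *)
From HB Require Import structures.
From mathcomp Require Import all_boot all_order all_algebra.
From mathcomp Require Import all_classical all_reals all_analysis.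
From mathcomp Require Import measurable_realfun.

Set Implicit Arguments.
Unset Strict Implicit.
Unset Printing Implicit Defensive.

Import Order.TTheory GRing.Theory Num.Theory.
Import numFieldNormedType.Exports.

Local Open Scope classical_set_scope.
Local Open Scope ring_scope.

Definition log2 (R : realType) (x : R) : R := ln x / ln 2.

Section information.
Context d (Omega : measurableType d) (R : realType) (Pr : probability Omega R).

Definition generated_sigma d' (T : measurableType d') (X : Omega -> T) :
  set (set Omega) := preimage_set_system setT X measurable.

Definition mutually_independent (I : finType) (F : I -> set (set Omega)) :=
  forall (J : {set I}) (E : I -> set Omega),
    (forall i, i \in J -> F i (E i)) ->
    Pr (\bigcap_(i in [set` J]) E i) = (\prod_(i in J) Pr (E i))%E.

(* In bits. Meant for X taking countably many values; 0 log 0 = 0 because the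
   library's ln vanishes at 0. *)
Definition entropy (A : choiceType) (X : Omega -> A) : \bar R :=
  (\esum_(a in [set: A])
     let p := fine (Pr (X @^-1` [set a])) in (- (p * log2 p))%:E)%E.

(* Kullback-Leibler divergence D(nu || mu), in bits. The value -oo of lne at 0
   is harmless: the density is positive nu-almost everywhere. *)
Definition kl_divergence d' (T : measurableType d')
    (nu mu : probability T R) : \bar R :=
  if `[< nu `<< mu >] then
    ((ln 2)^-1%:E * \int[nu]_x lne (Radon_Nikodym_SigmaFinite.f nu mu x))%E
  else +oo%E.

Section mutual_information.
Context d1 d2 (A : measurableType d1) (B : measurableType d2).
Variables (X : {RV Pr >-> A}) (Y : {RV Pr >-> B}).

Definition joint_rv (w : Omega) : A * B := (X w, Y w).

Lemma measurable_joint_rv : measurable_fun setT joint_rv.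
Proof. exact: measurable_fun_pair. Qed.

HB.instance Definition _ :=
  isMeasurableFun.Build _ _ _ _ joint_rv measurable_joint_rv.

Definition mutual_information : \bar R :=
  kl_divergence (distribution Pr joint_rv)
    (distribution Pr X \x distribution Pr Y)%E.

End mutual_information.

End information.

(* A block code of length N. Messages of user i are the naturals below the size
   of its message set, and the countable alphabet of the cooperative link is
   nat. [S1] and [S2] are the spaces of the local randomness. *)
Record code (R : realType) (N : nat) := Code {
  disp1 : measure_display;
  S1 : measurableType disp1;
  disp2 : measure_display;
  S2 : measurableType disp2;
  enc1 : 'I_N -> {mfun (nat * N.-tuple nat * S1)%type >-> R};
  enc1_causal : forall (n : 'I_N) (m : nat) (v v' : N.-tuple nat) (s : S1),
    (forall k : 'I_N, (k <= n)%N -> tnth v k = tnth v' k) ->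
    enc1 n (m, v, s) = enc1 n (m, v', s);
  enc2 : 'I_N -> {mfun (nat * S2)%type >-> R};
  coop : 'I_N -> {mfun (nat * S2)%type >-> nat};
  dec1 : {mfun N.-tuple R >-> nat};
  dec2 : {mfun N.-tuple R >-> nat}
}.

Record sources (R : realType) (N : nat) (c : code R N) := Sources {
  dispO : measure_display;
  Omega : measurableType dispO;
  Pr : probability Omega R;
  W1 : {RV Pr >-> nat};
  W2 : {RV Pr >-> nat};
  T1 : {RV Pr >-> S1 c};
  T2 : {RV Pr >-> S2 c};
  Z1 : 'I_N -> {RV Pr >-> R};
  Z2 : 'I_N -> {RV Pr >-> R}
}.

Section transmission.
Variables (R : realType) (N : nat) (c : code R N) (s : sources c).
Local Notation Omega := (Omega s).
Local Notation Pr := (Pr s).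

Definition source_sigma (i : bool + bool + ('I_N + 'I_N)) : set (set Omega) :=
  match i with
  | inl (inl false) => generated_sigma (W1 s)
  | inl (inl true) => generated_sigma (W2 s)
  | inl (inr false) => generated_sigma (T1 s)
  | inl (inr true) => generated_sigma (T2 s)
  | inr (inl n) => generated_sigma (Z1 s n)
  | inr (inr n) => generated_sigma (Z2 s n)
  end.

Definition uniform_message (M : nat) (W : {RV Pr >-> nat}) :=
  forall m : nat, Pr (W @^-1` [set m]) =
    (if (m < M)%N then M%:R^-1 else 0)%:E.

Definition standard_normal (Z : {RV Pr >-> R}) :=
  forall A : set R, measurable A -> distribution Pr Z A = normal_prob 0 1 A.

Definition sources_spec (M1 M2 : nat) :=
  [/\ uniform_message M1 (W1 s), uniform_message M2 (W2 s),
      forall n, standard_normal (Z1 s n), forall n, standard_normal (Z2 s n)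
    & mutually_independent Pr source_sigma].

Definition V21 (w : Omega) : N.-tuple nat :=
  [tuple coop c n (W2 s w, T2 s w) | n < N].

Definition X1 (n : 'I_N) (w : Omega) : R := enc1 c n (W1 s w, V21 w, T1 s w).

Definition X2 (n : 'I_N) (w : Omega) : R := enc2 c n (W2 s w, T2 s w).

Definition power_constraint (P : R) :=
  forall n : 'I_N, ('E_Pr[fun w => (X1 n w ^+ 2)%R] <= P%:E)%E /\
                   ('E_Pr[fun w => (X2 n w ^+ 2)%R] <= P%:E)%E.

Definition coop_constraint (CG : R) := (entropy Pr V21 <= (N%:R * CG)%:E)%E.

Variables hd hc : R.

Definition Y1 (w : Omega) : N.-tuple R :=
  [tuple hd * X1 n w + hc * X2 n w + Z1 s n w | n < N].

Definition Y2 (w : Omega) : N.-tuple R :=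
  [tuple hd * X2 n w + Z2 s n w | n < N].

Lemma measurable_V21 : measurable_fun setT V21.
Proof.
apply/measurable_fun_tnthP => n; rewrite /comp/=.
under eq_fun do rewrite tnth_mktuple.
by apply: measurableT_comp => //; exact: measurable_fun_pair.
Qed.

Lemma measurable_X1 n : measurable_fun setT (X1 n).
Proof.
apply: measurableT_comp => //; apply: measurable_fun_pair => //.
by apply: measurable_fun_pair => //; exact: measurable_V21.
Qed.

Lemma measurable_X2 n : measurable_fun setT (X2 n).
Proof. by apply: measurableT_comp => //; exact: measurable_fun_pair. Qed.

Lemma measurable_Y1 : measurable_fun setT Y1.
Proof.
apply/measurable_fun_tnthP => n; rewrite /comp/=.
under eq_fun do rewrite tnth_mktuple.
apply: measurable_funD => //; apply: measurable_funD; apply: measurable_funM => //.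
  exact: measurable_X1.
exact: measurable_X2.
Qed.

HB.instance Definition _ := isMeasurableFun.Build _ _ _ _ Y1 measurable_Y1.

Definition error1 : \bar R := Pr [set w | dec1 c (Y1 w) <> W1 s w].

Definition error2 : \bar R := Pr [set w | dec2 c (Y2 w) <> W2 s w].

Definition leakage : \bar R :=
  (N%:R^-1%:E * mutual_information (W2 s) (Y1 : {mfun _ >-> _}))%E.

End transmission.

(* A message set of size 2 ^ (N * rate), rounded up to an integer. *)
Definition message_count (R : realType) (N : nat) (rate : R) : nat :=
  absz (Num.ceil (2 `^ (N%:R * rate))).

Definition achievable (R : realType) (hd hc P CG : R) (r : R * R) : Prop :=
  [/\ 0 <= r.1, 0 <= r.2 &
    exists (N : nat -> nat) (c : forall k, code R (N k))
      (s : forall k, sources (c k)),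
      (N k @[k --> \oo] --> \oo) /\
      (forall k, [/\
        sources_spec (s k) (message_count (N k) r.1) (message_count (N k) r.2),
        power_constraint (s k) P & coop_constraint (s k) CG]) /\
      [/\ error1 (s k) hd hc @[k --> \oo] --> 0%E,
          error2 (s k) hd @[k --> \oo] --> 0%E
        & leakage (s k) hd hc @[k --> \oo] --> 0%E]].

Definition secrecy_capacity_region (R : realType) (hd hc P CG : R) :
  set (R * R) := closure [set r | achievable hd hc P CG r].

Section bounds.
Variables (R : realType) (SNR INR rho : R).

Definition Sigma_y2_s : 'rV[R]_(1 + 1) :=
  row_mx (rho * SNR)%:M (rho * SNR + Num.sqrt (SNR * INR))%:M.

Definition Sigma_s_s : 'M[R]_(1 + 1) :=
  block_mx (1 + SNR)%:M (SNR + rho * Num.sqrt (SNR * INR))%:M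
           (SNR + rho * Num.sqrt (SNR * INR))%:M
           (1 + SNR + INR + 2 * rho * Num.sqrt (SNR * INR))%:M.

Definition Sigma_y2_given_s : R :=
  1 + SNR - (Sigma_y2_s *m invmx Sigma_s_s *m Sigma_y2_s^T) 0 0.

Definition R2_bound : R :=
  2^-1 * log2 (1 + SNR - (rho * SNR + Num.sqrt (SNR * INR)) ^+ 2 /
                 (1 + SNR + INR + 2 * rho * Num.sqrt (SNR * INR))).

Definition sum_bound : R :=
  2^-1 * log2 (1 + SNR + INR + 2 * rho * Num.sqrt (SNR * INR) -
                 (rho * SNR + Num.sqrt (SNR * INR)) ^+ 2 / (1 + SNR)) +
  2^-1 * log2 Sigma_y2_given_s.

End bounds.

Definition is_max (R : realType) (D : set R) (f : R -> R) (m : R) :=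
  (f @` D) m /\ ubound (f @` D) m.

(* Main.v *)
(* Let [z3] be a fresh standard Gaussian block and [s = hd x1 + z3], so that
   receiver 1 decodes [W1] from [s + hc x2] as reliably as from [y1]. By Fano's
   inequality and weak secrecy, up to o(N),
     N R1 <= h(s + hc x2 | y2) - h(s | W1, v21),    N R2 <= h(y2 | y1) - h(z2),
   and likewise N R1 <= h(s) - h(z3). The rates are coupled by
     h(y2 | y1) <= h(y2 | s, y1) + h(s | y1) - h(z3),
     h(s | y1) - h(s | W1, v21) <= H(v21) <= N CG,
   the latter because [y1] reveals [W1] and, given [W1] and [v21], [s] is
   independent of [y1]. The remaining entropies are those of linear estimation
   errors; letter by letter they are bounded by Gaussian ones, with variances
   depending on the correlation of the two inputs.
   Differential entropies may fail to exist, so every inequality above is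
   replaced by the fact that some likelihood ratio L has mean at most 1, hence
   that ln L <= L - 1 has mean at most 0; a Gaussian density with a linear mean
   is substituted for each conditional density to be maximised. *)

(* All densities are taken with respect to the standard Gaussian block law [gaussN]: the reference
   is then a probability, every channel density is strictly positive, and a substituted test density
   only has to have mass at most one. In the sum bound the logarithms of [code1_ratio], [side_ratio]
   and [decoupling_ratio] are added; the two densities that cannot be computed, of [side] given the
   message and the cooperative signal and of [side] given the first output, then cancel pointwise,
   so their entropies are never formed. The power constraint holds letter by letter, so each letter
   has its own correlation [k] with [|k| <= P]; its contribution is compared directly with the
   maximum over [rho], and the letters may have different correlations without any concavity
   argument. The stated bounds see [hd * hc] only through its absolute value; the sign is absorbed
   by exchanging [rho] and [- rho]. *)
Require Import Defs.
From HB Require Import structures.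
From mathcomp Require Import all_boot all_order all_algebra.
From mathcomp Require Import all_classical all_reals all_analysis.
From mathcomp Require Import measurable_realfun ring lra.

Set Implicit Arguments.
Unset Strict Implicit.
Unset Printing Implicit Defensive.

Import Order.TTheory GRing.Theory Num.Theory.
Import numFieldNormedType.Exports.

Local Open Scope classical_set_scope.
Local Open Scope ring_scope.

(** * Gaussian integrals *)

Section integral_extra.
Local Open Scope ereal_scope.
Context {R : realType}.

Lemma ge0_integralZ_real d (T : measurableType d)
    (mu : {measure set T -> \bar R}) (c : R) (f : T -> R) :
  (0 <= c)%R -> measurable_fun setT f -> (forall x, 0 <= f x)%R ->
  \int[mu]_x (c * f x)%:E = c%:E * \int[mu]_x (f x)%:E.
Proof.
move=> c0 mf f0; rewrite -ge0_integralZl//.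
- exact/measurable_EFinP.
- by move=> x _; rewrite lee_fin.
Qed.

Lemma integral_probability_cst d (T : measurableType d) (P : probability T R)
  (r : \bar R) : \int[P]_x r = r.
Proof.
rewrite (integral_cst P measurableT r) -[RHS]mule1.
exact: (congr1 (fun x => r * x) (@probability_setT _ _ _ P)).
Qed.

End integral_extra.

Section density.
Local Open Scope ereal_scope.
Context d (T : measurableType d) (R : realType).
Variables (nu : {finite_measure set T -> \bar R})
  (mu : {sigma_finite_measure set T -> \bar R}) (h : T -> R).

(** The density of [nu] is unique up to a [mu]-null set, so the Radon-Nikodym derivative may be
    exchanged for the explicit [h] in the change of variables. *)
Lemma integral_density (F : T -> \bar R) :
  measurable_fun setT h -> (forall x, (0 <= h x)%R) ->
  (forall A, measurable A -> nu A = \int[mu]_(x in A) (h x)%:E) ->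
  measurable_fun setT F -> (forall x, 0 <= F x) ->
  \int[nu]_x F x = \int[mu]_x (F x * (h x)%:E).
Proof.
move=> mh h0 nuE mF F0.
have numu : nu `<< mu.
  apply/null_content_dominatesP => A mA A0; rewrite nuE//.
  by apply: null_set_integral => //; exact/measurable_EFinP/measurable_funTS.
rewrite -(Radon_Nikodym_SigmaFinite.change_of_variables numu)//.
apply: ae_eq_integral => //.
- apply: emeasurable_funM => //.
  exact: measurable_int (Radon_Nikodym_SigmaFinite.f_integrable numu).
- by apply: emeasurable_funM => //; exact/measurable_EFinP.
have : ae_eq mu setT (Radon_Nikodym_SigmaFinite.f nu mu) (EFin \o h).
  apply: integral_ae_eq => //.
  - exact: Radon_Nikodym_SigmaFinite.f_integrable.
  - exact/measurable_EFinP.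
  - by move=> E _ mE; rewrite -Radon_Nikodym_SigmaFinite.f_integral// nuE.
by apply: filterS => x /= /(_ I) ->.
Qed.

End density.

Lemma measurable_inv (R : realType) : measurable_fun setT (@GRing.inv R).
Proof.
(* Writing the inverse as [x] times a real power of its square reduces the claim to products and
   powers; at 0 both sides vanish because [0^-1 = 0]. *)
rewrite (_ : @GRing.inv R = fun x => x * (x ^+ 2) `^ (-1)).
  apply: measurable_funM => //.
  apply: (@measurableT_comp _ _ _ _ _ _ (@powR R ^~ (-1))).
    exact: measurable_powR.
  exact: exprn_measurable.
apply/funext => x; rewrite powR_inv1 ?sqr_ge0//.
have [->|x0] := eqVneq x 0; first by rewrite invr0 mul0r.
by rewrite expr2 invfM mulrA divff// mul1r.
Qed.

(** * The standard normal law: translations, rescalings and second moment *)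

Section gauss1.
Local Open Scope ereal_scope.
Context {R : realType}.
Local Notation mu := (@lebesgue_measure R).

Lemma measurable_addr (c : R) : measurable_fun setT
  ((fun x => x + c)%R : measurableTypeR R -> measurableTypeR R).
Proof. exact: measurable_funD. Qed.

(** The translated measure agrees with Lebesgue measure on half-open intervals, which determine
    it. *)
Lemma lebesgue_measureD (c : R) (A : set R) : measurable A ->
  pushforward mu ((fun x => x + c)%R : measurableTypeR R -> measurableTypeR R) A
  = mu A.
Proof.
have mD := measurable_addr c.
pose h : {mfun measurableTypeR R >-> measurableTypeR R} :=
  HB.pack (fun x : measurableTypeR R => (x + c)%R : measurableTypeR R)
    (isMeasurableFun.Build _ _ _ _ _ mD).
rewrite -/(h : _ -> _) => mA.
apply/esym/(lebesgue_measure_unique (mu := pushforward mu h)) => //= _ [[a b]] _ <-.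
rewrite /pushforward.
rewrite [X in _ = mu X](_ : _ = `](a - c)%R, (b - c)%R]%classic); last first.
  by apply/seteqP; split => x /=; rewrite !in_itv/= ltrBlDr lerBrDr.
rewrite !lebesgue_measure_itv/= !lte_fin ltrD2r.
by case: ifP => // _; rewrite -!EFinB; congr (_%:E); ring.
Qed.

Lemma ge0_integral_shift (c : R) (F : R -> \bar R) :
  measurable_fun setT F -> (forall x, 0 <= F x) ->
  \int[mu]_x F (x + c)%R = \int[mu]_x F x.
Proof.
move=> mF F0; rewrite -[LHS]/(\int[mu]_(x in
  ((fun x => x + c)%R : measurableTypeR R -> measurableTypeR R) @^-1` setT)
  (F \o (fun x => x + c)%R) x).
rewrite -ge0_integral_pushforward//=; last exact: measurable_addr.
apply: eq_measure_integral; first exact: measurable_addr.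
by move=> mD A mA _; exact: lebesgue_measureD.
Qed.

Definition phi : R -> R := normal_pdf 0 1.

Lemma normal_pdf_gt0 (m s x : R) : s != 0%R -> (0 < normal_pdf m s x)%R.
Proof.
move=> s0; rewrite normal_pdfE//; apply: mulr_gt0; last exact: expR_gt0.
exact: normal_peak_gt0.
Qed.

Lemma phi_gt0 x : (0 < phi x)%R.
Proof. by apply: normal_pdf_gt0; rewrite oner_neq0. Qed.

Lemma measurable_phi : measurable_fun setT phi.
Proof. exact: measurable_normal_pdf. Qed.

Let to_default (x : measurableTypeR R) : R := x.

Let measurable_to_default : measurable_fun setT to_default.
Proof. exact: measurable_id. Qed.

HB.instance Definition _ := isMeasurableFun.Build _ _ _ _ to_default
  measurable_to_default.

(* The library's normal law lives on the copy [measurableTypeR R] of R, whereas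
   tuples of reals use the default measurable structure of R. *)
Definition gauss1 : probability R R :=
  distribution (@normal_prob R 0 1) to_default.

Lemma integral_gauss1 (F : R -> \bar R) :
  measurable_fun setT F -> (forall x, 0 <= F x) ->
  \int[gauss1]_x F x = \int[mu]_x (F x * (phi x)%:E).
Proof.
move=> mF F0; rewrite ge0_integral_distribution//.
apply: (@integral_density _ (measurableTypeR R) R (normal_prob 0 1) mu phi F) => //.
- exact: measurable_phi.
- by move=> x; rewrite ltW// phi_gt0.
Qed.

Lemma measurable_normal_ratio (m s c : R) :
  measurable_fun setT (fun y : R => normal_pdf m s (y + c) / phi y)%R.
Proof.
apply: measurable_funM; last first.
  apply: (@measurableT_comp _ _ _ _ _ _ (@GRing.inv R)) => //.
    exact: measurable_inv.
  exact: measurable_phi.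
apply: (@measurableT_comp _ _ _ _ _ _ (normal_pdf m s)).
  exact: measurable_normal_pdf.
exact: measurable_funD.
Qed.

Lemma normal_ratio_ge0 (m s c y : R) : (0 <= normal_pdf m s (y + c) / phi y)%R.
Proof. by rewrite divr_ge0 ?normal_pdf_ge0// ltW// phi_gt0. Qed.

Lemma gauss1_normal_ratio (m s c : R) :
  \int[gauss1]_y (normal_pdf m s (y + c) / phi y)%:E = 1.
Proof.
rewrite (@integral_gauss1 (fun y : R => (normal_pdf m s (y + c) / phi y)%:E)).
- under eq_integral do rewrite -EFinM divfK ?gt_eqF ?phi_gt0//.
  rewrite (ge0_integral_shift c (F := fun x => (normal_pdf m s x)%:E)).
  + exact: integral_normal_pdf.
  + by apply/measurable_EFinP; exact: measurable_normal_pdf.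
  + by move=> x; rewrite lee_fin normal_pdf_ge0.
- by apply/measurable_EFinP; exact: measurable_normal_ratio.
- by move=> x; rewrite lee_fin normal_ratio_ge0.
Qed.

(** One-dimensional Cameron-Martin formula: a translation of the noise is traded for the density
    ratio of [N(m, 1)] and [N(0, 1)]. *)
Lemma integral_gauss1_shift (m : R) (F : R -> \bar R) :
  measurable_fun setT F -> (forall x, 0 <= F x) ->
  \int[gauss1]_z F (m + z)%R
  = \int[gauss1]_y (F y * (normal_pdf m 1 y / phi y)%:E).
Proof.
move=> mF F0; rewrite (@integral_gauss1 (fun z => F (m + z)%R))//; last first.
  by apply: measurableT_comp => //; exact: measurable_funD.
rewrite (@integral_gauss1 (fun y => F y * (normal_pdf m 1 y / phi y)%:E)); last first.
- by move=> x; rewrite mule_ge0// lee_fin; have := normal_ratio_ge0 m 1 0 x; rewrite addr0.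
- apply: emeasurable_funM => //; apply/measurable_EFinP.
  by have := measurable_normal_ratio m 1 0; under eq_fun do rewrite addr0.
under [RHS]eq_integral do rewrite -muleA -EFinM divfK ?gt_eqF ?phi_gt0//.
rewrite -[RHS](ge0_integral_shift m); last first.
- by move=> x; rewrite mule_ge0// lee_fin normal_pdf_ge0.
- apply: emeasurable_funM => //; apply/measurable_EFinP.
  exact: measurable_normal_pdf.
apply: eq_integral => x _; rewrite addrC; congr (_ * _%:E).
by rewrite /phi !normal_pdfE ?oner_neq0// /normal_fun subr0 addrK.
Qed.

Lemma normal_peak_scale (t : R) : (0 < t)%R ->
  normal_peak t = (t^-1 * normal_peak 1)%R.
Proof.
move=> t0; rewrite /normal_peak expr1n mul1r -mulrnAr sqrtrM ?sqr_ge0//.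
by rewrite sqrtr_sqr gtr0_norm// invfM.
Qed.

Lemma normal_ratio0E (s y : R) : (0 < s)%R ->
  (normal_pdf 0 s (y + 0) / phi y
   = s^-1 * expR ((1 - s ^- 2) / 2 * y ^+ 2))%R.
Proof.
move=> s0; have sn0 : s != 0%R by rewrite gt_eqF.
rewrite addr0 /phi !normal_pdfE ?oner_neq0//.
have p1 : normal_peak 1 != 0%R :> R by rewrite gt_eqF// normal_peak_gt0// oner_neq0.
rewrite normal_peak_scale// /normal_fun !subr0 expr1n.
rewrite (_ : expR ((1 - _) / 2 * _) =
  (expR (- y ^+ 2 / (s ^+ 2 *+ 2)) / expR (- y ^+ 2 / 2))%R); last first.
  rewrite -expRN -expRD; congr expR; rewrite -mulr_natr; field.
  by rewrite sn0.
have e0 : expR (- y ^+ 2 / 2) != 0%R :> R by rewrite gt_eqF ?expR_gt0.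
by field; rewrite e0 p1 sn0.
Qed.

Let measurable_sqr : measurable_fun setT (fun x : R => x ^+ 2)%R.
Proof. exact: exprn_measurable. Qed.

Lemma gauss1_normal_ratioZ (s : R) : (0 <= s)%R ->
  \int[gauss1]_x (s * (normal_pdf 0 s (x + 0) / phi x))%:E = s%:E.
Proof.
move=> s0; rewrite (ge0_integralZ_real _ s0).
- by rewrite gauss1_normal_ratio mule1.
- exact: measurable_normal_ratio.
- by move=> x; exact: normal_ratio_ge0.
Qed.

(** The centred normal density of deviation [s], divided by [phi], is
    [s^-1 * exp ((1 - s^-2) / 2 * x^2)] and has integral 1. Applying [exp t >= 1 + t] under the
    integral bounds the second moment from above when [s > 1]; the next lemma takes [s < 1], where
    the exponent changes sign, to bound it from below. *)
Lemma gauss1_sqr_le (s : R) : (1 < s)%R ->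
  1 + ((1 - s ^- 2) / 2)%:E * \int[gauss1]_z (z ^+ 2)%:E <= s%:E.
Proof.
move=> s1; have s0 : (0 < s)%R by rewrite (lt_trans _ s1).
have c0 : (0 <= (1 - s ^- 2) / 2)%R.
  by rewrite divr_ge0// subr_ge0 -exprVn exprn_ile1 ?invr_ge0 ?invf_le1// ltW.
rewrite -(gauss1_normal_ratioZ (ltW s0)) -ge0_integralZ_real//; last first.
  by move=> x; exact: sqr_ge0.
rewrite -[1%E](@probability_setT _ _ _ gauss1) -[gauss1 setT]mul1e -integral_cst//.
rewrite -ge0_integralD//; last 2 first.
- by move=> x _; rewrite lee_fin mulr_ge0// sqr_ge0.
- by apply/measurable_EFinP; exact: measurable_funM.
apply: ge0_le_integral => //.
- by move=> x _; rewrite adde_ge0// lee_fin mulr_ge0// sqr_ge0.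
- by apply: emeasurable_funD => //; apply/measurable_EFinP; exact: measurable_funM.
- by apply/measurable_EFinP; apply: measurable_funM => //; exact: measurable_normal_ratio.
move=> x _; rewrite lee_fin normal_ratio0E// mulVKf ?gt_eqF//.
exact: expR_ge1Dx.
Qed.

Lemma gauss1_sqr_ge (s : R) : (0 < s)%R -> (s < 1)%R ->
  1 <= s%:E + ((s ^- 2 - 1) / 2)%:E * \int[gauss1]_z (z ^+ 2)%:E.
Proof.
move=> s0 s1.
have c0 : (0 <= (s ^- 2 - 1) / 2)%R.
  by rewrite divr_ge0// subr_ge0 invf_ge1 ?exprn_gt0// exprn_ile1// ltW.
rewrite -(gauss1_normal_ratioZ (ltW s0)) -ge0_integralZ_real//; last first.
  by move=> x; exact: sqr_ge0.
rewrite -[1%E](@probability_setT _ _ _ gauss1) -[gauss1 setT]mul1e -integral_cst//.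
rewrite -ge0_integralD//; last 4 first.
- by move=> x _; rewrite lee_fin mulr_ge0 ?(ltW s0) ?normal_ratio_ge0.
- by apply/measurable_EFinP; apply: measurable_funM => //; exact: measurable_normal_ratio.
- by move=> x _; rewrite lee_fin mulr_ge0// sqr_ge0.
- by apply/measurable_EFinP; exact: measurable_funM.
apply: ge0_le_integral => //.
- apply: emeasurable_funD; apply/measurable_EFinP; last exact: measurable_funM.
  by apply: measurable_funM => //; exact: measurable_normal_ratio.
move=> x _; rewrite lee_fin normal_ratio0E// mulVKf ?gt_eqF//.
rewrite -lerBlDr (le_trans _ (expR_ge1Dx _))//; lra.
Qed.

(** Letting [s] tend to 1 in the two one-sided bounds pins the second moment. *)
Lemma integral_gauss1_sqr : \int[gauss1]_z (z ^+ 2)%:E = 1.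
Proof.
set m := \int[gauss1]_z _.
have m0 : 0 <= m by apply: integral_ge0 => x _; rewrite lee_fin sqr_ge0.
(* An infinite second moment would contradict the upper bound already at [s = 2]. *)
have mfin : m \is a fin_num.
  rewrite ge0_fin_numE//; case: ltP => //; rewrite leye_eq => /eqP moo.
  have := @gauss1_sqr_le 2%R; rewrite -/m moo ltr1n => /(_ isT).
  rewrite gt0_muley// lte_fin divr_gt0// subr_gt0 -exprVn exprn_ilt1//.
  by rewrite invf_lt1// ltr1n.
have hi (e : R) : (0 < e)%R -> (fine m <= 1 + e *+ 2)%R.
  move=> e0; have e1 : (0 < 1 + e)%R by rewrite addr_gt0.
  have := @gauss1_sqr_le (1 + e)%R; rewrite -/m ltrDl => /(_ e0).
  rewrite -(fineK mfin) -EFinM -EFinD lee_fin lerD2l.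
  (* After cancelling [e] the bound reads [m <= 2 (1 + e)^2 / (2 + e)], which falls short of
     [1 + 2 e] by [e / (2 + e)]. *)
  have -> : ((1 - (1 + e) ^- 2) / 2 * fine m =
    e * ((2 + e) / (2 * (1 + e) ^+ 2) * fine m))%R.
    by field; rewrite gt_eqF.
  rewrite ger_pMr// -ler_pdivlMl; last first.
    by rewrite divr_gt0 ?addr_gt0// mulr_gt0// exprn_gt0.
  move=> /= /le_trans; apply; rewrite mulr1 invf_div ler_pdivrMr ?addr_gt0//.
  rewrite -subr_ge0 (_ : _ - _ = e)%R ?ltW//; ring.
have lo (e : R) : (0 < e)%R -> (1 - e *+ 2 <= fine m)%R.
  move=> e0; have [e1|e1] := leP 1%R e.
    rewrite (@le_trans _ _ 0%R)// ?fine_ge0// subr_le0.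
    by rewrite (le_trans e1)// mulr2n lerDl ltW.
  have e1' : (0 < 1 - e)%R by rewrite subr_gt0.
  have := @gauss1_sqr_ge (1 - e)%R e1'; rewrite -/m gtrDl oppr_lt0 => /(_ e0).
  rewrite -(fineK mfin) -EFinM -EFinD lee_fin -lerBlDl opprB addrCA subrr addr0.
  have -> : (((1 - e) ^- 2 - 1) / 2 * fine m =
    e * ((2 - e) / (2 * (1 - e) ^+ 2) * fine m))%R.
    by field; rewrite gt_eqF.
  have e2 : (0 < 2 - e)%R by lra.
  rewrite ler_pMr// -ler_pdivrMl; last first.
    by rewrite divr_gt0// mulr_gt0// exprn_gt0.
  move=> /= /(le_trans _); apply; rewrite mulr1 invf_div ler_pdivlMr//.
  rewrite -subr_ge0 (_ : _ - _ = e)%R ?ltW//; ring.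
rewrite -(fineK mfin); congr (_%:E); apply/eqP; rewrite eq_le; apply/andP; split.
  apply/ler_addgt0Pr => e e0; rewrite (le_trans (hi (e / 2)%R _)) ?divr_gt0//.
  by rewrite -(mulr_natr (e / 2)%R) divfK.
apply/ler_addgt0Pr => e e0; rewrite -lerBlDr (le_trans _ (lo (e / 2)%R _)) ?divr_gt0//.
by rewrite -(mulr_natr (e / 2)%R) divfK.
Qed.

Lemma ge0_integral_opp (F : R -> \bar R) :
  measurable_fun setT F -> (forall x, 0 <= F x) ->
  \int[mu]_x F (- x)%R = \int[mu]_x F x.
Proof.
move=> mF F0; rewrite -[LHS]/(\int[mu]_(x in
  (-%R : measurableTypeR R -> measurableTypeR R) @^-1` setT) (F \o -%R) x).
rewrite -ge0_integral_pushforward//=.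
by apply: eq_measure_integral => A mA _; exact: lebesgue_measureN.
Qed.

Lemma integral_gauss1_opp (F : R -> \bar R) :
  measurable_fun setT F -> (forall x, 0 <= F x) ->
  \int[gauss1]_z F (- z)%R = \int[gauss1]_z F z.
Proof.
move=> mF F0.
rewrite (@integral_gauss1 (fun z => F (- z)%R))//; last first.
  by apply: measurableT_comp => //; exact: measurable_funN.
rewrite (@integral_gauss1 F)//.
rewrite -(@ge0_integral_opp (fun z => F z * (phi z)%:E)); last 2 first.
- by apply: emeasurable_funM => //; apply/measurable_EFinP; exact: measurable_phi.
- by move=> x; rewrite mule_ge0// lee_fin ltW// phi_gt0.
apply: eq_integral => x _; congr (_ * _%:E).
by rewrite /phi !normal_pdfE ?oner_neq0// /normal_fun !subr0 sqrrN.
Qed.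

(** Adding the integral to its image under [z -> - z] removes the cross term while all integrands
    stay nonnegative; the doubled identity is then halved. *)
Lemma integral_gauss1_sqr_affine (a c : R) :
  \int[gauss1]_z ((a + c * z) ^+ 2)%:E = (a ^+ 2 + c ^+ 2)%:E.
Proof.
have mA (b : R) : measurable_fun setT (fun z : R => ((a + b * z) ^+ 2)%:E).
  apply/measurable_EFinP; apply: measurable_funX.
  by apply: measurable_funD => //; exact: measurable_funM.
have A0 (b x : R) : 0 <= ((a + b * x) ^+ 2)%:E by rewrite lee_fin sqr_ge0.
set I := LHS.
have IN : I = \int[gauss1]_z ((a + - c * z) ^+ 2)%:E.
  rewrite /I -(@integral_gauss1_opp (fun z : R => ((a + c * z) ^+ 2)%:E))//.
  by apply: eq_integral => z _; rewrite mulrN mulNr.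
have I2 : I + I = ((a ^+ 2 + c ^+ 2) *+ 2)%:E.
  rewrite [X in _ + X]IN -ge0_integralD//.
  transitivity (\int[gauss1]_z ((a ^+ 2 *+ 2)%:E + ((c ^+ 2 *+ 2) * z ^+ 2)%:E)).
    by apply: eq_integral => z _; rewrite -!EFinD; congr (_%:E); ring.
  rewrite ge0_integralD//; last 3 first.
  - by move=> x _; rewrite lee_fin mulrn_wge0// sqr_ge0.
  - by move=> x _; rewrite lee_fin mulr_ge0 ?mulrn_wge0 ?sqr_ge0.
  - by apply/measurable_EFinP; exact: measurable_funM.
  rewrite integral_probability_cst ge0_integralZ_real//; last 2 first.
  - by rewrite mulrn_wge0 ?sqr_ge0.
  - by move=> x; rewrite sqr_ge0.
  by rewrite integral_gauss1_sqr mule1 -EFinD mulrnDl.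
have I0 : 0 <= I by apply: integral_ge0 => x _.
have Ifin : I \is a fin_num.
  rewrite ge0_fin_numE//; case: ltP => //; rewrite leye_eq => /eqP Ioo.
  by move: I2; rewrite Ioo.
rewrite -(fineK Ifin); congr (_%:E); move: I2; rewrite -(fineK Ifin) -EFinD => -[].
by rewrite -mulr2n => /(pmulrnI (isT : (0 < 2)%N)).
Qed.

End gauss1.

(** * The Gaussian block law and its translations *)

Section gaussN.
Local Open Scope ereal_scope.
Context {R : realType}.

Section cons_tuple.
Variable n : nat.

Let cons_tuple (p : R * n.-tuple R) : n.+1.-tuple R := [tuple of p.1 :: p.2].

Let measurable_cons_tuple : measurable_fun setT cons_tuple.
Proof. exact: measurable_cons. Qed.

HB.instance Definition _ := isMeasurableFun.Build _ _ _ _ cons_tuple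
  measurable_cons_tuple.

Definition extend_gauss (P : probability (n.-tuple R) R) :
    probability (n.+1.-tuple R) R :=
  distribution (gauss1 \x P) cons_tuple.

Lemma integral_extend_gauss (P : probability (n.-tuple R) R)
    (F : n.+1.-tuple R -> \bar R) :
  measurable_fun setT F -> (forall x, 0 <= F x) ->
  \int[extend_gauss P]_y F y
  = \int[gauss1]_x \int[P]_t F [tuple of x :: t].
Proof.
move=> mF F0; rewrite ge0_integral_distribution// fubini_tonelli1//=.
by apply: measurableT_comp.
Qed.

End cons_tuple.

(** Built by adding one coordinate at a time, so that Tonelli's theorem yields inductions on the
    block length. *)
Fixpoint gaussN n : probability (n.-tuple R) R :=
  if n is m.+1 then extend_gauss (gaussN m) else dirac [tuple].

Lemma integral_gaussN0 (F : 0.-tuple R -> \bar R) :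
  measurable_fun setT F -> \int[gaussN 0]_y F y = F [tuple].
Proof. by move=> mF; rewrite integral_dirac//= diracT mul1e. Qed.

Lemma integral_gaussN1 n (F : n.+1.-tuple R -> \bar R) :
  measurable_fun setT F -> (forall x, 0 <= F x) ->
  \int[gaussN n.+1]_y F y
  = \int[gauss1]_x \int[gaussN n]_t F [tuple of x :: t].
Proof. exact: integral_extend_gauss. Qed.

Definition vadd n (m y : n.-tuple R) : n.-tuple R :=
  [tuple (tnth m i + tnth y i)%R | i < n].

Lemma measurable_vadd d (T : measurableType d) n (f g : T -> n.-tuple R) :
  measurable_fun setT f -> measurable_fun setT g ->
  measurable_fun setT (fun x => vadd (f x) (g x)).
Proof.
move=> mf mg; apply/measurable_fun_tnthP => i.
rewrite (_ : _ \o _ = fun x => (tnth (f x) i + tnth (g x) i)%R); last first.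
  by apply/funext => x; rewrite /= tnth_mktuple.
by apply: measurable_funD; apply: (@measurableT_comp _ _ _ _ _ _ (fun t => tnth t i)) => //;
  exact: measurable_tnth.
Qed.

Lemma measurable_cons_const n (x : R) :
  measurable_fun setT (fun t : n.-tuple R => [tuple of x :: t]).
Proof. by apply: (measurable_cons (f := cst x)) => //; exact: measurable_id. Qed.

Lemma gaussN_prod n (h : 'I_n -> R -> R) :
  (forall i, measurable_fun setT (h i)) -> (forall i x, (0 <= h i x)%R) ->
  \int[gaussN n]_y (\prod_(i < n) h i (tnth y i))%:E
  = \prod_(i < n) \int[gauss1]_x (h i x)%:E.
Proof.
have mprod m (k : 'I_m -> R -> R) : (forall i, measurable_fun setT (k i)) ->
    measurable_fun setT (fun y : m.-tuple R => (\prod_(i < m) k i (tnth y i))%:E).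
  move=> mk; apply/measurable_EFinP; apply: measurable_prod => i _.
  by apply: measurableT_comp => //; exact: measurable_tnth.
elim: n h => [|n IH] h mh h0.
  by rewrite integral_gaussN0 ?big_ord0//; exact: mprod.
rewrite integral_gaussN1//; last 2 first.
- by apply: mprod.
- by move=> y; rewrite lee_fin prodr_ge0.
transitivity (\int[gauss1]_x ((h ord0 x)%:E *
    \prod_(i < n) \int[gauss1]_x (h (lift ord0 i) x)%:E)).
  apply: eq_integral => x _.
  rewrite -IH//; last first.
  rewrite -ge0_integralZl//; last 3 first.
  - by apply: (mprod _ (fun i => h (lift ord0 i))).
  - by move=> y _; rewrite lee_fin prodr_ge0.
  - by rewrite lee_fin.
  apply: eq_integral => t _; rewrite -EFinM; congr (_%:E).
  rewrite big_ord_recl tnth0; congr (_ * _)%R.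
  by apply: eq_bigr => i _; rewrite tnthS.
rewrite ge0_integralZr//; last 3 first.
- exact/measurable_EFinP.
- by move=> x _; rewrite lee_fin.
- by apply: prode_ge0 => i _; apply: integral_ge0 => x _; rewrite lee_fin.
by rewrite [RHS]big_ord_recl.
Qed.

(** Boxes form a generating system stable under intersection, so these values characterise [gaussN];
    they serve to identify the law of the channel noise blocks. *)
Lemma gaussN_box n (B : 'I_n -> set R) : (forall i, measurable (B i)) ->
  gaussN n [set y | forall i, B i (tnth y i)] = \prod_(i < n) gauss1 (B i).
Proof.
move=> mB.
have boxE : [set y : n.-tuple R | forall i, B i (tnth y i)] =
    \bigcap_(i in [set: 'I_n]) ((fun y => tnth y i) @^-1` B i).
  by apply/seteqP; split => y; [move=> By i _; exact: By|move=> By i; exact: By].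
have mbox : measurable [set y : n.-tuple R | forall i, B i (tnth y i)].
  rewrite boxE; apply: fin_bigcap_measurable => // i _.
  by rewrite -[_ @^-1` _]setTI; exact: measurable_tnth.
transitivity (\int[gaussN n]_y (\prod_(i < n) \1_(B i) (tnth y i))%:E).
  rewrite -[X in gaussN n X]setIT -integral_indic//.
  apply: eq_integral => y _; rewrite indicE; congr (_%:E).
  case: (boolP (y \in _)) => [/set_mem By|].
    by rewrite big1// => i _; rewrite indicE mem_set//; exact: By.
  rewrite notin_setE => /existsNP[i nBi].
  by rewrite (bigD1 i)//= indicE memNset ?mul0r.
rewrite (gaussN_prod (h := fun i => \1_(B i)))//.
  by apply: eq_bigr => i _; rewrite integral_indic// setIT.
Qed.

(** Density, with respect to [gaussN], of a standard Gaussian block translated by [m]. *)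
Definition lik n (m y : n.-tuple R) : R :=
  (\prod_(i < n) (normal_pdf (tnth m i) 1 (tnth y i) / phi (tnth y i)))%R.

Lemma measurable_fun_normal_pdf d (T : measurableType d) (f g : T -> R) (s : R) :
  s != 0%R -> measurable_fun setT f -> measurable_fun setT g ->
  measurable_fun setT (fun x => normal_pdf (f x) s (g x)).
Proof.
move=> s0 mf mg; under eq_fun do rewrite normal_pdfE//.
apply: measurable_funM => //; apply: (@measurableT_comp _ _ _ _ _ _ expR) => //.
apply: measurable_funM => //; apply: measurable_funN; apply: measurable_funX.
exact: measurable_funB.
Qed.

Lemma measurable_fun_inv d (T : measurableType d) (f : T -> R) :
  measurable_fun setT f -> measurable_fun setT (fun x => (f x)^-1%R).
Proof. by apply: measurableT_comp; exact: measurable_inv. Qed.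

Lemma measurable_fun_tnth d (T : measurableType d) n (f : T -> n.-tuple R) i :
  measurable_fun setT f -> measurable_fun setT (fun x => tnth (f x) i).
Proof.
move=> mf; apply: (@measurableT_comp _ _ _ _ _ _ (fun t => tnth t i)) => //.
exact: measurable_tnth.
Qed.

Lemma measurable_lik d (T : measurableType d) n (f g : T -> n.-tuple R) :
  measurable_fun setT f -> measurable_fun setT g ->
  measurable_fun setT (fun x => lik (f x) (g x)).
Proof.
move=> mf mg; apply: measurable_prod => i _; apply: measurable_funM.
  by apply: measurable_fun_normal_pdf; rewrite ?oner_neq0//;
    exact: measurable_fun_tnth.
apply: measurable_fun_inv; apply: (@measurableT_comp _ _ _ _ _ _ phi).
  exact: measurable_phi.
exact: measurable_fun_tnth.
Qed.

Lemma lik_gt0 n (m y : n.-tuple R) : (0 < lik m y)%R.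
Proof.
apply: prodr_gt0 => i _.
apply: divr_gt0; last exact: phi_gt0.
by apply: normal_pdf_gt0; exact: oner_neq0.
Qed.

(** Cameron-Martin formula for blocks, by peeling off the first coordinate. It is the change of
    variables from a noise to the signal that it corrupts, on which the ratio computations below
    rest. *)
Lemma integral_gaussN_shift n (m : n.-tuple R) (F : n.-tuple R -> \bar R) :
  measurable_fun setT F -> (forall x, 0 <= F x) ->
  \int[gaussN n]_z F (vadd m z) = \int[gaussN n]_y (F y * (lik m y)%:E).
Proof.
elim: n m F => [|n IH] m F mF F0.
  rewrite !integral_gaussN0.
  - by rewrite /lik big_ord0 mule1; congr (F _); apply: eq_from_tnth => -[].
  - by apply: emeasurable_funM => //; apply/measurable_EFinP; exact: measurable_lik.
  - by apply: measurableT_comp => //; apply: measurable_vadd.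
pose m' := [tuple tnth m (lift ord0 i) | i < n].
have vaddE (x : R) (t : n.-tuple R) : vadd m [tuple of x :: t] =
    [tuple of (tnth m ord0 + x)%R :: vadd m' t].
  apply: eq_from_tnth => i; rewrite tnth_mktuple.
  case: (unliftP ord0 i) => [j ->|->]; last by rewrite !tnth0.
  by rewrite !tnthS !tnth_mktuple.
have likE (x : R) (t : n.-tuple R) : lik m [tuple of x :: t] =
    (normal_pdf (tnth m ord0) 1 x / phi x * lik m' t)%R.
  rewrite /lik big_ord_recl tnth0; congr (_ * _)%R.
  by apply: eq_bigr => i _; rewrite tnthS tnth_mktuple.
rewrite integral_gaussN1//; last first.
  by apply: measurableT_comp => //; exact: measurable_vadd.
rewrite (@integral_gaussN1 _ (fun y => F y * (lik m y)%:E)); last 2 first.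
- by apply: emeasurable_funM => //; apply/measurable_EFinP; exact: measurable_lik.
- by move=> y; rewrite mule_ge0// lee_fin ltW// lik_gt0.
pose G (x : R) := \int[gaussN n]_t (F [tuple of x :: t] * (lik m' t)%:E).
have mcons : measurable_fun setT (fun p : R * n.-tuple R => [tuple of p.1 :: p.2]).
  exact: measurable_cons.
have mFx (x : R) : measurable_fun setT (fun t : n.-tuple R => F [tuple of x :: t]).
  by apply: (measurableT_comp mF); exact: measurable_cons_const.
have mG : measurable_fun setT G.
  apply: (measurable_fun_fubini_tonelli_F (fun p : R * n.-tuple R =>
    F [tuple of p.1 :: p.2] * (lik m' p.2)%:E)).
    apply: emeasurable_funM; first exact: (measurableT_comp mF).
    by apply/measurable_EFinP; exact: measurable_lik.
  by move=> p; rewrite mule_ge0// lee_fin ltW// lik_gt0.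
have G0 (x : R) : 0 <= G x.
  by apply: integral_ge0 => t _; rewrite mule_ge0// lee_fin ltW// lik_gt0.
transitivity (\int[gauss1]_x G (tnth m ord0 + x)%R).
  apply: eq_integral => x _; rewrite /G.
  rewrite -(IH m' (fun t => F [tuple of (tnth m ord0 + x)%R :: t]))//.
  by apply: eq_integral => t _; rewrite vaddE.
rewrite integral_gauss1_shift//; apply: eq_integral => x _.
rewrite -ge0_integralZr//; last 3 first.
- by apply: emeasurable_funM => //; apply/measurable_EFinP; exact: measurable_lik.
- by move=> t _; rewrite mule_ge0// lee_fin ltW// lik_gt0.
- rewrite lee_fin; apply: divr_ge0; last exact: ltW (phi_gt0 _).
  exact: normal_pdf_ge0.
by apply: eq_integral => t _; rewrite likE -muleA -EFinM mulrC.
Qed.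

Lemma integral_gaussN_tnth n (i : 'I_n) (F : R -> \bar R) :
  measurable_fun setT F -> (forall x, 0 <= F x) ->
  \int[gaussN n]_y F (tnth y i) = \int[gauss1]_x F x.
Proof.
elim: n i => [[]//|n IH] i mF F0; rewrite integral_gaussN1//; last first.
  by apply: (measurableT_comp mF); exact: measurable_tnth.
case: (unliftP ord0 i) => [j ->|->].
  under eq_integral do under eq_integral do rewrite tnthS.
  by rewrite IH// integral_probability_cst.
apply: eq_integral => x _.
under eq_integral do rewrite tnth0.
by rewrite integral_probability_cst.
Qed.

End gaussN.

(** * Means of logarithms *)

Section mean_le.
Local Open Scope ereal_scope.
Context d (T : measurableType d) (R : realType) (P : probability T R).

(* [D] has mean at most [x]; stated through nonnegative functions so that no
   integrability of [D] itself is needed. *)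
Definition mean_le (D : T -> \bar R) (x : R) := exists p n : T -> \bar R,
  [/\ measurable_fun setT p /\ (forall t, 0 <= p t),
      measurable_fun setT n /\ (forall t, 0 <= n t),
      forall t, D t + n t <= p t,
      \int[P]_t n t < +oo & \int[P]_t p t <= x%:E + \int[P]_t n t].

Lemma mean_leD (D1 D2 : T -> \bar R) (x y : R) :
  mean_le D1 x -> mean_le D2 y -> mean_le (fun t => D1 t + D2 t) (x + y).
Proof.
move=> [p1 [n1 [[mp1 p10] [mn1 n10] le1 fin1 int1]]].
move=> [p2 [n2 [[mp2 p20] [mn2 n20] le2 fin2 int2]]].
exists (fun t => p1 t + p2 t), (fun t => n1 t + n2 t); split.
- by split=> [|t]; [exact: emeasurable_funD|exact: adde_ge0].
- by split=> [|t]; [exact: emeasurable_funD|exact: adde_ge0].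
- by move=> t; rewrite addeACA; exact: leeD.
- by rewrite ge0_integralD// lte_add_pinfty.
- by rewrite !ge0_integralD// EFinD [leRHS]addeACA; exact: leeD.
Qed.

(** The exit from mean bounds to numerical inequalities: once all random terms have cancelled
    pointwise, a constant is left as lower bound. *)
Lemma mean_le_cst (D : T -> \bar R) (c x : R) :
  (forall t, c%:E <= D t) -> mean_le D x -> (c <= x)%R.
Proof.
move=> cD [p [n [[mp p0] [mn n0] le fin int]]].
have n_fin : \int[P]_t n t \is a fin_num.
  by rewrite ge0_fin_numE// integral_ge0.
(* Adding [k = max c 0 - c] to both sides makes the integrands nonnegative even when [c] is
   negative. *)
pose c' := Num.max c 0%R; pose k := (c' - c)%R.
have k0 : (0 <= k)%R by rewrite subr_ge0 le_max lexx.
have c'0 : (0 <= c')%R by rewrite le_max lexx orbT.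
have : \int[P]_t (c'%:E + n t) <= \int[P]_t (k%:E + p t).
  apply: ge0_le_integral => //.
  - by move=> t _; rewrite adde_ge0// lee_fin.
  - by apply: emeasurable_funD => //; exact: measurable_cst.
  - by apply: emeasurable_funD => //; exact: measurable_cst.
  move=> t _; rewrite (_ : c' = k + c)%R; last by rewrite subrK.
  rewrite EFinD -addeA leeD2l// (le_trans _ (le t))// leeD2r//.
rewrite !ge0_integralD//; try exact: measurable_cst; try by move=> *; rewrite lee_fin.
rewrite !integral_probability_cst => h.
have := le_trans h (leeD2l k%:E int).
by rewrite [leRHS]addeA leeD2rE// -EFinD lee_fin /k; lra.
Qed.
Lemma mean_le_nonneg (D : T -> \bar R) (x : R) :
  measurable_fun setT D -> (forall t, 0 <= D t) -> \int[P]_t D t <= x%:E ->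
  mean_le D x.
Proof.
move=> mD D0 Dx; exists D, (fun=> 0); split => //.
- by move=> t; rewrite adde0.
- by rewrite integral_probability_cst.
- by rewrite integral_probability_cst adde0.
Qed.

Lemma mean_le_subr1 (D : T -> \bar R) :
  measurable_fun setT D -> (forall t, 0 <= D t) -> \int[P]_t D t <= 1 ->
  mean_le (fun t => D t - 1) 0.
Proof.
move=> mD D0 Dx; exists D, (fun=> 1); split => //.
- by move=> t; rewrite subeK.
- by rewrite integral_probability_cst ltry.
- by rewrite integral_probability_cst add0e.
Qed.

(** Mixtures of bounded positive densities are positive and finite, hence have real logarithms. A
    vanishing integral would make the positive [f] vanish almost everywhere, and the whole space
    would be null. *)
Lemma integral_gt0 (f : T -> R) (c : R) : measurable_fun setT f ->
  (forall t, 0 < f t)%R -> (forall t, f t <= c)%R ->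
  (0 < fine (\int[P]_t (f t)%:E))%R /\
  (fine (\int[P]_t (f t)%:E))%:E = \int[P]_t (f t)%:E.
Proof.
move=> mf f0 fc; have mfE : measurable_fun setT (fun t => (f t)%:E).
  exact/measurable_EFinP.
have I0 : 0 <= \int[P]_t (f t)%:E.
  by apply: integral_ge0 => t _; rewrite lee_fin ltW.
have Ifin : \int[P]_t (f t)%:E \is a fin_num.
  rewrite ge0_fin_numE// (@le_lt_trans _ _ c%:E) ?ltry//.
  rewrite -[leRHS](integral_probability_cst P); apply: ge0_le_integral => //.
  - by move=> t _; rewrite lee_fin ltW.
  - by move=> t _; rewrite lee_fin.
split; last by rewrite fineK.
rewrite fine_gt0// lt_neqAle I0 andbT ltey_eq Ifin eq_sym; apply/andP; split=> //.
apply/eqP => I00.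
have /ae_eq_integral_abs : \int[P]_t `|(f t)%:E| = 0.
  by under eq_integral do rewrite gee0_abs ?lee_fin ?ltW//.
move=> /(_ measurableT mfE) [A [mA A0 sA]].
have := @probability_setT _ _ _ P; suff -> : [set: T] = A.
  by move=> A1; move: (oner_neq0 R); rewrite -(eqe (1:R) 0)%R -A1 A0 eqxx.
apply/seteqP; split => // t _; apply: sA => /= /(_ I) [] /eqP.
by rewrite gt_eqF.
Qed.

End mean_le.

(** * Measurability and Tonelli's theorem in composable form *)

Section measurable_closure.
Local Open Scope ereal_scope.
Context d (T : measurableType d) (R : realType).

Lemma measurable_fun_fst d1 d2 (T1 : measurableType d1) (T2 : measurableType d2)
    (f : T -> T1 * T2) :
  measurable_fun setT f -> measurable_fun setT (fun x => (f x).1).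
Proof. by move=> mf; apply: (measurableT_comp measurable_fst). Qed.

Lemma measurable_fun_snd d1 d2 (T1 : measurableType d1) (T2 : measurableType d2)
    (f : T -> T1 * T2) :
  measurable_fun setT f -> measurable_fun setT (fun x => (f x).2).
Proof. by move=> mf; apply: (measurableT_comp measurable_snd). Qed.

Lemma measurable_fun_EFin (f : T -> R) :
  measurable_fun setT f -> measurable_fun setT (fun x => (f x)%:E).
Proof. by move=> mf; exact/measurable_EFinP. Qed.

Lemma measurable_fun_fine (f : T -> \bar R) :
  measurable_fun setT f -> measurable_fun setT (fun x => fine (f x)).
Proof. by move=> mf; exact: (measurableT_comp (@fine_measurable R _ measurableT)). Qed.

Lemma measurable_fun_comp d1 d2 (T1 : measurableType d1) (T2 : measurableType d2)
    (g : T1 -> T2) (f : T -> T1) :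
  measurable_fun setT g -> measurable_fun setT f ->
  measurable_fun setT (fun x => g (f x)).
Proof. by move=> mg mf; exact: measurableT_comp. Qed.

Lemma measurable_fun_integral d1 (T1 : measurableType d1)
    (P : probability T1 R) (f : T * T1 -> \bar R) :
  measurable_fun setT f -> (forall p, 0 <= f p) ->
  measurable_fun setT (fun x => \int[P]_y f (x, y)).
Proof. by move=> mf f0; exact: measurable_fun_fubini_tonelli_F. Qed.

Definition prob_prod d1 d2 (T1 : measurableType d1) (T2 : measurableType d2)
    (P1 : probability T1 R) (P2 : probability T2 R) :
  probability (T1 * T2)%type R := P1 \x P2.

Lemma tonelli_prod d1 d2 (T1 : measurableType d1) (T2 : measurableType d2)
    (P1 : probability T1 R) (P2 : probability T2 R) (F : T1 -> T2 -> \bar R) :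
  measurable_fun setT (fun p => F p.1 p.2) -> (forall x y, 0 <= F x y) ->
  \int[prob_prod P1 P2]_p F p.1 p.2 = \int[P1]_x \int[P2]_y F x y.
Proof. by move=> mF F0; rewrite fubini_tonelli1. Qed.

Lemma tonelli_swap d1 d2 (T1 : measurableType d1) (T2 : measurableType d2)
    (P1 : probability T1 R) (P2 : probability T2 R) (F : T1 -> T2 -> \bar R) :
  measurable_fun setT (fun p => F p.1 p.2) -> (forall x y, 0 <= F x y) ->
  \int[P1]_x \int[P2]_y F x y = \int[P2]_y \int[P1]_x F x y.
Proof.
by move=> mF F0; rewrite (fubini_tonelli (fun p => F p.1 p.2)).
Qed.

Lemma integral_mono d1 (T1 : measurableType d1) (P : probability T1 R)
    (f g : T1 -> \bar R) :
  measurable_fun setT f -> measurable_fun setT g ->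
  (forall x, 0 <= f x) -> (forall x, f x <= g x) ->
  \int[P]_x f x <= \int[P]_x g x.
Proof. by move=> mf mg f0 fg; exact: ge0_le_integral. Qed.

Lemma integral_le_cst d1 (T1 : measurableType d1) (P : probability T1 R)
    (f : T1 -> \bar R) (c : \bar R) :
  measurable_fun setT f -> (forall x, 0 <= f x) -> (forall x, f x <= c) ->
  \int[P]_x f x <= c.
Proof.
move=> mf f0 fc; rewrite -[leRHS](integral_probability_cst P).
by apply: ge0_le_integral.
Qed.

End measurable_closure.

(** Extension point of [measurability]: it is redefined when new measurable functions are
    introduced, so that their closure lemmas are tried as well. *)
Ltac measurability_hook := fail.

Ltac measurability :=
  repeat first
    [ match goal with
      | H : measurable_fun _ ?g |- measurable_fun _ ?h =>
          constr_eq g h; exact: H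
      end
    | lazymatch goal with
      | |- measurable_fun _ (fun _ => ?c) => exact: measurable_cst
      | |- measurable_fun _ fst => exact: measurable_fst
      | |- measurable_fun _ snd => exact: measurable_snd
      | |- measurable_fun _ (fun x => x) => exact: measurable_id
      | |- measurable_fun _ (fun x => EFin (@?f1 x)) => apply: measurable_fun_EFin
      | |- measurable_fun _ (fun x => fst (@?f1 x)) => apply: measurable_fun_fst
      | |- measurable_fun _ (fun x => snd (@?f1 x)) => apply: measurable_fun_snd
      | |- measurable_fun _ (fun x => ((@?f1 x), (@?f2 x))) => apply: measurable_fun_pair
      | |- measurable_fun _ (fun x => lik (@?f1 x) (@?f2 x)) => apply: measurable_lik
      | |- measurable_fun _ (fun x => vadd (@?f1 x) (@?f2 x)) => apply: measurable_vadd
      | |- measurable_fun _ (fun x => GRing.inv (@?f1 x)) => apply: measurable_fun_inv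
      | |- measurable_fun _ (fun x => GRing.mul (@?f1 x) (@?f2 x)) => apply: measurable_funM
      | |- measurable_fun _ (fun x => mule (@?f1 x) (@?f2 x)) => apply: emeasurable_funM
      | |- measurable_fun _ (fun x => integral _ _ (@?F x)) =>
          let f := eval cbv beta in (fun p => F p.1 p.2) in
          apply: (@measurable_fun_integral _ _ _ _ _ _ f)
      | |- _ =>
          first
            [ measurability_hook
            | match goal with
              | H : measurable_fun _ ?g |- measurable_fun _ (fun x => ?h (@?f x)) =>
                  constr_eq g h; apply: (measurable_fun_comp H)
              | |- measurable_fun ?D ?g =>
                  lazymatch g with
                  | (fun x => @?h x) => fail
                  | _ => suff: measurable_fun D (fun x => g x) by []
                  end
              end ]
      end ].

(** * A soft decision in place of the decoder *)

Section weak_decoder.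
Local Open Scope ereal_scope.
Context {R : realType} dG (G : measurableType dG) (M : nat) (dec : G -> nat).
Hypotheses (M_gt0 : (0 < M)%N) (mdec : measurable_fun setT dec).

(* Half of the mass sits on the decoded message and half is spread uniformly:
   this replaces Fano's inequality. *)
Definition guess (m : nat) (y : G) : R :=
  (if dec y == m then 2^-1 else (2 * M%:R)^-1)%R.

Lemma guess_gt0 m y : (0 < guess m y)%R.
Proof. by rewrite /guess; case: ifP; rewrite invr_gt0// mulr_gt0// ltr0n. Qed.

Lemma measurable_guess d (T : measurableType d) (f : T -> nat) (g : T -> G) :
  measurable_fun setT f -> measurable_fun setT g ->
  measurable_fun setT (fun x => guess (f x) (g x)).
Proof.
move=> mf mg; apply: measurable_fun_ifT => //.
by apply: measurable_fun_eqn => //; exact: measurableT_comp.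
Qed.

(** [M * guess] is at most [M / 2] on the decoded message, whose probability is at most [1 / M],
    plus [1 / 2] everywhere. It is thus a sub-density in the message for each fixed observation. *)
Lemma integral_guess_le1 (P : probability nat R) y :
  (forall m, P [set m] <= (M%:R^-1)%:E) ->
  \int[P]_m (M%:R * guess m y)%:E <= 1.
Proof.
move=> PM; have M0 : (0 < M%:R :> R)%R by rewrite ltr0n.
apply: (@le_trans _ _ (\int[P]_m ((M%:R / 2 * \1_[set dec y] m)%:E + (2^-1)%:E))).
  apply: ge0_le_integral => //.
  - by move=> m _; rewrite lee_fin mulr_ge0// ltW// guess_gt0.
  move=> m _; rewrite -EFinD lee_fin /guess indicE in_set1 eq_sym.
  case: ifP => _; first by rewrite mulr1 lerDl.
  by rewrite mulr0 add0r invfM mulrCA mulfV ?gt_eqF// mulr1.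
rewrite ge0_integralD//.
rewrite integral_probability_cst ge0_integralZ_real//.
rewrite integral_indic// setIT.
apply: (@le_trans _ _ ((M%:R / 2)%:E * (M%:R^-1)%:E + (2^-1)%:E)).
  by rewrite leeD2r// lee_pmul2l// ?lte_fin ?divr_gt0//; exact: PM.
rewrite -EFinM -EFinD lee_fin; rewrite mulrAC mulfV ?gt_eqF//; lra.
Qed.

End weak_decoder.

(** * Likelihood ratios of mean at most one *)

Section converse.
Local Open Scope ereal_scope.
Context (R : realType) (N : nat).
Local Notation G := (N.-tuple R).
Local Notation gN := (@gaussN R N).
Context dS (S1 : measurableType dS) (tau : probability S1 R).
Context dU (U : measurableType dU) (kappa : probability U R).
Context (pi1 : probability nat R) dV (V : measurableType dV).
Variables (v : U -> V) (a : nat * V * S1 -> G) (b c : U -> G) (w2 : U -> nat).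
Hypotheses (mv : measurable_fun setT v) (ma : measurable_fun setT a)
  (mb : measurable_fun setT b) (mc : measurable_fun setT c)
  (mw2 : measurable_fun setT w2).

(* A point is [((u, (w, t)), (z1, (z2, z3)))]: [u] carries the message and local
   randomness of user 2, [w] and [t] those of user 1, [z1] and [z2] are the
   channel noises and [z3] the noise of the genie signal [side]. *)
Definition theta_law : probability (U * (nat * S1))%type R :=
  prob_prod kappa (prob_prod pi1 tau).

Definition space_law : probability (U * (nat * S1) * (G * (G * G)))%type R :=
  prob_prod theta_law (prob_prod gN (prob_prod gN gN)).

Definition direct (th : U * (nat * S1)) : G := a (th.2.1, v th.1, th.2.2).

Lemma measurable_direct d (T : measurableType d) (f : T -> U * (nat * S1)) :
  measurable_fun setT f -> measurable_fun setT (fun x => direct (f x)).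
Proof. by move=> mf; rewrite /direct; measurability. Qed.

Lemma integral_theta_law (F : U * (nat * S1) -> \bar R) :
  measurable_fun setT F -> (forall x, 0 <= F x) ->
  \int[theta_law]_th F th
  = \int[kappa]_u \int[pi1]_w \int[tau]_t F (u, (w, t)).
Proof.
move=> mF F0; rewrite fubini_tonelli1//; apply: eq_integral => u _.
rewrite [LHS]fubini_tonelli1//.
by apply: (measurable_fun_comp mF); measurability.
Qed.

Lemma integral_space_law (F : U * (nat * S1) * (G * (G * G)) -> \bar R) :
  measurable_fun setT F -> (forall x, 0 <= F x) ->
  \int[space_law]_x F x
  = \int[theta_law]_th \int[gN]_z1 \int[gN]_z2 \int[gN]_z3 F (th, (z1, (z2, z3))).
Proof.
move=> mF F0; rewrite fubini_tonelli1//; apply: eq_integral => th _.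
rewrite [LHS]fubini_tonelli1//; last first.
  by apply: (measurable_fun_comp mF); measurability.
apply: eq_integral => z1 _; rewrite [LHS]fubini_tonelli1//.
by apply: (measurable_fun_comp mF); measurability.
Qed.

(** Conditional density of the genie signal given the message and the cooperative signal, the local
    randomness of user 1 being averaged out. *)
Definition direct_lik (x : nat * V) (s : G) : R :=
  fine (\int[tau]_t (lik (a (x, t)) s)%:E).

(** The peak of the normal density bounds [lik] uniformly in its mean, which makes the mixtures of
    likelihoods finite. *)
Definition lik_bound (y : G) : R :=
  (\prod_(i < N) (normal_peak 1 / phi (tnth y i)))%R.

Lemma lik_le (m y : G) : (lik m y <= lik_bound y)%R.
Proof.
apply: ler_prod => i _; apply/andP; split.
  apply: divr_ge0; last exact: ltW (phi_gt0 _).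
  exact: normal_pdf_ge0.
rewrite ler_pM2r ?invr_gt0; last exact: phi_gt0.
by apply: normal_pdf_ub; exact: oner_neq0.
Qed.

Lemma direct_likP x s : (0 < direct_lik x s)%R /\
  (direct_lik x s)%:E = \int[tau]_t (lik (a (x, t)) s)%:E.
Proof.
apply: (@integral_gt0 _ _ _ tau _ (lik_bound s)).
- by measurability.
- by move=> t; exact: lik_gt0.
- by move=> t; exact: lik_le.
Qed.

Lemma measurable_direct_lik d (T : measurableType d) (f : T -> nat * V) (g : T -> G) :
  measurable_fun setT f -> measurable_fun setT g ->
  measurable_fun setT (fun x => direct_lik (f x) (g x)).
Proof.
move=> mf mg; apply: measurable_fun_fine; measurability.
by move=> p; rewrite lee_fin ltW// lik_gt0.
Qed.
Ltac measurability_hook ::=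
  lazymatch goal with
  | |- measurable_fun _ (fun x => direct_lik (@?f1 x) (@?f2 x)) => apply: measurable_direct_lik
  | |- measurable_fun _ (fun x => guess _ _ (@?f1 x) (@?f2 x)) => apply: measurable_guess
  | |- measurable_fun _ (fun x => direct (@?f1 x)) => apply: measurable_direct
  end.

Lemma lik_ge0 (m y : G) : (0 <= lik m y)%R.
Proof. by rewrite ltW// lik_gt0. Qed.

Lemma direct_lik_gt0 x s : (0 < direct_lik x s)%R.
Proof. by case: (direct_likP x s). Qed.

Lemma direct_lik_ge0 x s : (0 <= direct_lik x s)%R.
Proof. by rewrite ltW// direct_lik_gt0. Qed.

Lemma integral_gaussN_lik (m : G) : \int[gN]_y (lik m y)%:E = 1.
Proof.
transitivity (\int[gN]_y (1 * (lik m y)%:E)).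
  by apply: eq_integral => y _; rewrite mul1e.
rewrite -(integral_gaussN_shift m (F := fun=> 1))//.
exact: integral_probability_cst.
Qed.

Lemma integral_direct_lik x : \int[gN]_s (direct_lik x s)%:E = 1.
Proof.
have mL : measurable_fun setT (fun p : G * S1 => (lik (a (x, p.2)) p.1)%:E).
  by measurability.
transitivity (\int[gN]_s \int[tau]_t (lik (a (x, t)) s)%:E).
  by apply: eq_integral => s _; rewrite (direct_likP x s).2.
rewrite (fubini_tonelli (fun p : G * S1 => (lik (a (x, p.2)) p.1)%:E))//=; last first.
  by move=> p; rewrite lee_fin lik_ge0.
rewrite -[RHS](integral_probability_cst tau); apply: eq_integral => t _.
exact: integral_gaussN_lik.
Qed.

Local Notation gN2 := (prob_prod gN gN).

Local Notation space := (U * (nat * S1) * (G * (G * G)))%type.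

Definition out1 (x : space) : G := vadd (b x.1.1) (vadd (direct x.1) x.2.1).
Definition out2 (x : space) : G := vadd (c x.1.1) x.2.2.1.
Definition side (x : space) : G := vadd (direct x.1) x.2.2.2.

Lemma measurable_out1 d (T : measurableType d) (f : T -> space) :
  measurable_fun setT f -> measurable_fun setT (fun x => out1 (f x)).
Proof. by move=> mf; rewrite /out1; measurability. Qed.

Lemma measurable_out2 d (T : measurableType d) (f : T -> space) :
  measurable_fun setT f -> measurable_fun setT (fun x => out2 (f x)).
Proof. by move=> mf; rewrite /out2; measurability. Qed.

Lemma measurable_side d (T : measurableType d) (f : T -> space) :
  measurable_fun setT f -> measurable_fun setT (fun x => side (f x)).
Proof. by move=> mf; rewrite /side; measurability. Qed.

Ltac measurability_hook ::=
  lazymatch goal with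
  | |- measurable_fun _ (fun x => direct_lik (@?f1 x) (@?f2 x)) => apply: measurable_direct_lik
  | |- measurable_fun _ (fun x => guess _ _ (@?f1 x) (@?f2 x)) => apply: measurable_guess
  | |- measurable_fun _ (fun x => direct (@?f1 x)) => apply: measurable_direct
  | |- measurable_fun _ (fun x => out1 (@?f1 x)) => apply: measurable_out1
  | |- measurable_fun _ (fun x => out2 (@?f1 x)) => apply: measurable_out2
  | |- measurable_fun _ (fun x => side (@?f1 x)) => apply: measurable_side
  end.

(** Ratio behind [N R1 <= h(s + hc x2 | y2) - h(s | W1, v21)]. The test density [D] may depend on
    [u]: for fixed [u], a density of [s + hc x2] is a translate of a density of [s], and so the
    interference is accommodated. *)
Definition code1_ratio (M : nat) (dec : G -> nat) (D : U * G * G -> R)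
    (x : space) : R :=
  M%:R * guess M dec x.1.2.1 (vadd (b x.1.1) (side x)) *
  D (x.1.1, out2 x, side x) / direct_lik (x.1.2.1, v x.1.1) (side x).

Section code1_ratio.
Variables (M : nat) (dec : G -> nat) (D : U * G * G -> R).
Hypotheses (M_gt0 : (0 < M)%N) (mdec : measurable_fun setT dec)
  (pi1M : forall m, pi1 [set m] <= (M%:R^-1)%:E)
  (mD : measurable_fun setT D) (D_ge0 : forall x, (0 <= D x)%R)
  (D_le1 : forall u y, \int[gN]_s (D (u, y, s))%:E <= 1).

Let guess0 w y : (0 <= M%:R * guess M dec w y :> R)%R.
Proof. by rewrite mulr_ge0// ltW// guess_gt0. Qed.

Let K (u : U) (w : nat) (p : G * G) : R :=
  (M%:R * guess M dec w (vadd (b u) p.2) * D (u, vadd (c u) p.1, p.2))%R.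

Let K0 u w p : (0 <= K u w p)%R. Proof. by rewrite mulr_ge0. Qed.

Let measurable_K d (T : measurableType d) (f : T -> U) (g : T -> nat)
    (h : T -> G * G) :
  measurable_fun setT f -> measurable_fun setT g -> measurable_fun setT h ->
  measurable_fun setT (fun x => K (f x) (g x) (h x)).
Proof. by move=> mf mg mh; rewrite /K; measurability. Qed.

Let H (u : U) (w : nat) (t : S1) (p : G * G) : R :=
  (K u w p * (lik (a (w, v u, t)) p.2 / direct_lik (w, v u) p.2))%R.

Let H0 u w t p : (0 <= H u w t p)%R.
Proof. by rewrite mulr_ge0// divr_ge0 ?lik_ge0 ?direct_lik_ge0. Qed.

Let measurable_H d (T : measurableType d) (f : T -> U) (g : T -> nat)
    (s : T -> S1) (h : T -> G * G) :
  measurable_fun setT f -> measurable_fun setT g -> measurable_fun setT s ->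
  measurable_fun setT h ->
  measurable_fun setT (fun x => H (f x) (g x) (s x) (h x)).
Proof.
move=> mf mg ms mh; apply: measurable_funM; first exact: measurable_K.
by measurability.
Qed.

Let D_pair_le1 u : \int[gN2]_p (D (u, vadd (c u) p.1, p.2))%:E <= 1.
Proof.
have -> : \int[gN2]_p (D (u, vadd (c u) p.1, p.2))%:E =
    \int[gN]_z2 \int[gN]_s (D (u, vadd (c u) z2, s))%:E.
  rewrite (tonelli_prod gN gN (F := fun z s : G => (D (u, vadd (c u) z, s))%:E)).
  - by [].
  - by measurability.
  - by move=> z s; rewrite lee_fin.
apply: integral_le_cst => [|z2|z2]; last exact: D_le1.
- by measurability => p; rewrite lee_fin.
- by apply: integral_ge0 => s _; rewrite lee_fin.
Qed.

Let integral_K_le u p : \int[pi1]_w (K u w p)%:E <= (D (u, vadd (c u) p.1, p.2))%:E.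
Proof.
rewrite [leLHS](_ : _ = (D (u, vadd (c u) p.1, p.2))%:E *
    \int[pi1]_w (M%:R * guess M dec w (vadd (b u) p.2))%:E); last first.
  rewrite -ge0_integralZl ?lee_fin//.
    by apply: eq_integral => w _; rewrite -EFinM mulrC.
  by move=> w _; rewrite lee_fin.
by rewrite -[leRHS]mule1 lee_wpmul2l ?lee_fin// integral_guess_le1.
Qed.

(** Averaging [lik] over the local randomness of user 1 produces exactly [direct_lik], which cancels
    the denominator. *)
Let integral_H u w : \int[tau]_t \int[gN2]_p (H u w t p)%:E = \int[gN2]_p (K u w p)%:E.
Proof.
rewrite (tonelli_swap tau gN2 (F := fun t p => (H u w t p)%:E)); last 2 first.
- by apply: measurable_fun_EFin; apply: measurable_H; measurability.
- by move=> t p; rewrite lee_fin.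
apply: eq_integral => p _; have [r0 rE] := direct_likP (w, v u) p.2.
transitivity (\int[tau]_t ((K u w p / direct_lik (w, v u) p.2)%:E *
    (lik (a (w, v u, t)) p.2)%:E)).
  apply: eq_integral => t _; rewrite -EFinM; congr (_%:E).
  by rewrite /H mulrA mulrAC.
rewrite ge0_integralZl; last 4 first.
- by [].
- by measurability.
- by move=> t _; rewrite lee_fin lik_ge0.
- by rewrite lee_fin divr_ge0// ltW.
by rewrite -rE -EFinM divfK// gt_eqF.
Qed.

Let integral_H_le1 u : \int[pi1]_w \int[tau]_t \int[gN2]_p (H u w t p)%:E <= 1.
Proof.
under eq_integral do rewrite integral_H.
rewrite (tonelli_swap pi1 gN2 (F := fun w p => (K u w p)%:E)); last 2 first.
- by apply: measurable_fun_EFin; apply: measurable_K; measurability.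
- by move=> w p; rewrite lee_fin.
apply: le_trans (D_pair_le1 u); apply: ge0_le_integral => //.
- by move=> p _; apply: integral_ge0 => w _; rewrite lee_fin.
- measurability; last by move=> p; rewrite lee_fin.
  by apply: measurable_K; measurability.
- by measurability.
Qed.

(** For fixed [u], the average over the local randomness cancels [direct_lik], the average over the
    message removes the guess since [D] does not see the message, and [D] has mass at most one. The
    message is integrated with the value of [side] held fixed, which becomes possible once the
    translation by [direct] has been absorbed into [lik]. *)
Lemma code1_ratio_le1 : \int[space_law]_x (code1_ratio M dec D x)%:E <= 1.
Proof.
rewrite integral_space_law; last 2 first.
- by rewrite /code1_ratio /side /out2; measurability.
- move=> x; rewrite lee_fin divr_ge0 ?direct_lik_ge0//.
  by rewrite mulr_ge0// mulr_ge0// ltW// guess_gt0.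
have -> : \int[theta_law]_th \int[gN]_z1 \int[gN]_z2 \int[gN]_z3
    (code1_ratio M dec D (th, (z1, (z2, z3))))%:E =
    \int[theta_law]_th \int[gN2]_p (H th.1 th.2.1 th.2.2 p)%:E.
  apply: eq_integral => th _.
  rewrite -[RHS](integral_probability_cst gN); apply: eq_integral => z1 _.
  rewrite (tonelli_prod gN gN (F := fun z s : G => (H th.1 th.2.1 th.2.2 (z, s))%:E)); last 2 first.
  - by apply: measurable_fun_EFin; apply: measurable_H; measurability.
  - by move=> z s; rewrite lee_fin.
  apply: eq_integral => z2 _.
  pose F s := (K th.1 th.2.1 (z2, s) / direct_lik (th.2.1, v th.1) s)%:E.
  transitivity (\int[gN]_s (F s * (lik (direct th) s)%:E)).
    rewrite -(@integral_gaussN_shift _ _ (direct th) F).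
    - by [].
    - apply: measurable_fun_EFin; apply: measurable_funM; last by measurability.
      by apply: measurable_K; measurability.
    - by move=> s; rewrite lee_fin divr_ge0 ?direct_lik_ge0.
  apply: eq_integral => s _; rewrite /F -EFinM; congr (_%:E).
  by rewrite /H mulrA mulrAC.
rewrite integral_theta_law; last 2 first.
- measurability; last by move=> p; rewrite lee_fin.
  by apply: measurable_H; measurability.
- by move=> th; apply: integral_ge0 => p _; rewrite lee_fin.
apply: integral_le_cst => [|u|u]; last exact: integral_H_le1.
- measurability.
  + by apply: measurable_H; measurability.
  + by move=> p; rewrite lee_fin.
  + by move=> p; apply: integral_ge0 => q _; rewrite lee_fin.
  + by move=> p; do 2 apply: integral_ge0 => ? _; rewrite lee_fin.
- by do 3 apply: integral_ge0 => ? _; rewrite lee_fin.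
Qed.

End code1_ratio.
Lemma vaddA n (x y z : n.-tuple R) : vadd x (vadd y z) = vadd (vadd x y) z.
Proof. by apply: eq_from_tnth => i; rewrite !tnth_mktuple addrA. Qed.

Definition mean1 (th : U * (nat * S1)) : G := vadd (b th.1) (direct th).

Lemma out1E x : out1 x = vadd (mean1 x.1) x.2.1.
Proof. by rewrite /out1 vaddA. Qed.

Lemma measurable_mean1 d (T : measurableType d) (f : T -> U * (nat * S1)) :
  measurable_fun setT f -> measurable_fun setT (fun x => mean1 (f x)).
Proof. by move=> mf; rewrite /mean1; measurability. Qed.

Ltac measurability_hook ::=
  lazymatch goal with
  | |- measurable_fun _ (fun x => direct_lik (@?f1 x) (@?f2 x)) => apply: measurable_direct_lik
  | |- measurable_fun _ (fun x => guess _ _ (@?f1 x) (@?f2 x)) => apply: measurable_guess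
  | |- measurable_fun _ (fun x => direct (@?f1 x)) => apply: measurable_direct
  | |- measurable_fun _ (fun x => out1 (@?f1 x)) => apply: measurable_out1
  | |- measurable_fun _ (fun x => out2 (@?f1 x)) => apply: measurable_out2
  | |- measurable_fun _ (fun x => side (@?f1 x)) => apply: measurable_side
  | |- measurable_fun _ (fun x => mean1 (@?f1 x)) => apply: measurable_mean1
  end.

Definition out1_lik (y : G) : R :=
  fine (\int[theta_law]_th (lik (mean1 th) y)%:E).

(** Given the point [th], the noises of [side] and [out1] are independent, so their joint density is
    a mixture of products. *)
Definition joint_lik (s y : G) : R :=
  fine (\int[theta_law]_th (lik (direct th) s * lik (mean1 th) y)%:E).

Definition cond_lik (s y : G) : R := joint_lik s y / out1_lik y.

Lemma out1_likP y : (0 < out1_lik y)%R /\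
  (out1_lik y)%:E = \int[theta_law]_th (lik (mean1 th) y)%:E.
Proof.
apply: (@integral_gt0 _ _ _ theta_law _ (lik_bound y)).
- by measurability.
- by move=> t; exact: lik_gt0.
- by move=> t; exact: lik_le.
Qed.

Lemma joint_likP s y : (0 < joint_lik s y)%R /\
  (joint_lik s y)%:E =
  \int[theta_law]_th (lik (direct th) s * lik (mean1 th) y)%:E.
Proof.
apply: (@integral_gt0 _ _ _ theta_law _ (lik_bound s * lik_bound y)).
- by measurability.
- by move=> t; rewrite mulr_gt0 ?lik_gt0.
- by move=> t; rewrite ler_pM ?lik_ge0 ?lik_le.
Qed.

Lemma cond_lik_gt0 s y : (0 < cond_lik s y)%R.
Proof. by rewrite divr_gt0//; [case: (joint_likP s y)|case: (out1_likP y)]. Qed.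

Lemma measurable_out1_lik d (T : measurableType d) (f : T -> G) :
  measurable_fun setT f -> measurable_fun setT (fun x => out1_lik (f x)).
Proof.
move=> mf; apply: measurable_fun_fine; measurability.
by move=> p; rewrite lee_fin lik_ge0.
Qed.

Lemma measurable_joint_lik d (T : measurableType d) (f g : T -> G) :
  measurable_fun setT f -> measurable_fun setT g ->
  measurable_fun setT (fun x => joint_lik (f x) (g x)).
Proof.
move=> mf mg; apply: measurable_fun_fine; measurability.
by move=> p; rewrite lee_fin mulr_ge0 ?lik_ge0.
Qed.

Lemma measurable_cond_lik d (T : measurableType d) (f g : T -> G) :
  measurable_fun setT f -> measurable_fun setT g ->
  measurable_fun setT (fun x => cond_lik (f x) (g x)).
Proof.
move=> mf mg; apply: measurable_funM; first exact: measurable_joint_lik.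
by apply: measurable_fun_inv; exact: measurable_out1_lik.
Qed.

Ltac measurability_hook ::=
  lazymatch goal with
  | |- measurable_fun _ (fun x => direct_lik (@?f1 x) (@?f2 x)) => apply: measurable_direct_lik
  | |- measurable_fun _ (fun x => guess _ _ (@?f1 x) (@?f2 x)) => apply: measurable_guess
  | |- measurable_fun _ (fun x => direct (@?f1 x)) => apply: measurable_direct
  | |- measurable_fun _ (fun x => out1 (@?f1 x)) => apply: measurable_out1
  | |- measurable_fun _ (fun x => out2 (@?f1 x)) => apply: measurable_out2
  | |- measurable_fun _ (fun x => side (@?f1 x)) => apply: measurable_side
  | |- measurable_fun _ (fun x => mean1 (@?f1 x)) => apply: measurable_mean1
  | |- measurable_fun _ (fun x => out1_lik (@?f1 x)) => apply: measurable_out1_lik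
  | |- measurable_fun _ (fun x => joint_lik (@?f1 x) (@?f2 x)) => apply: measurable_joint_lik
  | |- measurable_fun _ (fun x => cond_lik (@?f1 x) (@?f2 x)) => apply: measurable_cond_lik
  end.

Lemma integral_out1_lik : \int[gN]_y (out1_lik y)%:E = 1.
Proof.
transitivity (\int[gN]_y \int[theta_law]_th (lik (mean1 th) y)%:E).
  by apply: eq_integral => y _; rewrite (out1_likP y).2.
rewrite (tonelli_swap gN theta_law (F := fun y th => (lik (mean1 th) y)%:E)).
- rewrite -[RHS](integral_probability_cst theta_law); apply: eq_integral => th _.
  exact: integral_gaussN_lik.
- by measurability.
- by move=> y th; rewrite lee_fin lik_ge0.
Qed.

Lemma integral_cond_lik y : \int[gN]_s (cond_lik s y)%:E = 1.
Proof.
have [q0 oE] := out1_likP y.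
transitivity (\int[gN]_s ((out1_lik y)^-1 * joint_lik s y)%:E).
  by apply: eq_integral => s _; rewrite /cond_lik mulrC.
rewrite ge0_integralZ_real.
- transitivity ((out1_lik y)^-1%:E * (out1_lik y)%:E); last first.
    by rewrite -EFinM mulVf// gt_eqF.
  congr (_ * _); rewrite oE.
  transitivity (\int[gN]_s \int[theta_law]_th
      (lik (mean1 th) y * lik (direct th) s)%:E).
    apply: eq_integral => s _; rewrite (joint_likP s y).2.
    by apply: eq_integral => th _; rewrite mulrC.
  rewrite (tonelli_swap gN theta_law
    (F := fun s th => (lik (mean1 th) y * lik (direct th) s)%:E)).
  + apply: eq_integral => th _; rewrite ge0_integralZ_real.
    * by rewrite integral_gaussN_lik mule1.
    * exact: lik_ge0.
    * by measurability.
    * by move=> s; exact: lik_ge0.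
  + by measurability.
  + by move=> s th; rewrite lee_fin mulr_ge0 ?lik_ge0.
- by rewrite invr_ge0 ltW.
- by apply: measurable_joint_lik; measurability.
- by move=> s; rewrite ltW//; case: (joint_likP s y).
Qed.

Section code2_ratio.
Variables (M : nat) (dec : G -> nat) (PW : probability nat R)
  (PY : probability G R) (f : nat * G -> R).
Hypotheses (M_gt0 : (0 < M)%N) (mdec : measurable_fun setT dec)
  (PWM : forall m, PW [set m] <= (M%:R^-1)%:E)
  (mf : measurable_fun setT f) (f_ge0 : forall p, (0 <= f p)%R).
Hypothesis fE : forall F : nat * G -> \bar R,
  measurable_fun setT F -> (forall p, 0 <= F p) ->
  \int[space_law]_x F (w2 x.1.1, out1 x)
  = \int[prob_prod PW PY]_p (F p * (f p)%:E).

(* [f] is the density of the law of ([w2], [out1]) with respect to the product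
   [PW \x PY]; it is modified where it vanishes, so as to have a logarithm. *)
Definition pos_density (p : nat * G) : R := if f p == 0%R then 1%R else f p.

Lemma pos_density_gt0 p : (0 < pos_density p)%R.
Proof. by rewrite /pos_density; case: eqVneq => // fp; rewrite lt_neqAle eq_sym fp/=. Qed.

Lemma measurable_pos_density d (T : measurableType d) (g : T -> nat * G) :
  measurable_fun setT g -> measurable_fun setT (fun x => pos_density (g x)).
Proof.
move=> mg; apply: measurable_fun_ifT; last by measurability.
- by apply: measurable_fun_eqr; measurability.
- by measurability.
Qed.

Let guess0 w y : (0 <= M%:R * guess M dec w y :> R)%R.
Proof. by rewrite mulr_ge0// ltW// guess_gt0. Qed.

(** Ratio behind [N R2 <= h(y2 | y1) - h(z2)]: [H] is a test density of the second output given the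
    first, [lik] the true density given the data of user 2, and [pos_density] pays for the
    dependence between message and first output. [H] takes extended values because it will also be a
    mixture over the genie signal. *)
Definition code2_ratio (H : G * G -> \bar R) (x : space) : \bar R :=
  (M%:R * guess M dec (w2 x.1.1) (out2 x) / lik (c x.1.1) (out2 x)
    / pos_density (w2 x.1.1, out1 x))%:E * H (out1 x, out2 x).

Variable H : G * G -> \bar R.
Hypotheses (mH : measurable_fun setT H) (H_ge0 : forall p, 0 <= H p)
  (H_le1 : forall y1, \int[gN]_y2 H (y1, y2) <= 1).

Let K (p : nat * G) : \bar R :=
  \int[gN]_y2 ((M%:R * guess M dec p.1 y2)%:E * H (p.2, y2)).

Let K0 p : 0 <= K p.
Proof. by apply: integral_ge0 => y _; rewrite mule_ge0// lee_fin. Qed.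

Let mK : measurable_fun setT K.
Proof. by rewrite /K; measurability => p; rewrite mule_ge0// lee_fin. Qed.

Let integral_K_le1 : \int[prob_prod PW PY]_p K p <= 1.
Proof.
rewrite (tonelli_prod PW PY (F := fun w y => K (w, y))); last 2 first.
- by apply: (measurable_fun_comp mK); measurability.
- by move=> w y; exact: K0.
rewrite (tonelli_swap PW PY (F := fun w y => K (w, y))); last 2 first.
- by apply: (measurable_fun_comp mK); measurability.
- by move=> w y; exact: K0.
apply: integral_le_cst => [|y|y].
- by measurability => p; exact: K0.
- by apply: integral_ge0 => w _; exact: K0.
rewrite /K /=.
rewrite (tonelli_swap PW gN
  (F := fun w y2 => (M%:R * guess M dec w y2)%:E * H (y, y2))); last 2 first.
- by measurability.
- by move=> w y2; rewrite mule_ge0// lee_fin.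
apply: le_trans (H_le1 y); apply: ge0_le_integral => //.
- by move=> y2 _; apply: integral_ge0 => w _; rewrite mule_ge0// lee_fin.
- by measurability => p; rewrite mule_ge0// lee_fin.
- by measurability.
move=> y2 _; rewrite ge0_integralZr//; last by move=> w _; rewrite lee_fin.
by rewrite -[leRHS]mul1e lee_wpmul2r// integral_guess_le1.
Qed.

(** Integrating the noise of the second output cancels [lik] and leaves a function of the second
    message and the first output alone. Division by [pos_density] then bounds the integral under
    their joint law by the one under the product law, where the guess and [H] integrate one after
    the other. *)
Lemma code2_ratio_le1 : \int[space_law]_x code2_ratio H x <= 1.
Proof.
pose F (p : nat * G) : \bar R := ((pos_density p)^-1)%:E * K p.
have F0 p : 0 <= F p.
  by rewrite mule_ge0// lee_fin invr_ge0 ltW// pos_density_gt0.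
have mF : measurable_fun setT F.
  apply: emeasurable_funM => //; apply: measurable_fun_EFin.
  by apply: measurable_fun_inv; apply: measurable_pos_density; measurability.
have mcode : measurable_fun setT (code2_ratio H).
  apply: emeasurable_funM; last by measurability.
  apply: measurable_fun_EFin; apply: measurable_funM; first by measurability.
  by apply: measurable_fun_inv; apply: measurable_pos_density; measurability.
have code0 x : 0 <= code2_ratio H x.
  rewrite mule_ge0// lee_fin divr_ge0 ?(ltW (pos_density_gt0 _))//.
  by rewrite divr_ge0 ?lik_ge0.
have -> : \int[space_law]_x code2_ratio H x = \int[space_law]_x F (w2 x.1.1, out1 x).
  rewrite integral_space_law// integral_space_law; last 2 first.
  - by apply: (measurable_fun_comp mF); measurability.
  - by [].
  apply: eq_integral => th _; apply: eq_integral => z1 _.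
  set y1 := vadd (b th.1) (vadd (direct th) z1).
  pose F2 y2 : \bar R := (M%:R * guess M dec (w2 th.1) y2 / lik (c th.1) y2
    / pos_density (w2 th.1, y1))%:E * H (y1, y2).
  transitivity (\int[gN]_z2 F2 (vadd (c th.1) z2)).
    apply: eq_integral => z2 _.
    exact: (integral_probability_cst gN (F2 (vadd (c th.1) z2))).
  transitivity (\int[gN]_z2 \int[gN]_z3 F (w2 th.1, y1)); last by [].
  transitivity (F (w2 th.1, y1)); last by rewrite !integral_probability_cst.
  rewrite integral_gaussN_shift; last 2 first.
  - by rewrite /F2; measurability.
  - move=> y2; rewrite mule_ge0// lee_fin divr_ge0 ?(ltW (pos_density_gt0 _))//.
    by rewrite divr_ge0 ?lik_ge0.
  rewrite /F /K -ge0_integralZl//.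
  - apply: eq_integral => y2 _; rewrite /F2 muleAC -EFinM [RHS]muleA -EFinM.
    congr (_%:E * _); have := lik_gt0 (c th.1) y2; move: (lik _ _) => l l0.
    have := pos_density_gt0 (w2 th.1, y1); move: (pos_density _) => q q0.
    by field; rewrite !gt_eqF.
  - by measurability.
  - by move=> y2 _; rewrite mule_ge0// lee_fin.
  - by rewrite lee_fin invr_ge0 ltW// pos_density_gt0.
rewrite fE//; apply: le_trans integral_K_le1; apply: ge0_le_integral => //.
- by move=> p _; rewrite mule_ge0// lee_fin.
- by apply: emeasurable_funM => //; exact: measurable_fun_EFin.
move=> p _; rewrite /F muleAC -EFinM -[leRHS]mul1e lee_wpmul2r// lee_fin.
rewrite /pos_density; case: eqVneq => [->|fp]; first by rewrite mulr0.
by rewrite mulVf.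
Qed.

End code2_ratio.
Lemma cond_lik_ge0 s y : (0 <= cond_lik s y)%R.
Proof. by rewrite ltW// cond_lik_gt0. Qed.

Let integral_side_shift th (A : G -> R) :
  measurable_fun setT A -> (forall s, 0 <= A s)%R ->
  \int[gN]_z3 (A (vadd (direct th) z3) / lik (direct th) (vadd (direct th) z3))%:E
  = \int[gN]_s (A s)%:E.
Proof.
move=> mA A0.
rewrite (integral_gaussN_shift (direct th)
  (F := fun s => (A s / lik (direct th) s)%:E)); last 2 first.
- by measurability.
- by move=> s; rewrite lee_fin divr_ge0 ?lik_ge0.
by apply: eq_integral => s _; rewrite -EFinM divfK// gt_eqF// lik_gt0.
Qed.

(** That its mean logarithm is at most 0 says [h(s | W1, v21) >= h(z3)]: given everything user 1
    knows, only the noise of [side] is random. *)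
Definition likelihood_gain (x : space) : R :=
  direct_lik (x.1.2.1, v x.1.1) (side x) / lik (direct x.1) (side x).

Lemma likelihood_gain_le1 : \int[space_law]_x (likelihood_gain x)%:E <= 1.
Proof.
have gain0 x : (0 <= likelihood_gain x)%R.
  by rewrite divr_ge0 ?direct_lik_ge0 ?lik_ge0.
rewrite integral_space_law; last 2 first.
- by rewrite /likelihood_gain; measurability.
- by move=> x; rewrite lee_fin.
rewrite le_eqVlt; apply/orP; left; apply/eqP.
rewrite -[RHS](integral_probability_cst theta_law); apply: eq_integral => th _.
rewrite -[RHS](integral_probability_cst gN); apply: eq_integral => z1 _.
rewrite -[RHS](integral_probability_cst gN); apply: eq_integral => z2 _.
rewrite (integral_side_shift th (A := direct_lik (th.2.1, v th.1))).
- exact: integral_direct_lik.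
- by measurability.
- by move=> s; exact: direct_lik_ge0.
Qed.

Section side_ratio.
Variables (M : nat) (dec : G -> nat) (PW : probability nat R)
  (PY : probability G R) (f : nat * G -> R).
Hypotheses (M_gt0 : (0 < M)%N) (mdec : measurable_fun setT dec)
  (PWM : forall m, PW [set m] <= (M%:R^-1)%:E)
  (mf : measurable_fun setT f) (f_ge0 : forall p, (0 <= f p)%R).
Hypothesis fE : forall F : nat * G -> \bar R,
  measurable_fun setT F -> (forall p, 0 <= F p) ->
  \int[space_law]_x F (w2 x.1.1, out1 x)
  = \int[prob_prod PW PY]_p (F p * (f p)%:E).
Variable D : G * G * G -> R.
Hypotheses (mD : measurable_fun setT D) (D_ge0 : forall p, (0 <= D p)%R)
  (D_le1 : forall y1 s, \int[gN]_y2 (D (y1, s, y2))%:E <= 1).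

(** Ratio behind [N R2 <= h(y2 | s, y1) + h(s | y1) - h(z2) - h(z3)]: the genie signal enters with
    its true conditional density [cond_lik], and only the second output gets a test density [D]. *)
Definition side_ratio (x : space) : R :=
  M%:R * guess M dec (w2 x.1.1) (out2 x) / lik (c x.1.1) (out2 x)
    / pos_density f (w2 x.1.1, out1 x) *
  (D (out1 x, side x, out2 x) * cond_lik (side x) (out1 x)
    / lik (direct x.1) (side x)).

Let H (p : G * G) : \bar R :=
  \int[gN]_s (D (p.1, s, p.2) * cond_lik s p.1)%:E.

Let mH : measurable_fun setT H.
Proof.
rewrite /H; measurability => p.
by rewrite lee_fin mulr_ge0// cond_lik_ge0.
Qed.

Let H_ge0 p : 0 <= H p.
Proof.
by apply: integral_ge0 => s _; rewrite lee_fin mulr_ge0// cond_lik_ge0.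
Qed.

Let H_le1 y1 : \int[gN]_y2 H (y1, y2) <= 1.
Proof.
rewrite (tonelli_swap gN gN
  (F := fun y2 s => (D (y1, s, y2) * cond_lik s y1)%:E)); last 2 first.
- by measurability.
- by move=> y2 s; rewrite lee_fin mulr_ge0// cond_lik_ge0.
apply: (@le_trans _ _ (\int[gN]_s (cond_lik s y1)%:E)); last first.
  by rewrite integral_cond_lik.
apply: integral_mono => [||s|s].
- measurability => p.
  rewrite lee_fin.
 apply: mulr_ge0; [exact: D_ge0|exact: cond_lik_ge0].
- by measurability.
- apply: integral_ge0 => y2 _.
  by rewrite lee_fin mulr_ge0// cond_lik_ge0.
rewrite [leLHS](_ : _ = (cond_lik s y1)%:E *
    \int[gN]_y2 (D (y1, s, y2))%:E); last first.
  rewrite -ge0_integralZ_real//.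
  - by apply: eq_integral => y2 _; rewrite mulrC.
  - by rewrite cond_lik_ge0.
  - by measurability.
rewrite -[leRHS]mule1; apply: lee_wpmul2l; last exact: D_le1.
by rewrite lee_fin cond_lik_ge0.
Qed.

(** Integrating the genie noise cancels [lik (direct x.1)] and reduces the claim to
    [code2_ratio_le1], with [H] the mixture of [D] over [cond_lik]. *)
Lemma side_ratio_le1 : \int[space_law]_x (side_ratio x)%:E <= 1.
Proof.
have guess0 w y : (0 <= M%:R * guess M dec w y :> R)%R.
  by rewrite mulr_ge0// ltW// guess_gt0.
have code0 x : (0 <= M%:R * guess M dec (w2 x.1.1) (out2 x)
    / lik (c x.1.1) (out2 x) / pos_density f (w2 x.1.1, out1 x))%R.
  by rewrite divr_ge0 ?(ltW (pos_density_gt0 f_ge0 _))// divr_ge0 ?lik_ge0.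
have mcode : measurable_fun setT (fun x : space =>
    M%:R * guess M dec (w2 x.1.1) (out2 x)
    / lik (c x.1.1) (out2 x) / pos_density f (w2 x.1.1, out1 x))%R.
  apply: measurable_funM; first by measurability.
  by apply: measurable_fun_inv; apply: measurable_pos_density; measurability.
have := @code2_ratio_le1 M dec PW PY f M_gt0 mdec PWM mf f_ge0 fE H mH H_ge0 H_le1.
rewrite [X in X <= 1 -> _]integral_space_law; last 2 first.
- by apply: emeasurable_funM; [apply: measurable_fun_EFin|measurability].
- by move=> x; rewrite mule_ge0// lee_fin.
rewrite [X in _ -> X <= 1]integral_space_law; last 2 first.
- apply: measurable_fun_EFin; apply: measurable_funM => //.
  by measurability.
- move=> x; rewrite lee_fin mulr_ge0// divr_ge0 ?lik_ge0// mulr_ge0//.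
  by rewrite cond_lik_ge0.
apply: le_trans; rewrite le_eqVlt; apply/orP; left; apply/eqP.
apply: eq_integral => th _; apply: eq_integral => z1 _; apply: eq_integral => z2 _.
set y1 := vadd (b th.1) (vadd (direct th) z1).
set y2 := vadd (c th.1) z2.
set A := (M%:R * guess M dec (w2 th.1) y2 / lik (c th.1) y2
    / pos_density f (w2 th.1, y1))%R.
transitivity (A%:E * H (y1, y2)); last first.
  by rewrite -[LHS](integral_probability_cst gN).
rewrite /H -(integral_side_shift th (A := fun s => D (y1, s, y2) * cond_lik s y1)%R); last 2 first.
- by measurability.
- by move=> s; rewrite mulr_ge0// cond_lik_ge0.
rewrite -ge0_integralZ_real//.
- exact: (code0 (th, (z1, (z2, z2)))).
- by measurability.
- move=> s; rewrite divr_ge0 ?lik_ge0// mulr_ge0//.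
  by rewrite cond_lik_ge0.
Qed.

End side_ratio.

Section decoupling_ratio.
Variables (M : nat) (dec : G -> nat).
Hypotheses (M_gt0 : (0 < M)%N) (mdec : measurable_fun setT dec)
  (pi1M : forall m, pi1 [set m] <= (M%:R^-1)%:E)
  (mV1 : forall x : V, measurable [set x]).

Definition message_mass (w : nat) : R := fine (pi1 [set w]).
Definition signal_mass (x : V) : R := fine (kappa (v @^-1` [set x])).

Hypothesis mmass : measurable_fun setT signal_mass.

(** Ratio behind [h(s | y1) - h(s | W1, v21) <= H(v21)]. For a uniform message [M * message_mass] is
    1 on the support; [guess] at [out1] expresses that the first output reveals [W1], and
    [signal_mass] contributes the entropy of the cooperative signal. *)
Definition decoupling_ratio (x : space) : R :=
  M%:R * guess M dec x.1.2.1 (out1 x) * message_mass x.1.2.1 *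
  signal_mass (v x.1.1) * direct_lik (x.1.2.1, v x.1.1) (side x)
  / cond_lik (side x) (out1 x).

Let guess0 w y : (0 <= M%:R * guess M dec w y :> R)%R.
Proof. by rewrite mulr_ge0// ltW// guess_gt0. Qed.

Let J (u : U) (w : nat) (p : G * G) : R :=
  (M%:R * guess M dec w p.1 * direct_lik (w, v u) p.2)%R.

Let J0 u w p : (0 <= J u w p)%R.
Proof. by rewrite mulr_ge0 ?direct_lik_ge0. Qed.

(** Sub-density of [side] given the first output in which message and cooperative signal are drawn
    afresh, weighted by the guess. *)
Let B (p : G * G) : \bar R := \int[kappa]_u \int[pi1]_w (J u w p)%:E.

Let mB : measurable_fun setT B.
Proof.
rewrite /B /J; measurability.
- by move=> p; rewrite lee_fin mulr_ge0 ?direct_lik_ge0.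
- by move=> p; apply: integral_ge0 => w _; rewrite lee_fin mulr_ge0 ?direct_lik_ge0.
Qed.

Let B0 p : 0 <= B p.
Proof. by do 2 apply: integral_ge0 => ? _; rewrite lee_fin J0. Qed.

Let integral_B_le1 y : \int[gN]_s B (y, s) <= 1.
Proof.
rewrite /B (tonelli_swap gN kappa
  (F := fun s u => \int[pi1]_w (J u w (y, s))%:E)); last 2 first.
- by rewrite /J; measurability => p; rewrite lee_fin mulr_ge0 ?direct_lik_ge0.
- by move=> s u; apply: integral_ge0 => w _; rewrite lee_fin J0.
apply: integral_le_cst => [|u|u].
- rewrite /J; measurability.
  + by move=> p; rewrite lee_fin mulr_ge0 ?direct_lik_ge0.
  + by move=> p; apply: integral_ge0 => w _; rewrite lee_fin mulr_ge0 ?direct_lik_ge0.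
- by do 2 apply: integral_ge0 => ? _; rewrite lee_fin J0.
rewrite (tonelli_swap gN pi1 (F := fun s w => (J u w (y, s))%:E)); last 2 first.
- by rewrite /J; measurability.
- by move=> s w; rewrite lee_fin J0.
apply: (@le_trans _ _ (\int[pi1]_w (M%:R * guess M dec w y)%:E)); last first.
  exact: integral_guess_le1.
apply: integral_mono => [||w|w].
- rewrite /J; measurability.
  by move=> p; rewrite lee_fin mulr_ge0 ?direct_lik_ge0.
- by measurability.
- by apply: integral_ge0 => s _; rewrite lee_fin J0.
rewrite [leLHS](_ : _ = (M%:R * guess M dec w y)%:E *
    \int[gN]_s (direct_lik (w, v u) s)%:E); last first.
  rewrite -ge0_integralZ_real.
  - by [].
  - exact: guess0.
  - by measurability.
  - by move=> s; exact: direct_lik_ge0.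
by rewrite integral_direct_lik mule1.
Qed.

(** Of the mixture [B] only the atom of the actual message and cooperative signal is kept.
    Discreteness enters here: keeping one atom costs the logarithm of its mass, on average an
    entropy. *)
Let mass_le_B u w p :
  (J u w p * message_mass w * signal_mass (v u))%:E <= B p.
Proof.
have mvu : measurable (v @^-1` [set v u]) by rewrite -[_ @^-1` _]setTI; exact: mv.
have massE : (message_mass w)%:E = pi1 [set w] by rewrite fineK// fin_num_measure.
have smassE : (signal_mass (v u))%:E = kappa (v @^-1` [set v u]).
  by rewrite fineK// fin_num_measure.
apply: (@le_trans _ _ (\int[kappa]_u'
    ((J u w p * message_mass w)%:E * (\1_(v @^-1` [set v u]) u')%:E))).
  rewrite ge0_integralZl//; last 2 first.
  - exact/measurable_EFinP/measurable_indic.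
  - by rewrite lee_fin mulr_ge0// fine_ge0.
  rewrite integral_indic// setIT EFinM; apply: lee_wpmul2l.
    by rewrite lee_fin mulr_ge0// fine_ge0.
  by rewrite smassE.
apply: integral_mono => [||u'|u'].
- apply: emeasurable_funM; first exact: measurable_cst.
  exact/measurable_EFinP/measurable_indic.
- rewrite /J; measurability.
  by move=> q; rewrite lee_fin mulr_ge0 ?direct_lik_ge0.
- by rewrite mule_ge0// lee_fin mulr_ge0// fine_ge0.
rewrite indicE; have [/set_mem/= vu|_] := boolP (u' \in _); last first.
  by rewrite mule0; apply: integral_ge0 => w' _; rewrite lee_fin J0.
rewrite mule1; apply: (@le_trans _ _ (\int[pi1]_w'
    ((J u w p)%:E * (\1_[set w] w')%:E))).
  rewrite [leRHS](_ : _ = (J u w p)%:E * \int[pi1]_w' (\1_[set w] w')%:E).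
    rewrite integral_indic// setIT EFinM.
    by apply: lee_wpmul2l; rewrite ?lee_fin// massE.
  by apply: ge0_integralZl => //; rewrite lee_fin.
apply: integral_mono => [||w'|w'].
- exact: emeasurable_funM.
- by rewrite /J; measurability.
- by rewrite mule_ge0// lee_fin.
rewrite indicE; have [/set_mem/= ->|_] := boolP (w' \in _); last first.
  by rewrite mule0 lee_fin J0.
by rewrite mule1 lee_fin /J vu.
Qed.

(** The numerator is at most [B], and the joint density of [side] and [out1] divided by [cond_lik]
    is [out1_lik]. What remains is the integral of [out1_lik y * B (y, s)], where [B] has mass at
    most one in [s] for each [y]. *)
Lemma decoupling_ratio_le1 : \int[space_law]_x (decoupling_ratio x)%:E <= 1.
Proof.
have mmessage : measurable_fun setT message_mass by [].
have mass0 w : (0 <= message_mass w)%R by rewrite fine_ge0.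
have smass0 x : (0 <= signal_mass x)%R by rewrite fine_ge0.
pose L (th : U * (nat * S1)) (p : G * G) : R := (J th.1 th.2.1 p * message_mass th.2.1 *
  signal_mass (v th.1) / cond_lik p.2 p.1)%R.
have L0 th p : (0 <= L th p)%R.
  by rewrite divr_ge0 ?cond_lik_ge0// mulr_ge0// mulr_ge0.
have mL d (T : measurableType d) (g : T -> U * (nat * S1)) (h : T -> G * G) :
    measurable_fun setT g -> measurable_fun setT h ->
    measurable_fun setT (fun x => L (g x) (h x)).
  by move=> mg mh; rewrite /L /J; measurability.
have LE x : (decoupling_ratio x = L x.1 (out1 x, side x))%R.
  by rewrite /decoupling_ratio /L /J /=; congr (_ / _)%R; ring.
rewrite integral_space_law; last 2 first.
- by rewrite /decoupling_ratio; measurability.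
- by move=> x; rewrite LE lee_fin.
pose K (th : U * (nat * S1)) (p : G * G) : R :=
  (L th p * (lik (direct th) p.2 * lik (mean1 th) p.1))%R.
have K0 th p : (0 <= K th p)%R by rewrite mulr_ge0// mulr_ge0 ?lik_ge0.
have mK : measurable_fun setT (fun q : (U * (nat * S1)) * (G * G) => (K q.1 q.2)%:E).
  by apply: measurable_fun_EFin; apply: measurable_funM; [apply: mL|]; measurability.
have -> : \int[theta_law]_th \int[gN]_z1 \int[gN]_z2 \int[gN]_z3
    (decoupling_ratio (th, (z1, (z2, z3))))%:E
    = \int[theta_law]_th \int[gN2]_p (K th p)%:E.
  apply: eq_integral => th _.
  rewrite (tonelli_prod gN gN (F := fun y s : G => (K th (y, s))%:E)); last 2 first.
  - by apply: measurable_fun_EFin; apply: measurable_funM; [apply: mL|]; measurability.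
  - by move=> y s; rewrite lee_fin.
  pose F1 y : \bar R := \int[gN]_s (L th (y, s) * lik (direct th) s)%:E.
  transitivity (\int[gN]_z1 F1 (vadd (mean1 th) z1)).
    apply: eq_integral => z1 _.
    transitivity (\int[gN]_z2 F1 (vadd (mean1 th) z1)).
      apply: eq_integral => z2 _; rewrite /F1.
      transitivity (\int[gN]_s ((L th (vadd (mean1 th) z1, s))%:E * (lik (direct th) s)%:E)).
        rewrite -(integral_gaussN_shift (direct th)
          (F := fun s => (L th (vadd (mean1 th) z1, s))%:E)).
        + by apply: eq_integral => z3 _; rewrite LE out1E.
        + by apply: measurable_fun_EFin; apply: mL; measurability.
        + by move=> s; rewrite lee_fin.
      by apply: eq_integral => s _; rewrite EFinM.
    exact: integral_probability_cst.
  rewrite integral_gaussN_shift; last 2 first.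
  - rewrite /F1; measurability; first by apply: mL; measurability.
    by move=> p; rewrite lee_fin mulr_ge0 ?lik_ge0.
  - by move=> y; apply: integral_ge0 => s _; rewrite lee_fin mulr_ge0 ?lik_ge0.
  apply: eq_integral => y _; rewrite muleC -ge0_integralZ_real.
  - by apply: eq_integral => s _; rewrite /K mulrC mulrA.
  - exact: lik_ge0.
  - by apply: measurable_funM; [apply: mL|]; measurability.
  - by move=> s; rewrite mulr_ge0 ?lik_ge0.
rewrite (tonelli_swap theta_law gN2 (F := fun th p => (K th p)%:E)); last 2 first.
- exact: mK.
- by move=> th p; rewrite lee_fin.
apply: (@le_trans _ _ (\int[gN2]_p ((out1_lik p.1)%:E * B p))).
  apply: integral_mono => [||p|p].
  - measurability; last by move=> p; rewrite lee_fin.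
    by apply: measurable_funM; [apply: mL|]; measurability.
  - by measurability.
  - by apply: integral_ge0 => th _; rewrite lee_fin.
  have [j0 jE] := joint_likP p.2 p.1; have [q0 qE] := out1_likP p.1.
  have cE : (cond_lik p.2 p.1 = joint_lik p.2 p.1 / out1_lik p.1)%R by [].
  have c0 := cond_lik_gt0 p.2 p.1.
  apply: (@le_trans _ _ (\int[theta_law]_th (((cond_lik p.2 p.1)^-1%:E * B p) *
      (lik (direct th) p.2 * lik (mean1 th) p.1)%:E))).
    apply: integral_mono => [||th|th].
    + by apply: measurable_fun_EFin; apply: measurable_funM; [apply: mL|]; measurability.
    + by measurability.
    + by rewrite lee_fin.
    rewrite /K /L EFinM; apply: lee_wpmul2r; first by rewrite lee_fin mulr_ge0 ?lik_ge0.
    rewrite mulrC EFinM; apply: lee_wpmul2l; first by rewrite lee_fin invr_ge0 ltW.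
    exact: mass_le_B.
  rewrite ge0_integralZl//; last 3 first.
  - by measurability.
  - by move=> th _; rewrite lee_fin mulr_ge0 ?lik_ge0.
  - by rewrite mule_ge0// lee_fin invr_ge0 ltW.
  rewrite -jE muleAC -EFinM (_ : _ * _ = out1_lik p.1)%R//.
  by rewrite cE; field; rewrite !gt_eqF.
rewrite (tonelli_prod gN gN (F := fun y s => (out1_lik y)%:E * B (y, s))); last 2 first.
- by measurability.
- move=> y s; rewrite mule_ge0// lee_fin ltW//.
  by case: (out1_likP y).
apply: (@le_trans _ _ (\int[gN]_y (out1_lik y)%:E)); last by rewrite integral_out1_lik.
apply: integral_mono => [||y|y].
- measurability => p; rewrite mule_ge0// lee_fin ltW//.
  by case: (out1_likP p.1).
- by measurability.
- apply: integral_ge0 => s _; rewrite mule_ge0// lee_fin ltW//.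
  by case: (out1_likP y).
have q0 : 0 <= (out1_lik y)%:E by rewrite lee_fin ltW//; case: (out1_likP y).
rewrite [leLHS](_ : _ = (out1_lik y)%:E * \int[gN]_s B (y, s)).
  by rewrite -[leRHS]mule1; apply: lee_wpmul2l; [exact: q0|exact: integral_B_le1].
apply: ge0_integralZl; [exact: measurableT| |by move=> s _; exact: B0|exact: q0].
by measurability.
Qed.

End decoupling_ratio.

(** * From ratios to bounds on the numbers of messages *)

Section log_bounds.
Local Notation mean_le := (mean_le space_law).

Lemma ln_le_subr1 (x : R) : (0 < x)%R -> (ln x <= x - 1)%R.
Proof.
move=> x0; have := @le_ln1Dx R (x - 1)%R.
by rewrite ltrBrDl subrr addrCA subrr addr0; exact.
Qed.

Lemma mean_le_ratio (L : space -> R) :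
  measurable_fun setT L -> (forall x, 0 < L x)%R ->
  \int[space_law]_x (L x)%:E <= 1 -> mean_le (fun x => (ln (L x))%:E) 0%R.
Proof.
move=> mL L0 L1; exists (fun x => (L x)%:E), (fun=> 1); split => //.
- by split; [exact/measurable_EFinP|move=> x; rewrite lee_fin ltW].
- by move=> x; rewrite -EFinD lee_fin -lerBrDr ln_le_subr1.
- by rewrite integral_probability_cst ltry.
- by rewrite integral_probability_cst add0e.
Qed.
Variables (M1 M2 : nat) (dec1 dec2 : G -> nat).
Hypotheses (M1_gt0 : (0 < M1)%N) (mdec1 : measurable_fun setT dec1)
  (pi1M : forall m, pi1 [set m] <= (M1%:R^-1)%:E).
Hypotheses (M2_gt0 : (0 < M2)%N) (mdec2 : measurable_fun setT dec2).

(** [direct_lik] is in the denominator of [code1_ratio] and in the numerator of [likelihood_gain],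
    so it disappears from the sum of the logarithms. *)
Lemma message1_bound (D : U * G * G -> R) (e x : R) :
  measurable_fun setT D -> (forall p, 0 < D p)%R ->
  (forall u y, \int[gN]_s (D (u, y, s))%:E <= 1) ->
  mean_le (fun x => (- ln (guess M1 dec1 x.1.2.1 (vadd (b x.1.1) (side x))))%:E) e ->
  mean_le (fun x => (- ln (D (x.1.1, out2 x, side x))
    + ln (lik (direct x.1) (side x)))%:E) x ->
  (ln (M1%:R : R) <= e + x)%R.
Proof.
move=> mD D0 D1 me mx.
have D0' p : (0 <= D p)%R by rewrite ltW.
have M0 : (0 < M1%:R :> R)%R by rewrite ltr0n.
have c0 y : (0 < code1_ratio M1 dec1 D y)%R.
  by rewrite divr_gt0 ?direct_lik_gt0// !mulr_gt0// guess_gt0.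
have g0 y : (0 < likelihood_gain y)%R.
  by rewrite divr_gt0 ?direct_lik_gt0 ?lik_gt0.
have mc1 : mean_le (fun x => (ln (code1_ratio M1 dec1 D x))%:E) 0%R.
  apply: mean_le_ratio => //; last exact: code1_ratio_le1.
  by rewrite /code1_ratio; measurability.
have mg : mean_le (fun x => (ln (likelihood_gain x))%:E) 0%R.
  apply: mean_le_ratio => //; last exact: likelihood_gain_le1.
  by rewrite /likelihood_gain; measurability.
have := mean_leD (mean_leD me mx) (mean_leD mc1 mg).
rewrite !addr0; apply: mean_le_cst => y.
rewrite -!EFinD lee_fin /code1_ratio /likelihood_gain.
have q0 := guess_gt0 dec1 M1_gt0 y.1.2.1 (vadd (b y.1.1) (side y)) (R := R).
have Dy := D0 (y.1.1, out2 y, side y).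
have r0 := direct_lik_gt0 (y.1.2.1, v y.1.1) (side y).
have l0 := lik_gt0 (direct y.1) (side y).
rewrite !ln_div ?posrE ?mulr_gt0// !lnM ?posrE ?mulr_gt0//; lra.
Qed.

Section secrecy.
Variables (PW : probability nat R) (PY : probability G R) (f : nat * G -> R).
Hypotheses (PWM : forall m, PW [set m] <= (M2%:R^-1)%:E)
  (mf : measurable_fun setT f) (f_ge0 : forall p, (0 <= f p)%R).
Hypothesis fE : forall F : nat * G -> \bar R,
  measurable_fun setT F -> (forall p, 0 <= F p) ->
  \int[space_law]_x F (w2 x.1.1, out1 x)
  = \int[prob_prod PW PY]_p (F p * (f p)%:E).
Variables (e2 l : R).
Hypotheses
  (me2 : mean_le (fun x => (- ln (guess M2 dec2 (w2 x.1.1) (out2 x)))%:E) e2)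
  (ml : mean_le (fun x => (ln (pos_density f (w2 x.1.1, out1 x)))%:E) l).

Lemma message2_bound (D : G * G -> R) (x : R) :
  measurable_fun setT D -> (forall p, 0 < D p)%R ->
  (forall y1, \int[gN]_y2 (D (y1, y2))%:E <= 1) ->
  mean_le (fun x => (- ln (D (out1 x, out2 x))
    + ln (lik (c x.1.1) (out2 x)))%:E) x ->
  (ln (M2%:R : R) <= e2 + x + l)%R.
Proof.
move=> mD D0 D1 mx.
have M0 : (0 < M2%:R :> R)%R by rewrite ltr0n.
pose L y := (M2%:R * guess M2 dec2 (w2 y.1.1) (out2 y) / lik (c y.1.1) (out2 y)
    / pos_density f (w2 y.1.1, out1 y) * D (out1 y, out2 y))%R.
have L0 y : (0 < L y)%R.
  by rewrite mulr_gt0// divr_gt0 ?pos_density_gt0// divr_gt0 ?lik_gt0// mulr_gt0// guess_gt0.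
have mL : measurable_fun setT L.
  apply: measurable_funM; last by measurability.
  apply: measurable_funM; first by measurability.
  by apply: measurable_fun_inv; apply: measurable_pos_density; measurability.
have mlL : mean_le (fun x => (ln (L x))%:E) 0%R.
  apply: mean_le_ratio => //.
  have D0' p : 0 <= (D p)%:E by rewrite lee_fin ltW.
  have := code2_ratio_le1 M2_gt0 mdec2 PWM mf f_ge0 fE
    (measurable_fun_EFin mD) D0' D1.
  by apply: le_trans; rewrite le_eqVlt; apply/orP; left; apply/eqP;
    apply: eq_integral => y _.
have := mean_leD (mean_leD (mean_leD me2 mx) ml) mlL.
rewrite addr0; apply: mean_le_cst => y; rewrite -!EFinD lee_fin /L.
have q0 := guess_gt0 dec2 M2_gt0 (w2 y.1.1) (out2 y) (R := R).
have Dy := D0 (out1 y, out2 y).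
have f0 := pos_density_gt0 f_ge0 (w2 y.1.1, out1 y).
have l0 := lik_gt0 (c y.1.1) (out2 y).
move: (guess _ _ _ _) q0 (D _) Dy (pos_density _ _) f0 (lik _ _) l0.
move=> q q0 d Dy g f0 k l0.
rewrite lnM ?posrE ?divr_gt0 ?mulr_gt0// !ln_div ?posrE ?divr_gt0 ?mulr_gt0//.
rewrite lnM ?posrE//; lra.
Qed.

(** The value [+oo] at 0 makes the pointwise inequality of the sum bound trivial where a mass
    vanishes. *)
Definition neg_ln (t : R) : \bar R := if t == 0%R then +oo else (- ln t)%:E.

(** In the product of the three ratios both unknown densities cancel: [direct_lik] between
    [code1_ratio] and [decoupling_ratio], [cond_lik] between [side_ratio] and [decoupling_ratio].
    The losses [e1] and [e1'] belong to the same decoder, fed with the genie version of the output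
    and with the true one. *)
Lemma sum_messages_bound (D1 : U * G * G -> R) (D2 : G * G * G -> R)
    (e1 e1' x h1 h2 : R) :
  (forall x : V, measurable [set x]) -> measurable_fun setT signal_mass ->
  measurable_fun setT D1 -> (forall p, 0 < D1 p)%R ->
  (forall u y, \int[gN]_s (D1 (u, y, s))%:E <= 1) ->
  measurable_fun setT D2 -> (forall p, 0 < D2 p)%R ->
  (forall y1 s, \int[gN]_y2 (D2 (y1, s, y2))%:E <= 1) ->
  mean_le (fun x => (- ln (guess M1 dec1 x.1.2.1 (vadd (b x.1.1) (side x))))%:E) e1 ->
  mean_le (fun x => (- ln (guess M1 dec1 x.1.2.1 (out1 x)))%:E) e1' ->
  mean_le (fun x => (- ln (D1 (x.1.1, out2 x, side x))
    - ln (D2 (out1 x, side x, out2 x))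
    + ln (lik (c x.1.1) (out2 x)) + ln (lik (direct x.1) (side x)))%:E) x ->
  mean_le (fun x => neg_ln (M1%:R * message_mass x.1.2.1)%R) h1 ->
  mean_le (fun x => neg_ln (signal_mass (v x.1.1))) h2 ->
  (ln (M1%:R : R) + ln (M2%:R : R) <= e1 + e1' + e2 + x + l + h1 + h2)%R.
Proof.
move=> mV1 mmass mD1 D10 D11 mD2 D20 D21 me1 me1' mx mh1 mh2.
have mmessage : measurable_fun setT message_mass by [].
have D10' p : (0 <= D1 p)%R by rewrite ltW.
have D20' p : (0 <= D2 p)%R by rewrite ltW.
have M10 : (0 < M1%:R :> R)%R by rewrite ltr0n.
have M20 : (0 < M2%:R :> R)%R by rewrite ltr0n.
have c0 y : (0 < code1_ratio M1 dec1 D1 y)%R.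
  by rewrite divr_gt0 ?direct_lik_gt0// !mulr_gt0// guess_gt0.
have mlc : mean_le (fun x => (ln (code1_ratio M1 dec1 D1 x))%:E) 0%R.
  apply: mean_le_ratio => //; last exact: code1_ratio_le1.
  by rewrite /code1_ratio; measurability.
have s0 y : (0 < side_ratio M2 dec2 f D2 y)%R.
  rewrite mulr_gt0//; last by rewrite divr_gt0 ?lik_gt0// mulr_gt0// cond_lik_gt0.
  by rewrite divr_gt0 ?pos_density_gt0// divr_gt0 ?lik_gt0// mulr_gt0// guess_gt0.
have mls : mean_le (fun x => (ln (side_ratio M2 dec2 f D2 x))%:E) 0%R.
  apply: mean_le_ratio => //; last exact: (side_ratio_le1 M2_gt0 mdec2 PWM mf f_ge0 fE).
  apply: measurable_funM; last by measurability.
  apply: measurable_funM; first by measurability.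
  by apply: measurable_fun_inv; apply: measurable_pos_density; measurability.
(* The masses in this ratio may vanish, so the ratio minus 1 stands in for its logarithm, which it
   dominates wherever the ratio is positive. *)
have mld : mean_le (fun x => (decoupling_ratio M1 dec1 x)%:E - 1) 0%R.
  apply: mean_le_subr1; last exact: decoupling_ratio_le1.
  - by rewrite /decoupling_ratio; measurability.
  - move=> y; rewrite lee_fin divr_ge0 ?cond_lik_ge0// mulr_ge0 ?direct_lik_ge0//.
    rewrite mulr_ge0 ?fine_ge0// mulr_ge0 ?fine_ge0// mulr_ge0// ltW//.
    exact: guess_gt0.
have := mean_leD (mean_leD (mean_leD (mean_leD (mean_leD (mean_leD (mean_leD
  me1 me1') me2) mx) ml) mh1) mh2) (mean_leD (mean_leD mlc mls) mld).
rewrite !addr0; apply: mean_le_cst => y; rewrite /neg_ln.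
have [_|m0] := eqVneq (M1%:R * message_mass y.1.2.1)%R 0%R.
  rewrite -!EFinD addey// addye; last by case: ifP.
  by rewrite addye ?leey.
have [_|v0] := eqVneq (signal_mass (v y.1.1)) 0%R.
  by rewrite -!EFinD addey// addye ?leey.
rewrite -!EFinD lee_fin.
have m0' : (0 < message_mass y.1.2.1)%R.
  rewrite lt_neqAle fine_ge0// andbT eq_sym; apply: contra_neq m0 => ->.
  by rewrite mulr0.
have v0' : (0 < signal_mass (v y.1.1))%R.
  by rewrite lt_neqAle eq_sym v0 fine_ge0.
have d0 : (0 < decoupling_ratio M1 dec1 y)%R.
  rewrite divr_gt0 ?cond_lik_gt0// mulr_gt0 ?direct_lik_gt0// mulr_gt0//.
  by rewrite mulr_gt0// mulr_gt0// guess_gt0.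
have := ln_le_subr1 d0.
rewrite /code1_ratio /side_ratio /decoupling_ratio.
have q1 := guess_gt0 dec1 M1_gt0 y.1.2.1 (vadd (b y.1.1) (side y)) (R := R).
have q2 := guess_gt0 dec1 M1_gt0 y.1.2.1 (out1 y) (R := R).
have q3 := guess_gt0 dec2 M2_gt0 (w2 y.1.1) (out2 y) (R := R).
have r0 := direct_lik_gt0 (y.1.2.1, v y.1.1) (side y).
have k0 := cond_lik_gt0 (side y) (out1 y).
have E1 := D10 (y.1.1, out2 y, side y).
have E2 := D20 (out1 y, side y, out2 y).
have f0 := pos_density_gt0 f_ge0 (w2 y.1.1, out1 y).
have l1 := lik_gt0 (c y.1.1) (out2 y).
have l2 := lik_gt0 (direct y.1) (side y).
clear -M10 M20 q1 q2 q3 r0 k0 E1 E2 f0 l1 l2 m0' v0'.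
move: (guess _ _ _ _) q1 (guess _ _ _ _) q2 (guess _ _ _ _) q3.
move: (direct_lik _ _) r0 (cond_lik _ _) k0 (D1 _) E1 (D2 _) E2.
move: (pos_density _ _) f0 (lik _ _) l1 (lik _ _) l2 (message_mass _) m0'.
move: (signal_mass _) v0' (M1%:R : R)%R M10 (M2%:R : R)%R M20.
move=> sv sv0 m1 m10 m2 m20 pd pd0 l1 l10 l2 l20 mm mm0 dl dl0 cl cl0 d1 d10 d2 d20
  q1 q10 q2 q20 q3 q30 dle.
have := dle.
do ![rewrite lnM ?posrE; [|by rewrite ?(mulr_gt0, invr_gt0)..]].
rewrite !lnV ?posrE//; lra.
Qed.

End secrecy.

End log_bounds.

End converse.

(** * Law of the sources *)

Section independence.
Local Open Scope ereal_scope.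
Context d (Omega : measurableType d) (R : realType) (P : probability Omega R).

Section groups.
Variables (I : finType) (F : I -> set (set Omega)).
Hypotheses (Findep : mutually_independent P F)
  (FT : forall i, F i setT) (FI : forall i, setI_closed (F i))
  (Fm : forall i, F i `<=` measurable).

(** A system stable under intersection that generates the joint sigma-algebra of the sources in [J];
    mutual independence factorises directly on it. *)
Definition group_sets (J : {set I}) : set (set Omega) :=
  [set A | exists2 E : I -> set Omega, (forall i, i \in J -> F i (E i))
    & A = \bigcap_(i in [set` J]) E i].

Lemma group_setsm J : group_sets J `<=` measurable.
Proof.
move=> _ [E FE ->]; apply: fin_bigcap_measurable => // i Ji.
by apply: (Fm (FE i _)).
Qed.

Lemma group_setsT J : group_sets J setT.
Proof. by exists (fun=> setT) => //; rewrite bigcapT. Qed.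

Lemma group_setsI J : setI_closed (group_sets J).
Proof.
move=> _ _ [E FE ->] [E' FE' ->]; exists (fun i => E i `&` E' i).
  by move=> i Ji; apply: FI; [exact: FE|exact: FE'].
by rewrite bigcapI.
Qed.

Definition independent_systems (G H : set (set Omega)) :=
  forall A B, G A -> H B -> P (A `&` B) = P A * P B.

Lemma independent_systemsC G H : independent_systems G H -> independent_systems H G.
Proof. by move=> GH A B HA GB; rewrite setIC GH// muleC. Qed.

Lemma independent_group_sets (J K : {set I}) :
  (forall i, i \in J -> i \notin K) ->
  independent_systems (group_sets J) (group_sets K).
Proof.
move=> JK _ _ [E FE ->] [E' FE' ->].
pose E2 i := if i \in J then E i else E' i.
have EE : \bigcap_(i in [set` J]) E i = \bigcap_(i in [set` J]) E2 i.
  by apply: eq_bigcapr => i /= Ji; rewrite /E2 Ji.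
have EE' : \bigcap_(i in [set` K]) E' i = \bigcap_(i in [set` K]) E2 i.
  apply: eq_bigcapr => i /= Ki; rewrite /E2; case: ifP => // Ji.
  by have := JK i Ji; rewrite Ki.
pose L : {set I} := finset (fun i => (i \in J) || (i \in K)).
have FE2 i : i \in L -> F i (E2 i).
  rewrite inE /E2; case: ifPn => [Ji _|_ /= Ki]; [exact: FE|exact: FE'].
rewrite EE EE' (_ : _ `&` _ = \bigcap_(i in [set` L]) E2 i); last first.
  apply/seteqP; split => [w [wJ wK] i /=|w wL].
    by rewrite inE => /orP[/wJ|/wK].
  by split => i /= Ji; apply: wL; rewrite /= inE Ji ?orbT.
rewrite !Findep//; last 2 first.
- by move=> i Ki; apply: FE2; rewrite inE Ki orbT.
- by move=> i Ji; apply: FE2; rewrite inE Ji.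
rewrite big_mkcond [X in _ = X * _]big_mkcond [X in _ = _ * X]big_mkcond -big_split.
apply: eq_bigr => i _; rewrite inE /=.
case: (boolP (i \in J)) => [/JK/negbTE ->|_] /=; first by rewrite mule1.
by rewrite mul1e.
Qed.

End groups.

(** For fixed [B], the measures [A -> P (A & B)] and [A -> P A * P B] agree on [G], which is stable
    under intersection and contains the whole space, hence on the sigma-algebra that [G]
    generates. *)
Lemma independent_systems_sigma (G H : set (set Omega)) :
  G `<=` measurable -> H `<=` measurable -> G setT -> setI_closed G ->
  independent_systems G H -> independent_systems <<s G >> H.
Proof.
move=> Gm Hm GT GI GH A B sA HB.
have mB := Hm _ HB.
have fB : P B \is a fin_num by exact: fin_num_measure.
have r0 : (0 <= fine (P B))%R by exact: fine_ge0.
have scaleE C : mscale (NngNum r0) P C = P C * P B.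
  by rewrite /mscale/= fineK// muleC.
rewrite -scaleE.
apply: (@g_sigma_algebra_measure_unique _ R _ G Gm (fun=> setT) (fun=> GT) _
  (mrestr P mB) (mscale (NngNum r0) P) GI) => //.
- by rewrite bigcup_const//; exists 0%N.
- by move=> C GC; apply: (etrans _ (esym (scaleE C))); exact: GH.
- by move=> k; suff: P (setT `&` B) < +oo by []; rewrite setTI ltey_eq fB.
Qed.

Lemma independent_sigma_systems (G H : set (set Omega)) :
  G `<=` measurable -> H `<=` measurable -> G setT -> H setT ->
  setI_closed G -> setI_closed H ->
  independent_systems G H -> independent_systems <<s G >> <<s H >>.
Proof.
move=> Gm Hm GT HT GI HI GH.
have sHm : <<s H >> `<=` measurable.
  by apply: smallest_sub => //; exact: sigma_algebra_measurable.
have sHG : independent_systems <<s H >> G.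
  by apply: independent_systems_sigma => //; exact: independent_systemsC.
by apply: independent_systems_sigma => //; exact: independent_systemsC.
Qed.

Lemma integral_independent_pair d1 d2 (A : measurableType d1)
    (B : measurableType d2) (X : {RV P >-> A}) (Y : {RV P >-> B})
    (F : A * B -> \bar R) :
  independent_systems (generated_sigma X) (generated_sigma Y) ->
  measurable_fun setT F -> (forall p, 0 <= F p) ->
  \int[P]_w F (X w, Y w)
  = \int[prob_prod (distribution P X) (distribution P Y)]_p F p.
Proof.
move=> XY mF F0.
rewrite -[LHS]/(\int[P]_w (F \o (joint_rv X Y : {mfun Omega >-> (A * B)%type})) w).
rewrite -ge0_integral_distribution//.
apply: eq_measure_integral => C mC _.
apply/esym/product_measure_unique => // A1 B1 mA1 mB1.
apply: XY; [exists A1|exists B1] => //; by rewrite setTI.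
Qed.

Lemma integral_joint_law d1 d2 (A : measurableType d1)
    (B : measurableType d2) (X : {RV P >-> A}) (Y : {RV P >-> B})
    (F : A -> B -> \bar R) :
  independent_systems (generated_sigma X) (generated_sigma Y) ->
  measurable_fun setT (fun p => F p.1 p.2) -> (forall x y, 0 <= F x y) ->
  \int[P]_w F (X w) (Y w)
  = \int[distribution P X]_x \int[distribution P Y]_y F x y.
Proof.
move=> XY mF F0; rewrite -tonelli_prod//.
exact: (integral_independent_pair (F := fun p => F p.1 p.2)).
Qed.

End independence.

(** * From the given sources to explicit product laws *)

Section transfer.
Local Open Scope ereal_scope.
Context (R : realType) (N : nat) (c : Defs.code R N) (s : sources c).
Local Notation G := (N.-tuple R).
Local Notation P := (Pr s).
Local Notation I := (bool + bool + ('I_N + 'I_N))%type.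
Local Notation groups := (group_sets (@source_sigma R N c s)).
Hypothesis indep : mutually_independent P (@source_sigma R N c s).

Lemma generated_sigmaT d (T : measurableType d) (X : Omega s -> T) :
  generated_sigma X setT.
Proof. by exists setT => //; rewrite setTI preimage_setT. Qed.

Lemma generated_sigmaI d (T : measurableType d) (X : Omega s -> T) :
  setI_closed (generated_sigma X).
Proof.
move=> _ _ [A mA <-] [B mB <-]; exists (A `&` B); first exact: measurableI.
by rewrite !setTI preimage_setI.
Qed.

Lemma generated_sigmam d (T : measurableType d) (X : {RV P >-> T}) :
  generated_sigma X `<=` measurable.
Proof. by move=> _ [A mA <-]; exact: measurable_funP. Qed.

Let sourceT i : @source_sigma R N c s i setT.
Proof. by case: i => [[[]|[]]|[]] *; exact: generated_sigmaT. Qed.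

Let sourceI i : setI_closed (@source_sigma R N c s i).
Proof. by case: i => [[[]|[]]|[]] *; exact: generated_sigmaI. Qed.

Let sourcem i : @source_sigma R N c s i `<=` measurable.
Proof. by case: i => [[[]|[]]|[]] *; exact: generated_sigmam. Qed.

(** Phrased as measurability for a generated structure, so that closure under pairs and tuples comes
    from the general lemmas on measurable functions. *)
Definition determined (J : {set I}) d (T : measurableType d) (X : Omega s -> T) :=
  measurable_fun (setT : set (g_sigma_algebraType (groups J))) X.

Lemma determined_source (J : {set I}) i d (T : measurableType d)
    (X : Omega s -> T) :
  i \in J -> @source_sigma R N c s i = generated_sigma X -> determined J X.
Proof.
move=> Ji iX _ A mA; apply: sub_sigma_algebra.
exists (fun j => if j == i then X @^-1` A else setT).
  move=> j Jj; case: eqP => [->|_]; last exact: sourceT.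
  by rewrite iX; exists A => //; rewrite setTI.
apply/seteqP; split => w.
  by move=> [_ XA] j _; case: eqP.
by move=> /(_ i Ji); rewrite eqxx.
Qed.

Lemma independent_determined (J K : {set I}) d1 d2 (A : measurableType d1)
    (B : measurableType d2) (X : Omega s -> A) (Y : Omega s -> B) :
  (forall i, i \in J -> i \notin K) -> determined J X -> determined K Y ->
  independent_systems P (generated_sigma X) (generated_sigma Y).
Proof.
move=> JK mX mY _ _ [C mC <-] [D mD <-].
apply: (@independent_sigma_systems _ _ _ P (groups J) (groups K)).
- exact: group_setsm.
- exact: group_setsm.
- exact: group_setsT.
- exact: group_setsT.
- exact: group_setsI.
- exact: group_setsI.
- exact: (independent_group_sets indep).
- exact: mX.
- exact: mY.
Qed.

Definition noise1 (w : Omega s) : G := [tuple Z1 s n w | n < N].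
Definition noise2 (w : Omega s) : G := [tuple Z2 s n w | n < N].
Definition secret (w : Omega s) : nat * S2 c := (W2 s w, T2 s w).

Lemma tnth_noise1 n : (fun y => tnth y n) \o noise1 = (Z1 s n : _ -> _).
Proof. by apply/funext => w; rewrite /= tnth_mktuple. Qed.

Let measurable_noise1 : measurable_fun setT noise1.
Proof. by apply/measurable_fun_tnthP => n; rewrite tnth_noise1. Qed.

Lemma tnth_noise2 n : (fun y => tnth y n) \o noise2 = (Z2 s n : _ -> _).
Proof. by apply/funext => w; rewrite /= tnth_mktuple. Qed.

Let measurable_noise2 : measurable_fun setT noise2.
Proof. by apply/measurable_fun_tnthP => n; rewrite tnth_noise2. Qed.

Let measurable_secret : measurable_fun setT secret.
Proof. exact: measurable_fun_pair. Qed.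

HB.instance Definition _ := isMeasurableFun.Build _ _ _ _ noise1 measurable_noise1.
HB.instance Definition _ := isMeasurableFun.Build _ _ _ _ noise2 measurable_noise2.
HB.instance Definition _ := isMeasurableFun.Build _ _ _ _ secret measurable_secret.

Lemma determined_pair (J : {set I}) d1 d2 (A : measurableType d1)
    (B : measurableType d2) (X : Omega s -> A) (Y : Omega s -> B) :
  determined J X -> determined J Y -> determined J (fun w => (X w, Y w)).
Proof. by move=> mX mY; exact: measurable_fun_pair. Qed.

Lemma determined_noise1 (J : {set I}) :
  (forall n, inr (inl n) \in J) -> determined J noise1.
Proof.
move=> nJ; apply/measurable_fun_tnthP => n; rewrite tnth_noise1.
exact: (determined_source (nJ n)).
Qed.

Lemma determined_noise2 (J : {set I}) :
  (forall n, inr (inr n) \in J) -> determined J noise2.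
Proof.
move=> nJ; apply/measurable_fun_tnthP => n; rewrite tnth_noise2.
exact: (determined_source (nJ n)).
Qed.

Lemma determined_secret (J : {set I}) :
  inl (inl true) \in J -> inl (inr true) \in J -> determined J secret.
Proof.
move=> WJ TJ; apply: determined_pair.
  exact: (determined_source WJ).
exact: (determined_source TJ).
Qed.

Hypotheses (Z1N : forall n, standard_normal (Z1 s n))
  (Z2N : forall n, standard_normal (Z2 s n)).

(** Common to both noises, with [i] embedding the letters into the source indices: independence and
    normality of the coordinates give agreement with [gaussN] on boxes. *)
Let noise_law (Z : 'I_N -> {RV P >-> R}) (i : 'I_N -> I) (X : {RV P >-> G}) :
  injective i -> (forall n, @source_sigma R N c s (i n) = generated_sigma (Z n)) ->
  (forall n, standard_normal (Z n)) ->
  (forall w, X w = [tuple Z n w | n < N]) ->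
  forall A, measurable A -> distribution P X A = gaussN N A.
Proof.
move=> inj_i iZ ZN XE.
pose box : set (set G) := [set A | exists2 B : 'I_N -> set R,
  (forall n, measurable (B n)) & A = [set y | forall n, B n (tnth y n)]].
have mbox : box `<=` measurable.
  move=> _ [B mB ->].
  rewrite (_ : [set y | _] = \bigcap_(n in [set: 'I_N]) ((fun y => tnth y n) @^-1` B n)).
    apply: fin_bigcap_measurable => // n _.
    by rewrite -[_ @^-1` _]setTI; exact: measurable_tnth.
  by apply/seteqP; split => y; [move=> By n _; exact: By|move=> By n; exact: By].
apply: (measure_unique box (fun=> setT)).
- apply/seteqP; split; apply: smallest_sub.
  + exact: smallest_sigma_algebra.
  + rewrite -bigcup_seq => A /= [n _ [B mB <-]]; apply: sub_sigma_algebra.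
    exists (fun m => if m == n then B else setT); first by move=> m; case: ifP.
    apply/seteqP; split => y /=; first by move=> [_ By] m; case: eqP => [->|].
    by move=> /(_ n); rewrite eqxx.
  + exact: sigma_algebra_measurable.
  + exact: mbox.
- move=> _ _ [B mB ->] [B' mB' ->]; exists (fun n => B n `&` B' n).
    by move=> n; exact: measurableI.
  apply/seteqP; split => y; first by move=> [By By'] n; split.
  by move=> By; split => n; case: (By n).
- by move=> _; exists (fun=> setT) => //; apply/seteqP; split.
- by rewrite bigcup_const//; exists 0%N.
- move=> _ [B mB ->]; apply: (etrans _ (esym (gaussN_box mB))).
  pose J : {set I} := imset i (mem 'I_N).
  (* One event per source index: the condition is vacuous off the image of [i], and injectivity
     makes it the event of the single letter [n] at [i n]. *)
  pose E j : set (Omega s) := [set w | forall n, i n = j -> B n (Z n w)].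
  have Ei n : E (i n) = Z n @^-1` B n.
    by apply/seteqP; split => w /= Ew; [exact: Ew|move=> m /inj_i ->].
  rewrite [LHS](_ : _ = P (\bigcap_(j in [set` J]) E j)); last first.
    congr (P _); apply/seteqP; split => w /=.
      by move=> Bw j _ n _; have := Bw n; rewrite XE tnth_mktuple.
    move=> Ew n; rewrite XE tnth_mktuple; apply: (Ew (i n)) => //=.
    by apply/imsetP; exists n.
  rewrite indep; last first.
    move=> j /imsetP[n _ ->]; rewrite iZ Ei; exists (B n) => //.
    by rewrite setTI.
  rewrite big_imset/=; last by move=> m n _ _; exact: inj_i.
  apply: eq_bigr => n _; rewrite Ei; exact: (ZN n).
- by move=> _; rewrite (le_lt_trans (probability_le1 _ _)) ?ltry.
Qed.

Lemma noise1_law A : measurable A -> distribution P noise1 A = gaussN N A.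
Proof.
apply: (noise_law (Z := Z1 s) (i := fun n => inr (inl n))) => //.
by move=> m n [].
Qed.

Lemma noise2_law A : measurable A -> distribution P noise2 A = gaussN N A.
Proof.
apply: (noise_law (Z := Z2 s) (i := fun n => inr (inr n))) => //.
by move=> m n [].
Qed.

Definition message_law : probability nat R := distribution P (W1 s).
Definition local_law : probability (S1 c) R := distribution P (T1 s).
Definition secret_law : probability (nat * S2 c)%type R := distribution P secret.

(** Carries expectations to the explicit laws on which the ratios are integrated. Independence is
    used from coarse to fine: users against noises, the two noises, user 2 against user 1, and the
    first message against its local randomness. *)
Lemma integral_sources (F : nat * S2 c -> nat * S1 c -> G -> G -> \bar R) :
  measurable_fun setT (fun p : (nat * S2 c) * (nat * S1 c) * (G * G) =>
    F p.1.1 p.1.2 p.2.1 p.2.2) ->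
  (forall u w z1 z2, 0 <= F u w z1 z2) ->
  \int[P]_w F (secret w) (W1 s w, T1 s w) (noise1 w) (noise2 w)
  = \int[theta_law local_law secret_law message_law]_th
      \int[gaussN N]_z1 \int[gaussN N]_z2 F th.1 th.2 z1 z2.
Proof.
move=> mF F0.
pose user1 : {RV P >-> (nat * S1 c)%type} :=
  joint_rv (Pr := P) (W1 s) (T1 s).
pose users : {RV P >-> (nat * S2 c * (nat * S1 c))%type} :=
  joint_rv (Pr := P) secret user1.
pose noises : {RV P >-> (G * G)%type} :=
  joint_rv (Pr := P) noise1 noise2.
pose J_user1 : {set I} :=
  finset (fun i => if i is inl (inl false) then true else
                   if i is inl (inr false) then true else false).
pose J_secret : {set I} :=
  finset (fun i => if i is inl (inl true) then true else
                   if i is inl (inr true) then true else false).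
pose J_users : {set I} := finset (fun i => if i is inl _ then true else false).
pose J_noises : {set I} := finset (fun i => if i is inr _ then true else false).
pose single j : {set I} := finset (pred1 j).
have ind_noises : independent_systems P (generated_sigma noise1) (generated_sigma noise2).
  apply: (@independent_determined
    (finset (fun i => if i is inr (inl _) then true else false))
    (finset (fun i => if i is inr (inr _) then true else false))).
  - by case=> [j|[j|j]]; rewrite !inE.
  - by apply: determined_noise1 => n; rewrite inE.
  - by apply: determined_noise2 => n; rewrite inE.
have ind_user1 : independent_systems P (generated_sigma (W1 s)) (generated_sigma (T1 s)).
  apply: (@independent_determined (single (inl (inl false))) (single (inl (inr false)))).
  - by move=> j; rewrite !inE => /eqP ->.
  - by apply: (@determined_source _ (inl (inl false))) => //; rewrite inE.
  - by apply: (@determined_source _ (inl (inr false))) => //; rewrite inE.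
have ind_users : independent_systems P (generated_sigma secret) (generated_sigma user1).
  apply: (@independent_determined J_secret J_user1).
  - by case=> [[[]|[]]|j]; rewrite !inE.
  - by apply: determined_secret; rewrite inE.
  - apply: determined_pair.
      by apply: (@determined_source _ (inl (inl false))) => //; rewrite inE.
    by apply: (@determined_source _ (inl (inr false))) => //; rewrite inE.
have ind :
    independent_systems P (generated_sigma users) (generated_sigma noises).
  apply: (@independent_determined J_users J_noises).
  - by case=> j; rewrite !inE.
  - apply: determined_pair; first by apply: determined_secret; rewrite inE.
    apply: determined_pair.
      by apply: (@determined_source _ (inl (inl false))) => //; rewrite inE.
    by apply: (@determined_source _ (inl (inr false))) => //; rewrite inE.
  - apply: determined_pair.
      by apply: determined_noise1 => n; rewrite inE.
    by apply: determined_noise2 => n; rewrite inE.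
rewrite (integral_joint_law (X := users) (Y := noises)
  (F := fun x y => F x.1 x.2 y.1 y.2))//.
have mF' d1 (T : measurableType d1) (u : T -> nat * S2 c) (t : T -> nat * S1 c)
    (y1 y2 : T -> G) : measurable_fun setT u -> measurable_fun setT t ->
    measurable_fun setT y1 -> measurable_fun setT y2 ->
    measurable_fun setT (fun x => F (u x) (t x) (y1 x) (y2 x)).
  move=> mu mt my1 my2.
  by apply: (measurable_fun_comp mF (f := fun x => ((u x, t x), (y1 x, y2 x))));
    measurability.
have F2 u t : 0 <= \int[gaussN N]_z1 \int[gaussN N]_z2 F u t z1 z2.
  by do 2 apply: integral_ge0 => ? _.
have noisesE u t : \int[distribution P noises]_y F u t y.1 y.2
    = \int[gaussN N]_z1 \int[gaussN N]_z2 F u t z1 z2.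
  rewrite ge0_integral_distribution//; last first.
    by apply: mF'; measurability.
  rewrite (integral_joint_law (X := noise1) (Y := noise2)
    (F := fun z1 z2 => F u t z1 z2))//; last by apply: mF'; measurability.
  transitivity (\int[distribution P noise1]_z1 \int[gaussN N]_z2 F u t z1 z2).
    apply: eq_integral => z1 _; apply: eq_measure_integral => A mA _.
    exact: noise2_law.
  by apply: eq_measure_integral => A mA _; exact: noise1_law.
transitivity (\int[distribution P users]_x \int[gaussN N]_z1 \int[gaussN N]_z2
    F x.1 x.2 z1 z2).
  by apply: eq_integral => x _; exact: noisesE.
rewrite ge0_integral_distribution//; last first.
  by measurability; first [by apply: mF'; measurability | by move=> p
    | by move=> p; apply: integral_ge0].
rewrite (integral_joint_law (X := secret) (Y := user1)
  (F := fun u t => \int[gaussN N]_z1 \int[gaussN N]_z2 F u t z1 z2))//; last first.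
  by measurability; first [by apply: mF'; measurability | by move=> p
    | by move=> p; apply: integral_ge0].
rewrite integral_theta_law//; last first.
  by measurability; first [by apply: mF'; measurability | by move=> p
    | by move=> p; apply: integral_ge0].
apply: eq_integral => u _; rewrite ge0_integral_distribution//; last first.
  by measurability; first [by apply: mF'; measurability | by move=> p
    | by move=> p; apply: integral_ge0].
rewrite (integral_joint_law (X := W1 s) (Y := T1 s)
  (F := fun w t => \int[gaussN N]_z1 \int[gaussN N]_z2 F u (w, t) z1 z2))//.
by measurability; first [by apply: mF'; measurability | by move=> p
    | by move=> p; apply: integral_ge0].
Qed.

End transfer.

(** * Gaussian test densities *)

Section gauss_density.
Local Open Scope ereal_scope.
Context (R : realType) (N : nat).
Local Notation G := (N.-tuple R).
Local Notation gN := (@gaussN R N).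

(* A density with respect to [gaussN N]. *)
Definition gauss_density (sg : 'I_N -> R) (m y : G) : R :=
  (\prod_(i < N) (normal_pdf (tnth m i) (sg i) (tnth y i) / phi (tnth y i)))%R.

Variable sg : 'I_N -> R.
Hypothesis sg_ge1 : forall i, (1 <= sg i)%R.

Let sg_gt0 i : (0 < sg i)%R. Proof. exact: lt_le_trans (sg_ge1 i). Qed.

Let sg_neq0 i : sg i != 0%R. Proof. by rewrite gt_eqF. Qed.

Lemma gauss_density_gt0 m y : (0 < gauss_density sg m y)%R.
Proof. by apply: prodr_gt0 => i _; rewrite divr_gt0 ?phi_gt0 ?normal_pdf_gt0. Qed.

Lemma measurable_gauss_density d (T : measurableType d) (f g : T -> G) :
  measurable_fun setT f -> measurable_fun setT g ->
  measurable_fun setT (fun x => gauss_density sg (f x) (g x)).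
Proof.
move=> mf mg; apply: measurable_prod => i _; apply: measurable_funM.
  by apply: measurable_fun_normal_pdf => //; exact: measurable_fun_tnth.
apply: measurable_fun_inv; apply: (measurable_fun_comp measurable_phi).
exact: measurable_fun_tnth.
Qed.

Lemma integral_gauss_density m : \int[gN]_y (gauss_density sg m y)%:E = 1.
Proof.
rewrite (gaussN_prod (h := fun i x => normal_pdf (tnth m i) (sg i) x / phi x)%R).
- apply: big1 => i _; rewrite -[RHS](gauss1_normal_ratio (tnth m i) (sg i) 0).
  by apply: eq_integral => x _; rewrite addr0.
- move=> i; have := measurable_normal_ratio (tnth m i) (sg i) 0.
  by under eq_fun do rewrite addr0.
- by move=> i x; have := normal_ratio_ge0 (tnth m i) (sg i) 0 x; rewrite addr0.
Qed.

Lemma ln_normal_ratio (m s y : R) : (0 < s)%R ->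
  (ln (normal_pdf m s y / phi y)
   = y ^+ 2 / 2 - ln s - (y - m) ^+ 2 / (2 * s ^+ 2))%R.
Proof.
move=> s0; have sn0 : s != 0%R by rewrite gt_eqF.
have p1 : (0 < normal_peak 1 :> R)%R by rewrite normal_peak_gt0// oner_neq0.
rewrite /phi !normal_pdfE ?oner_neq0// normal_peak_scale// /normal_fun subr0 expr1n.
rewrite (_ : _ / _ = s^-1 *
  expR (- (y - m) ^+ 2 / (s ^+ 2 *+ 2) + y ^+ 2 / 2))%R; last first.
  rewrite (_ : expR (_ + _) = expR (- (y - m) ^+ 2 / (s ^+ 2 *+ 2)) /
      expR (- y ^+ 2 / 2))%R; last first.
    by rewrite -expRN -expRD; congr (expR (_ + _)); rewrite mulNr opprK.
  have e0 : expR (- y ^+ 2 / 2) != 0%R :> R by rewrite gt_eqF ?expR_gt0.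
  by field; rewrite e0 sn0 gt_eqF.
rewrite lnM ?posrE ?invr_gt0 ?expR_gt0// lnV ?posrE// expRK -mulr_natr.
by field; rewrite sn0.
Qed.

Lemma ln_gauss_ratio (m m' y : G) :
  (- ln (gauss_density sg m y) + ln (lik m' y)
   = \sum_(i < N) (ln (sg i) + (tnth y i - tnth m i) ^+ 2 / (2 * sg i ^+ 2)
                 - (tnth y i - tnth m' i) ^+ 2 / 2))%R.
Proof.
have lnprod (F : 'I_N -> R) : (forall i, 0 < F i)%R ->
    (ln (\prod_(i < N) F i) = \sum_(i < N) ln (F i))%R.
  move=> F0; suff [] : (0 < \prod_(i < N) F i)%R /\
      (ln (\prod_(i < N) F i) = \sum_(i < N) ln (F i))%R by [].
  apply: (big_rec2 (fun x y : R => (0 < x)%R /\ ln x = y)).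
    by rewrite ln1.
  by move=> i x y' _ [x0 <-]; rewrite mulr_gt0// lnM ?posrE.
rewrite /gauss_density /lik !lnprod; last 2 first.
- move=> i; apply: divr_gt0; last exact: phi_gt0.
  by apply: normal_pdf_gt0; exact: oner_neq0.
- move=> i; apply: divr_gt0; last exact: phi_gt0.
  by apply: normal_pdf_gt0; exact: sg_neq0.
rewrite -sumrN -big_split/=; apply: eq_bigr => i _.
rewrite !ln_normal_ratio// ln1 expr1n; lra.
Qed.

(** Per letter, the residual term has mean at most [sg^2 / (2 sg^2) = 1/2] and the noise term has
    mean exactly [1/2], so only [ln sg] survives. Deviations at least 1 keep [ln sg] nonnegative, as
    the part [p] in [mean_le] requires. *)
Lemma mean_le_gauss d (T : measurableType d) (P : probability T R)
    (m m' y : T -> G) :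
  measurable_fun setT m -> measurable_fun setT m' -> measurable_fun setT y ->
  (forall i, \int[P]_t ((tnth (y t) i - tnth (m t) i) ^+ 2)%:E <= (sg i ^+ 2)%:E) ->
  (forall i, \int[P]_t ((tnth (y t) i - tnth (m' t) i) ^+ 2)%:E = 1) ->
  mean_le P (fun t => (- ln (gauss_density sg (m t) (y t))
                       + ln (lik (m' t) (y t)))%:E) (\sum_(i < N) ln (sg i))%R.
Proof.
move=> mm mm' my le_sg eq1.
have mres (m1 : T -> G) (k : R) i : measurable_fun setT m1 ->
    measurable_fun setT (fun t => (k * (tnth (y t) i - tnth (m1 t) i) ^+ 2)%R).
  move=> mm1; apply: measurable_funM => //; apply: measurable_funX.
  by apply: measurable_funB; exact: measurable_fun_tnth.
pose p t := \sum_(i < N) (ln (sg i) +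
  (2 * sg i ^+ 2)^-1 * (tnth (y t) i - tnth (m t) i) ^+ 2)%:E.
pose n t := \sum_(i < N) (2^-1 * (tnth (y t) i - tnth (m' t) i) ^+ 2)%:E.
have lnsg i : (0 <= ln (sg i))%R by rewrite ln_ge0.
have c0 i : (0 <= (2 * sg i ^+ 2)^-1)%R.
  by rewrite invr_ge0 mulr_ge0// sqr_ge0.
have p0 i t : 0 <= (ln (sg i) +
    (2 * sg i ^+ 2)^-1 * (tnth (y t) i - tnth (m t) i) ^+ 2)%:E.
  by rewrite lee_fin addr_ge0// mulr_ge0// sqr_ge0.
have n0 i t : 0 <= (2^-1 * (tnth (y t) i - tnth (m' t) i) ^+ 2)%:E.
  by rewrite lee_fin mulr_ge0// sqr_ge0.
have mp i : measurable_fun setT (fun t => (ln (sg i) +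
    (2 * sg i ^+ 2)^-1 * (tnth (y t) i - tnth (m t) i) ^+ 2)%:E).
  by apply/measurable_EFinP; apply: measurable_funD => //; exact: mres.
have mn i : measurable_fun setT
    (fun t => (2^-1 * (tnth (y t) i - tnth (m' t) i) ^+ 2)%:E).
  by apply/measurable_EFinP; exact: mres.
have nE : \int[P]_t n t = (\sum_(i < N) 2^-1)%:E.
  rewrite ge0_integral_sum// -sumEFin; apply: eq_bigr => i _.
  rewrite ge0_integralZ_real ?eq1 ?mule1//.
  - by have := mres m' 1%R i mm'; under eq_fun do rewrite mul1r.
  - by move=> t; exact: sqr_ge0.
exists p, n; split.
- split; first by apply: emeasurable_sum => i; exact: mp.
  by move=> t; apply: sume_ge0 => i _.
- split; first by apply: emeasurable_sum => i; exact: mn.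
  by move=> t; apply: sume_ge0 => i _.
- move=> t; rewrite ln_gauss_ratio /p /n !sumEFin -EFinD lee_fin -big_split/=.
  apply: ler_sum => i _; rewrite le_eqVlt; apply/orP; left; apply/eqP.
  by rewrite [(_ / (2 * _))%R]mulrC [(_ / 2)%R]mulrC subrK.
- by rewrite nE ltry.
- rewrite nE ge0_integral_sum// -EFinD -big_split/= -sumEFin.
  apply: lee_sum => i _; under eq_integral do rewrite EFinD.
  rewrite ge0_integralD//; last 3 first.
  + by move=> t _; rewrite lee_fin.
  + by move=> t _; rewrite lee_fin mulr_ge0// sqr_ge0.
  + by apply/measurable_EFinP; exact: mres.
  rewrite integral_probability_cst EFinD leeD2l// ge0_integralZ_real//; last 2 first.
  + by have := mres m 1%R i mm; under eq_fun do rewrite mul1r.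
  + by move=> t; exact: sqr_ge0.
  apply: (@le_trans _ _ ((2 * sg i ^+ 2)^-1%:E * (sg i ^+ 2)%:E)).
    by apply: lee_wpmul2l => //; rewrite lee_fin.
  by rewrite -EFinM lee_fin invfM -mulrA mulVf ?mulr1// sqrf_eq0.
Qed.

End gauss_density.

Section second_moments.
Local Open Scope ereal_scope.
Context (R : realType).

Lemma integral_gaussN_affine N (i : 'I_N) (x c K : R) : (0 <= K)%R ->
  \int[gaussN N]_y ((x + c * tnth y i) ^+ 2 + K)%:E = (x ^+ 2 + (c ^+ 2 + K))%:E.
Proof.
move=> K0.
have mA : measurable_fun setT (fun z : R => ((x + c * z) ^+ 2)%R).
  by apply: measurable_funX; apply: measurable_funD => //; exact: measurable_funM.
rewrite (integral_gaussN_tnth i (F := fun z : R => ((x + c * z) ^+ 2 + K)%:E)); last 2 first.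
- by apply/measurable_EFinP; exact: measurable_funD.
- by move=> z; rewrite lee_fin addr_ge0// sqr_ge0.
under eq_integral do rewrite EFinD.
rewrite ge0_integralD//; last 2 first.
- by move=> t _; rewrite lee_fin sqr_ge0.
- exact/measurable_EFinP.
by rewrite integral_probability_cst integral_gauss1_sqr_affine -EFinD addrA.
Qed.

(* The best constant [k] is the correlation of [x1] and [x2]. *)
Lemma quadratic_moment_bound d (T : measurableType d) (mu : probability T R) (P : R)
    (x1 x2 : T -> R) :
  measurable_fun setT x1 -> measurable_fun setT x2 ->
  \int[mu]_t (x1 t ^+ 2)%:E <= P%:E -> \int[mu]_t (x2 t ^+ 2)%:E <= P%:E ->
  exists2 k : R, (`|k| <= P)%R & forall p q : R,
    \int[mu]_t ((p * x1 t + q * x2 t) ^+ 2)%:E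
    <= ((p ^+ 2 + q ^+ 2) * P + 2 * p * q * k)%:E.
Proof.
move=> m1 m2 P1 P2.
have isq (x : T -> R) : measurable_fun setT x -> \int[mu]_t (x t ^+ 2)%:E <= P%:E ->
    mu.-integrable setT (fun t => (x t ^+ 2)%:E).
  move=> mx xP; apply/integrableP; split.
    by apply/measurable_EFinP; exact: measurable_funX.
  under eq_integral do rewrite gee0_abs ?lee_fin ?sqr_ge0//.
  exact: le_lt_trans xP (ltry _).
have i1 := isq _ m1 P1; have i2 := isq _ m2 P2.
have m12 : measurable_fun setT (fun t => x1 t * x2 t)%R by exact: measurable_funM.
have i12 : mu.-integrable setT (fun t => (x1 t * x2 t)%:E).
  apply: (le_integrable measurableT) (integrableD measurableT i1 i2).
    exact/measurable_EFinP.
  move=> t _ /=; rewrite lee_fin normrM (le_trans _ (ler_norm _))//.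
  rewrite -(real_normK (num_real (x1 t))) -(real_normK (num_real (x2 t))).
  have := sqr_ge0 (`|x1 t| - `|x2 t|)%R.
  have := normr_ge0 (x1 t); have := normr_ge0 (x2 t); nra.
pose k := fine (\int[mu]_t (x1 t * x2 t)%:E).
have kE : \int[mu]_t (x1 t * x2 t)%:E = k%:E.
  by rewrite fineK//; exact: integrable_fin_num.
have bound (p q : R) : \int[mu]_t ((p * x1 t + q * x2 t) ^+ 2)%:E
    <= ((p ^+ 2 + q ^+ 2) * P + 2 * p * q * k)%:E.
  rewrite (_ : \int[mu]_t _ = (p ^+ 2)%:E * \int[mu]_t (x1 t ^+ 2)%:E +
    (q ^+ 2)%:E * \int[mu]_t (x2 t ^+ 2)%:E +
    (2 * p * q)%:E * \int[mu]_t (x1 t * x2 t)%:E).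
    rewrite kE -EFinM EFinD; apply: leeD => //; rewrite mulrDl EFinD.
    by apply: leeD; rewrite [leRHS]EFinM; apply: lee_wpmul2l => //; rewrite lee_fin sqr_ge0.
  rewrite -!integralZl// -integralD//; try exact: integrableZl.
  rewrite -integralD//; [|by apply: integrableD => //; exact: integrableZl|exact: integrableZl].
  by apply: eq_integral => t _; rewrite -!EFinM -!EFinD; congr (_%:E); ring.
exists k => //.
(* With [p = 1] and [q = 1] or [q = -1], nonnegativity of the second moment forces
   [- P <= k <= P]. *)
have pos (q : R) : (0 <= (1 ^+ 2 + q ^+ 2) * P + 2 * 1 * q * k)%R.
  rewrite -lee_fin (le_trans _ (bound _ _))//.
  by apply: integral_ge0 => t _; rewrite lee_fin sqr_ge0.
by have := pos 1%R; have := pos (-1)%R; rewrite ler_norml; lra.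
Qed.

Section residual.
Context (N : nat) dS (S1 : measurableType dS) (tau : probability S1 R)
  dU (U : measurableType dU) (kappa : probability U R) (pi1 : probability nat R).
Variables (x1 x2 : U * (nat * S1) -> R) (i : 'I_N) (P k : R).
Hypotheses (m1 : measurable_fun setT x1) (m2 : measurable_fun setT x2).
Local Notation theta_law := (theta_law tau kappa pi1).
Hypothesis x12 : forall p q : R,
  \int[theta_law]_t ((p * x1 t + q * x2 t) ^+ 2)%:E
  <= ((p ^+ 2 + q ^+ 2) * P + 2 * p * q * k)%:E.

(** The noises are independent, centred and of unit variance, so each adds the square of its
    coefficient; the inputs contribute through the assumed quadratic form. *)
Lemma residual_moment (p q c1 c2 c3 : R) :
  \int[space_law N tau kappa pi1]_x ((p * x1 x.1 + q * x2 x.1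
    + c1 * tnth x.2.1 i + c2 * tnth x.2.2.1 i + c3 * tnth x.2.2.2 i) ^+ 2)%:E
  <= ((p ^+ 2 + q ^+ 2) * P + 2 * p * q * k + (c1 ^+ 2 + c2 ^+ 2 + c3 ^+ 2))%:E.
Proof.
have mx : measurable_fun setT (fun t => p * x1 t + q * x2 t)%R.
  by apply: measurable_funD; exact: measurable_funM.
rewrite integral_space_law; last 2 first.
- apply/measurable_EFinP; apply: measurable_funX.
  do 3 (apply: measurable_funD; last by
    apply: measurable_funM => //; apply: measurable_fun_tnth; measurability).
  by apply: (measurable_fun_comp mx); measurability.
- by move=> x; rewrite lee_fin sqr_ge0.
rewrite [leLHS](_ : _ = \int[theta_law]_th
    (((p * x1 th + q * x2 th) ^+ 2)%:E + (c1 ^+ 2 + c2 ^+ 2 + c3 ^+ 2)%:E)).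
  rewrite ge0_integralD//; last 3 first.
  - by move=> t _; rewrite lee_fin sqr_ge0.
  - by apply/measurable_EFinP; exact: measurable_funX.
  - by move=> t _; rewrite lee_fin !addr_ge0// sqr_ge0.
  rewrite [leRHS]EFinD; apply: leeD; first exact: x12.
  by rewrite integral_probability_cst.
apply: eq_integral => th _ /=.
have nn0 (y : R) : (0 <= y ^+ 2)%R by exact: sqr_ge0.
under eq_integral => z1 _.
  under eq_integral => z2 _.
    rewrite (_ : (fun z3 : N.-tuple R => _) = (fun z3 : N.-tuple R =>
      ((p * x1 th + q * x2 th + c1 * tnth z1 i + c2 * tnth z2 i
        + c3 * tnth z3 i) ^+ 2 + 0)%:E)); last first.
      by apply/funext => z3; rewrite addr0.
    rewrite integral_gaussN_affine// addr0.
    over.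
  rewrite /= integral_gaussN_affine//.
  over.
rewrite /= integral_gaussN_affine ?addr_ge0// -EFinD; congr (_%:E); ring.
Qed.

End residual.

End second_moments.

(** * Linear estimation *)

Section linear_estimation.
Context (R : realType).
Variables (hd hc P k : R).

(** For inputs of power [P] and correlation [k]: [var1] is the second moment of the first output and
    of [s + hc x2], [var2] that of the second output and of [s]; [cov12] is the covariance of the
    first output, or of [s + hc x2], with the second output, and [cov1s] that of [s] with the first
    output. [det1s] is the determinant of the covariance matrix of [s] and the first output. The
    covariance of [s] with the second output is [hd ^+ 2 * k]. *)
Definition var1 := 1 + hd ^+ 2 * P + hc ^+ 2 * P + 2 * hd * hc * k.
Definition var2 := 1 + hd ^+ 2 * P.
Definition cov12 := hd ^+ 2 * k + hd * hc * P.
Definition cov1s := hd ^+ 2 * P + hd * hc * k.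
Definition det1s := var2 * var1 - cov1s ^+ 2.

(* Error variances of the linear least-squares estimates of the second output
   from the first one, of the interfered side information from the second
   output, and of the second output from the side information and the first
   output. *)
Definition var2_given1 := var2 - cov12 ^+ 2 / var1.
Definition vars_given2 := var1 - cov12 ^+ 2 / var2.
Definition var2_given_s1 :=
  var2 - (var1 * (hd ^+ 2 * k) ^+ 2 - 2 * cov1s * (hd ^+ 2 * k) * cov12
          + var2 * cov12 ^+ 2) / det1s.

Hypothesis kP : `|k| <= P.

Lemma quadratic_ge0 p q : 0 <= (p ^+ 2 + q ^+ 2) * P + 2 * p * q * k.
Proof.
move: kP; rewrite ler_norml => /andP[k1 k2].
rewrite (_ : _ + _ = ((p + q) ^+ 2 * (P + k) + (p - q) ^+ 2 * (P - k)) / 2).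
  by rewrite divr_ge0// addr_ge0// mulr_ge0// ?sqr_ge0//; lra.
by field.
Qed.

Lemma var1_ge1 : 1 <= var1.
Proof. have := quadratic_ge0 hd hc; rewrite /var1; lra. Qed.

Lemma P_ge0 : 0 <= P. Proof. exact: le_trans (normr_ge0 k) kP. Qed.

Lemma var2_ge1 : 1 <= var2.
Proof. by rewrite lerDl mulr_ge0 ?sqr_ge0// P_ge0. Qed.

(** The expanded determinant is 1 plus nonnegative terms: powers of linear combinations of the
    inputs and a multiple of the determinant [P^2 - k^2] of the input covariance. *)
Lemma det1s_ge1 : 1 <= det1s.
Proof.
rewrite (_ : det1s = 1 + hd ^+ 2 * P + ((hd ^+ 2 + hc ^+ 2) * P + 2 * hd * hc * k)
  + (hd * hc) ^+ 2 * (P ^+ 2 - k ^+ 2)); last by rewrite /det1s /var2 /var1 /cov1s; ring.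
rewrite -2!addrA lerDl; apply: addr_ge0; first by rewrite mulr_ge0 ?sqr_ge0 ?P_ge0.
apply: addr_ge0; first exact: quadratic_ge0.
apply: mulr_ge0; first exact: sqr_ge0.
by rewrite subr_ge0 -(real_normK (num_real k)) lerXn2r ?nnegrE ?P_ge0.
Qed.

Let var1_neq0 : var1 != 0. Proof. by rewrite gt_eqF// (lt_le_trans _ var1_ge1). Qed.
Let var2_neq0 : var2 != 0. Proof. by rewrite gt_eqF// (lt_le_trans _ var2_ge1). Qed.
Let det1s_neq0 : det1s != 0. Proof. by rewrite gt_eqF// (lt_le_trans _ det1s_ge1). Qed.

(** The left side has the shape of [residual_moment] for the second output minus [a] times the
    first; [a] minimises the resulting quadratic polynomial. *)
Lemma var2_given1E (a := cov12 / var1) :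
  (((- (a * hd)) ^+ 2 + (hd - a * hc) ^+ 2) * P + 2 * (- (a * hd)) * (hd - a * hc) * k)
  + ((- a) ^+ 2 + 1 ^+ 2 + 0 ^+ 2) = var2_given1.
Proof.
rewrite [LHS](_ : _ = var2 - 2 * a * cov12 + a ^+ 2 * var1); last first.
  by rewrite /var1 /var2 /cov12; ring.
by rewrite /var2_given1 /a; field.
Qed.

Lemma vars_given2E (a := cov12 / var2) :
  ((hd ^+ 2 + (hc - a * hd) ^+ 2) * P + 2 * hd * (hc - a * hd) * k)
  + (0 ^+ 2 + (- a) ^+ 2 + 1 ^+ 2) = vars_given2.
Proof.
rewrite [LHS](_ : _ = var1 - 2 * a * cov12 + a ^+ 2 * var2); last first.
  by rewrite /var1 /var2 /cov12; ring.
by rewrite /vars_given2 /a; field.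
Qed.

(** The residual is the second output minus [a] times [s] minus [b] times the first output; [a] and
    [b] solve the normal equations by Cramer's rule. *)
Lemma var2_given_s1E (a := (var1 * (hd ^+ 2 * k) - cov1s * cov12) / det1s)
    (b := (var2 * cov12 - cov1s * (hd ^+ 2 * k)) / det1s) :
  (((- ((a + b) * hd)) ^+ 2 + (hd - b * hc) ^+ 2) * P
   + 2 * (- ((a + b) * hd)) * (hd - b * hc) * k)
  + ((- b) ^+ 2 + 1 ^+ 2 + (- a) ^+ 2) = var2_given_s1.
Proof.
rewrite [LHS](_ : _ = var2 - 2 * a * (hd ^+ 2 * k) - 2 * b * cov12
  + (a ^+ 2 * var2 + 2 * a * b * cov1s + b ^+ 2 * var1)); last first.
  by rewrite /var1 /var2 /cov12 /cov1s; ring.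
rewrite /var2_given_s1 /a /b; move: det1s_neq0; rewrite /det1s.
move: var1 var2 cov1s cov12 (hd ^+ 2 * k) => x y z t u xyz; field; exact: xyz.
Qed.

(** One noise keeps coefficient 1 in each residual, so all error variances are at least 1; their
    logarithms are therefore nonnegative and continuous in [k]. *)
Let residual_ge1 p q c1 c2 c3 : 1 <= c1 ^+ 2 + c2 ^+ 2 + c3 ^+ 2 ->
  1 <= ((p ^+ 2 + q ^+ 2) * P + 2 * p * q * k) + (c1 ^+ 2 + c2 ^+ 2 + c3 ^+ 2).
Proof. by move=> c_ge1; rewrite (le_trans c_ge1)// lerDr quadratic_ge0. Qed.

Lemma var2_given1_ge1 : 1 <= var2_given1.
Proof.
rewrite -var2_given1E; apply: residual_ge1.
by rewrite expr0n addr0 expr1n lerDr sqr_ge0.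
Qed.

Lemma vars_given2_ge1 : 1 <= vars_given2.
Proof.
rewrite -vars_given2E; apply: residual_ge1.
by rewrite expr0n add0r expr1n lerDr sqr_ge0.
Qed.

Lemma var2_given_s1_ge1 : 1 <= var2_given_s1.
Proof.
rewrite -var2_given_s1E; apply: residual_ge1.
by rewrite expr1n addrAC lerDr addr_ge0// sqr_ge0.
Qed.

End linear_estimation.

(** * Identification with the stated bounds and existence of the maxima *)

Section maximal_bounds.
Context (R : realType).

(** The Schur complement is expanded through the explicit inverse of the two-by-two matrix, whose
    determinant is [A * D - B ^+ 2]. *)
Lemma Sigma_y2_given_sE (SNR INR rho : R)
    (A := 1 + SNR) (B := SNR + rho * Num.sqrt (SNR * INR))
    (D := 1 + SNR + INR + 2 * rho * Num.sqrt (SNR * INR))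
    (u := rho * SNR) (v := rho * SNR + Num.sqrt (SNR * INR)) :
  A * D - B ^+ 2 != 0 ->
  Sigma_y2_given_s SNR INR rho =
  A - (D * u ^+ 2 - 2 * B * u * v + A * v ^+ 2) / (A * D - B ^+ 2).
Proof.
set e := A * D - _ => e0.
have inv1 : Sigma_s_s SNR INR rho *m
    block_mx (D / e)%:M (- B / e)%:M (- B / e)%:M (A / e)%:M = 1%:M.
  rewrite mulmx_block -!scalar_mxM -!raddfD/= -/A -/B -/D scalar_mx_block.
  have -> : A * (D / e) + B * (- B / e) = 1 by rewrite /e; field.
  have -> : A * (- B / e) + B * (A / e) = 0 by field.
  have -> : B * (D / e) + D * (- B / e) = 0 by field.
  have -> : B * (- B / e) + D * (A / e) = 1 by rewrite /e; field.
  by rewrite raddf0.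
have [unitS _] := mulmx1_unit inv1.
rewrite /Sigma_y2_given_s.
have -> : invmx (Sigma_s_s SNR INR rho) =
    block_mx (D / e)%:M (- B / e)%:M (- B / e)%:M (A / e)%:M.
  by rewrite -[RHS]mul1mx -(mulVmx unitS) -mulmxA inv1 mulmx1.
rewrite /Sigma_y2_s -/u -/v tr_row_mx !tr_scalar_mx mul_row_block mul_row_col.
rewrite -!scalar_mxM -!raddfD/= -!scalar_mxM -!raddfD/= mxE eqxx mulr1n -/A.
by congr (_ - _); field.
Qed.

Variables (hd hc P : R).
Hypothesis P_gt0 : 0 < P.

(** Sign of [hd * hc]. The stated bounds contain [sqrt (SNR * INR) = |hd * hc| * P] whereas the
    covariances carry the sign, so [rho] corresponds to [k = eps * rho * P]; the factor [eps] left
    on covariances disappears since they enter quadratically. *)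
Let eps : R := if 0 <= hd * hc then 1 else -1.

Let epsK : eps ^+ 2 = 1.
Proof. by rewrite /eps; case: ifP => _; rewrite ?sqrrN expr1n. Qed.

Let sqrtE : Num.sqrt ((hd ^+ 2 * P) * (hc ^+ 2 * P)) = eps * (hd * hc * P).
Proof.
rewrite (_ : _ * _ = (hd * hc * P) ^+ 2); last by ring.
rewrite sqrtr_sqr normrM (gtr0_norm P_gt0) mulrA /eps.
case: ifP => h; first by rewrite ger0_norm// mul1r.
by rewrite ltr0_norm ?mulN1r// ltNge h.
Qed.

Let corr_le rho : `|rho| <= 1 -> `|eps * rho * P| <= P.
Proof.
move=> r1; rewrite !normrM (gtr0_norm P_gt0) (_ : `|eps| = 1); last first.
  by rewrite /eps; case: ifP => _; rewrite ?normrN normr1.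
by rewrite mul1r ler_piMl// ltW.
Qed.

Let var1E rho : 1 + hd ^+ 2 * P + hc ^+ 2 * P
  + 2 * rho * Num.sqrt ((hd ^+ 2 * P) * (hc ^+ 2 * P))
  = var1 hd hc P (eps * rho * P).
Proof. by rewrite sqrtE /var1; ring. Qed.

Let cov12E rho : rho * (hd ^+ 2 * P) + Num.sqrt ((hd ^+ 2 * P) * (hc ^+ 2 * P))
  = eps * cov12 hd hc P (eps * rho * P).
Proof.
rewrite sqrtE /cov12 mulrDr [hd ^+ 2 * (_ * _)]mulrC !mulrA -expr2 epsK mul1r.
by congr (_ + _); ring.
Qed.

Let cov1sE rho : hd ^+ 2 * P + rho * Num.sqrt ((hd ^+ 2 * P) * (hc ^+ 2 * P))
  = cov1s hd hc P (eps * rho * P).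
Proof. by rewrite sqrtE /cov1s; ring. Qed.

Let R2_boundE rho : R2_bound (hd ^+ 2 * P) (hc ^+ 2 * P) rho
  = 2^-1 * log2 (var2_given1 hd hc P (eps * rho * P)).
Proof. by rewrite /R2_bound var1E cov12E exprMn epsK mul1r. Qed.

Let Sigma_y2E rho : `|rho| <= 1 ->
  Sigma_y2_given_s (hd ^+ 2 * P) (hc ^+ 2 * P) rho
  = var2_given_s1 hd hc P (eps * rho * P).
Proof.
move=> /corr_le kP.
rewrite Sigma_y2_given_sE; rewrite !var1E cov1sE -/(var2 hd P) -/(det1s hd hc P _);
  last by rewrite gt_eqF// (lt_le_trans _ (det1s_ge1 hd hc kP)).
rewrite cov12E (_ : rho * _ = eps * (hd ^+ 2 * (eps * rho * P))); last first.
  transitivity (eps ^+ 2 * (rho * (hd ^+ 2 * P))); first by rewrite epsK mul1r.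
  by ring.
rewrite /var2_given_s1; move: (det1s _ _ _ _) (hd ^+ 2 * _) (cov12 _ _ _ _).
move: (cov1s _ _ _ _) (var1 _ _ _ _) (var2 _ _) => t x y d u v.
rewrite (_ : x * (eps * u) ^+ 2 - 2 * t * (eps * u) * (eps * v) + y * (eps * v) ^+ 2
  = eps ^+ 2 * (x * u ^+ 2 - 2 * t * u * v + y * v ^+ 2)); last by ring.
by rewrite epsK mul1r.
Qed.

Let sum_boundE rho : `|rho| <= 1 ->
  sum_bound (hd ^+ 2 * P) (hc ^+ 2 * P) rho
  = 2^-1 * log2 (vars_given2 hd hc P (eps * rho * P))
    + 2^-1 * log2 (var2_given_s1 hd hc P (eps * rho * P)).
Proof.
move=> r1; rewrite /sum_bound var1E cov12E exprMn epsK mul1r.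
by rewrite Sigma_y2E.
Qed.

(** The map [rho -> eps * rho * P] sends [[-1, 1]] onto [[- P, P]], with inverse [k -> eps * k / P].
    The maximum over [rho], attained by compactness, thus dominates [g] at every admissible [k]. *)
Let max_exists (f g : R -> R) :
  (forall rho, `|rho| <= 1 -> f rho = g (eps * rho * P)) ->
  (forall k, `|k| <= P -> {for k, continuous g}) ->
  exists2 m, is_max `[-1, 1] f m & forall k, `|k| <= P -> g k <= m.
Proof.
move=> fg cg; pose h rho := g (eps * rho * P).
have ch : {within `[-1, 1], continuous h}.
  apply: continuous_in_subspaceT => rho; rewrite inE/= in_itv/= -ler_norml => r1.
  rewrite /h; apply: (@continuous_comp _ _ _ (fun rho => eps * rho * P) g).
    by apply: cvgM; [apply: cvgM; [exact: cvg_cst|exact: cvg_id]|exact: cvg_cst].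
  exact/cg/corr_le.
have le11 : -1 <= 1 :> R by rewrite (le_trans (lerN10 R)).
have [c c1 cmax] := EVT_max le11 ch.
have c1' : `|c| <= 1 by rewrite ler_norml; move: c1; rewrite in_itv.
exists (h c).
  split; first by exists c => //; exact: fg.
  move=> _ [rho /= r1 <-]; rewrite fg; first exact: cmax.
  by rewrite ler_norml; move: r1; rewrite in_itv.
move=> k kP; have -> : g k = h (eps * k / P).
  by rewrite /h mulrA divfK ?gt_eqF// mulrA -expr2 epsK mul1r.
apply: cmax; rewrite in_itv/= -ler_norml !normrM normfV (gtr0_norm P_gt0).
rewrite ler_pdivrMr// mul1r (_ : `|eps| = 1) ?mul1r//.
by rewrite /eps; case: ifP => _; rewrite ?normrN normr1.
Qed.

Let continuous_log2 (f : R -> R) k : {for k, continuous f} -> 1 <= f k ->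
  {for k, continuous (fun k => 2^-1 * log2 (f k))}.
Proof.
move=> cf f1; apply: cvgM; first exact: cvg_cst.
apply: cvgM; last exact: cvg_cst.
apply: (continuous_comp cf); apply: continuous_ln; exact: lt_le_trans f1.
Qed.

Let continuous_const (a k : R) : {for k, continuous (fun _ : R => a)}.
Proof. exact: cvg_cst. Qed.

Let continuous_add (f g : R -> R) k : {for k, continuous f} ->
  {for k, continuous g} -> {for k, continuous (fun k => f k + g k)}.
Proof. exact: cvgD. Qed.

Let continuous_sub (f g : R -> R) k : {for k, continuous f} ->
  {for k, continuous g} -> {for k, continuous (fun k => f k - g k)}.
Proof. exact: cvgB. Qed.

Let continuous_mul (f g : R -> R) k : {for k, continuous f} ->
  {for k, continuous g} -> {for k, continuous (fun k => f k * g k)}.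
Proof. exact: cvgM. Qed.

Let continuous_sqr (f : R -> R) k : {for k, continuous f} ->
  {for k, continuous (fun k => f k ^+ 2)}.
Proof. by move=> cf; apply: cvgM. Qed.

Let continuous_div (f g : R -> R) k : {for k, continuous f} ->
  {for k, continuous g} -> 1 <= g k -> {for k, continuous (fun k => f k / g k)}.
Proof.
move=> cf cg g1; apply: cvgM => //; apply: cvgV => //.
by rewrite gt_eqF// (lt_le_trans _ g1).
Qed.

Let continuous_linear (a b k : R) : {for k, continuous (fun k => a + b * k)}.
Proof. by apply: continuous_add => //; apply: continuous_mul => //; exact: cvg_id. Qed.

Let continuous_var1 k : {for k, continuous (fun k => var1 hd hc P k)}.
Proof. exact: continuous_linear. Qed.

Let continuous_scale (a k : R) : {for k, continuous (fun k => a * k)}.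
Proof. by apply: continuous_mul => //; exact: cvg_id. Qed.

Let continuous_cov12 k : {for k, continuous (fun k => cov12 hd hc P k)}.
Proof. by apply: continuous_add => //; exact: continuous_scale. Qed.

Let continuous_cov1s k : {for k, continuous (fun k => cov1s hd hc P k)}.
Proof. exact: continuous_linear. Qed.

Lemma R2_bound_max : exists2 m,
  is_max `[-1, 1] (R2_bound (hd ^+ 2 * P) (hc ^+ 2 * P)) m &
  forall k, `|k| <= P -> 2^-1 * log2 (var2_given1 hd hc P k) <= m.
Proof.
apply: max_exists => [rho _|k kP]; first exact: R2_boundE.
apply: (continuous_log2 (f := var2_given1 hd hc P)); last exact: var2_given1_ge1.
rewrite /var2_given1; apply: continuous_sub => //.
apply: continuous_div; [exact: continuous_sqr|exact: continuous_var1|exact: var1_ge1].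
Qed.

Lemma sum_bound_max : exists2 m,
  is_max `[-1, 1] (sum_bound (hd ^+ 2 * P) (hc ^+ 2 * P)) m &
  forall k, `|k| <= P -> 2^-1 * log2 (vars_given2 hd hc P k)
    + 2^-1 * log2 (var2_given_s1 hd hc P k) <= m.
Proof.
apply: (max_exists (g := fun k => 2^-1 * log2 (vars_given2 hd hc P k)
    + 2^-1 * log2 (var2_given_s1 hd hc P k))) => [rho /sum_boundE//|k kP].
have cu : {for k, continuous (fun k => hd ^+ 2 * k)} by exact: continuous_scale.
apply: continuous_add.
  apply: (continuous_log2 (f := vars_given2 hd hc P)); last exact: vars_given2_ge1.
  rewrite /vars_given2; apply: continuous_sub; first exact: continuous_var1.
  by apply: continuous_div; [exact: continuous_sqr| |exact: var2_ge1 kP].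
apply: (continuous_log2 (f := var2_given_s1 hd hc P)); last exact: var2_given_s1_ge1.
rewrite /var2_given_s1; apply: continuous_sub => //.
apply: continuous_div; last exact: det1s_ge1.
  apply: continuous_add.
    apply: continuous_sub.
      by apply: continuous_mul; [exact: continuous_var1|exact: continuous_sqr].
    apply: continuous_mul; last exact: continuous_cov12.
    by apply: continuous_mul => //; apply: continuous_mul.
  by apply: continuous_mul => //; exact: continuous_sqr.
rewrite /det1s; apply: continuous_sub; last exact: continuous_sqr.
by apply: continuous_mul => //; exact: continuous_var1.
Qed.

End maximal_bounds.

(** * Decoding errors, leakage and cooperation *)

Section means.
Local Open Scope ereal_scope.
Context (R : realType).

Lemma mean_le_comp d (T : measurableType d) (P : probability T R)
    d' (T' : measurableType d') (Q : probability T' R) (g : T -> T')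
    (D : T' -> \bar R) (x : R) :
  measurable_fun setT g ->
  (forall F, measurable_fun setT F -> (forall y, 0 <= F y) ->
    \int[P]_t F (g t) = \int[Q]_y F y) ->
  mean_le Q D x -> mean_le P (fun t => D (g t)) x.
Proof.
move=> mg PQ [p [n [[mp p0] [mn n0] le fin int]]].
exists (fun t => p (g t)), (fun t => n (g t)); split => //.
- by split => //; exact: measurable_fun_comp.
- by split => //; exact: measurable_fun_comp.
- by rewrite PQ.
- by rewrite !PQ.
Qed.

(** The logarithmic loss of the soft decision is [ln 2] when the decoder is right and [ln 2 + ln M]
    when it is wrong: the two terms of Fano's inequality. *)
Lemma mean_le_guess d (T : measurableType d) (P : probability T R)
    dG (G : measurableType dG) (M : nat) (dec : G -> nat) (f : T -> nat)
    (g : T -> G) (e : R) : (0 < M)%N ->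
  measurable_fun setT dec -> measurable_fun setT f -> measurable_fun setT g ->
  \int[P]_t (dec (g t) != f t)%:R%:E <= e%:E ->
  mean_le P (fun t => (- ln (guess M dec (f t) (g t)))%:E)
    (ln 2 + ln M%:R * e)%R.
Proof.
move=> M0 mdec mf mg Pe.
have M1 : (0 <= ln (M%:R : R))%R by rewrite ln_ge0// ler1n.
have two0 : (0 < 2 :> R)%R by [].
have M0' : (0 < M%:R :> R)%R by rewrite ltr0n.
have mne : measurable_fun setT (fun t => (dec (g t) != f t)%:R : R).
  apply: (measurable_fun_comp (g := fun b : bool => (b%:R : R))) => //.
  apply: measurable_neg; apply: measurable_fun_eqn => //.
  exact: measurable_fun_comp.
rewrite (_ : (fun t => _) = (fun t => (ln 2)%:E +
    (ln M%:R * (dec (g t) != f t)%:R)%:E)); last first.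
  apply/funext => t; rewrite -EFinD /guess.
  case: eqP => _ /=; rewrite lnV ?posrE ?mulr_gt0// opprK.
    by rewrite mulr0 addr0.
  by rewrite lnM ?posrE// mulr1.
apply: mean_le_nonneg.
- by apply: emeasurable_funD => //; apply/measurable_EFinP; exact: measurable_funM.
- by move=> t; rewrite -EFinD lee_fin addr_ge0 ?ln_ge0 ?mulr_ge0// ler1n.
- rewrite ge0_integralD//; last 3 first.
  + by move=> t _; rewrite lee_fin ln_ge0// ler1n.
  + by move=> t _; rewrite lee_fin mulr_ge0.
  + by apply/measurable_EFinP; exact: measurable_funM.
  rewrite integral_probability_cst EFinD leeD2l// ge0_integralZ_real//.
  by rewrite EFinM lee_wpmul2l.
Qed.

End means.

(** * Leakage as the mean of a log-density *)

Section relative_entropy.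
Local Open Scope ereal_scope.
Context d (T : measurableType d) (R : realType).

(** A finite divergence provides a density whose logarithm may still be [-oo] on a null set. Setting
    the density to 1 where it vanishes gives the real function [L]; its negative part has finite
    mean, so the divergence controls the positive part. *)
Lemma kl_divergence_density (nu mu : probability T R) (k : R) :
  kl_divergence nu mu = k%:E ->
  exists f : T -> R, [/\ measurable_fun setT f, forall x, (0 <= f x)%R,
    forall F, measurable_fun setT F -> (forall x, 0 <= F x) ->
      \int[nu]_x F x = \int[mu]_x (F x * (f x)%:E) &
    mean_le nu (fun x => (ln (if f x == 0%R then 1%R else f x))%:E) (ln 2 * k)].
Proof.
rewrite /kl_divergence; case: asboolP => // numu.
set g := Radon_Nikodym_SigmaFinite.f nu mu => klE.
pose f x := fine (g x).
have fE x : g x = (f x)%:E by rewrite fineK//; exact: Radon_Nikodym_SigmaFinite.f_fin_num.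
have f0 x : (0 <= f x)%R by apply: fine_ge0; exact: Radon_Nikodym_SigmaFinite.f_ge0.
have mf : measurable_fun setT f.
  apply: measurable_fun_fine; apply: measurable_int.
  exact: Radon_Nikodym_SigmaFinite.f_integrable numu.
have change F : measurable_fun setT F -> (forall x, 0 <= F x) ->
    \int[nu]_x F x = \int[mu]_x (F x * (f x)%:E).
  move=> mF F0; rewrite -(Radon_Nikodym_SigmaFinite.change_of_variables numu)//.
  by apply: eq_integral => x _; rewrite -fE.
exists f; split => //.
pose pos x := if f x == 0%R then 1%R else f x.
have feq0 : measurable_fun setT (fun x => f x == 0%R).
  by apply: measurable_fun_eqr => //; exact: measurable_cst.
have mpos : measurable_fun setT pos by apply: measurable_fun_ifT.
pose L x := (ln (pos x))%:E : \bar R.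
have mL : measurable_fun setT L.
  by apply: measurable_fun_EFin; apply: (measurable_fun_comp (g := @ln R)).
pose lg x := lne (g x).
have lgE x : lg x = if f x == 0%R then -oo else L x.
  rewrite /lg fE /L /pos /=; case: eqP => [->|/eqP fx0]; first by rewrite lexx.
  by rewrite leNgt lt_neqAle f0 eq_sym fx0.
have mlg : measurable_fun setT lg.
  rewrite (_ : lg = fun x => if f x == 0%R then -oo else L x); last exact/funext.
  by apply: measurable_fun_ifT.
have mp : measurable_fun setT L^\+ by exact: measurable_funepos.
have mn : measurable_fun setT L^\- by exact: measurable_funeneg.
have posE x : (lg ^\+) x = (L ^\+) x.
  rewrite !funeposE lgE /L /pos; case: eqP => // _.
  by rewrite ln1 maxxx max_r// leNye.
have negE : \int[nu]_x (lg ^\-) x = \int[nu]_x (L ^\-) x.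
  rewrite !change//; last exact: measurable_funeneg.
  apply: eq_integral => x _; rewrite !funenegE lgE; case: eqP => // ->.
  by rewrite !mule0.
(* Against [mu], where [0 < f < 1], the integrand is [- f * ln f <= 1 - f <= 1], by [ln t <= t - 1]
   at [t = 1 / f]. *)
have neg_le1 : \int[nu]_x (L ^\-) x <= 1.
  rewrite change// -[leRHS](integral_probability_cst mu).
  apply: integral_mono => //.
  - by apply: emeasurable_funM => //; exact/measurable_EFinP.
  - by move=> x; rewrite mule_ge0// lee_fin.
  move=> x; rewrite funenegE /L /pos.
  case: eqP => [->|/eqP fx0]; first by rewrite mule0.
  have fx : (0 < f x)%R by rewrite lt_neqAle eq_sym fx0 f0.
  rewrite maxEle; case: ifPn => _; first by rewrite mul0e.
  rewrite -EFinN -EFinM lee_fin -lnV ?posrE//.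
  rewrite (@le_trans _ _ (((f x)^-1 - 1) * f x)%R)//.
    by rewrite ler_wpM2r// ln_le_subr1// invr_gt0.
  by rewrite mulrBl mulVf// mul1r gerBl.
have klE' : \int[nu]_x lg x = (ln 2 * k)%:E.
  have ln2 : ln 2 != 0%R :> R by rewrite gt_eqF// ln_gt0// ltr1n.
  have := congr1 (fun y => (ln 2)%:E * y) klE.
  by rewrite muleA -!EFinM mulfV// mul1e.
exists L^\+, L^\-; split => //.
- move=> x; rewrite funeposE funenegE /L -/(pos x); move: (ln (pos x)) => r.
  rewrite -EFinN -!EFin_max -EFinD lee_fin /Num.max.
  by case: ltP => h1; case: ltP => h2; lra.
- by rewrite (le_lt_trans neg_le1)// ltry.
- rewrite -klE' [\int[nu]_x lg x]integralE negE.
  rewrite (eq_integral (L^\+)) => [|x _]; last exact: posE.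
  rewrite subeK// ge0_fin_numE; last by apply: integral_ge0.
  by rewrite (le_lt_trans neg_le1)// ltry.
Qed.

End relative_entropy.

(** * Countable alphabets *)

Section countable.
Local Open Scope ereal_scope.
Context d (V : measurableType d) (R : realType).
Variable e : V -> nat.
Hypotheses (e_inj : injective e) (m1 : forall x : V, measurable [set x]).

Let fiber i := [set x | e x = i].

Let fiberE x : fiber (e x) = [set x].
Proof. by apply/seteqP; split => y /= => [/e_inj|->]. Qed.

Let fiber0 i : ~ range e i -> fiber i = set0.
Proof. by move=> nei; apply/seteqP; split => // x /= xi; apply: nei; exists x. Qed.

Let mfiber i : measurable (fiber i).
Proof.
have [[x _ <-]|/fiber0 ->//] := pselect (range e i).
by rewrite fiberE.
Qed.

Lemma measurable_countable (A : set V) : measurable A.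
Proof.
rewrite (_ : A = \bigcup_i (A `&` fiber i)); last first.
  apply/seteqP; split => [x Ax|x [i _ []]//]; by exists (e x).
apply: bigcup_measurable => i _.
have [[x [Ax xi]]|nA] := pselect (exists x, A x /\ e x = i).
  rewrite (_ : _ `&` _ = [set x])//.
  apply/seteqP; split => y /=; last by move=> ->.
  by move=> [_]; rewrite /fiber/= -xi => /e_inj.
rewrite (_ : _ `&` _ = set0)//; apply/seteqP; split => // y [Ay yi].
by apply: nA; exists y.
Qed.

Lemma measurable_fun_countable d' (T : measurableType d') (f : V -> T) :
  measurable_fun setT f.
Proof. by move=> _ B _; exact: measurable_countable. Qed.

(** Cutting the space into the fibres of the injection turns the integral into a sum over atoms, the
    form in which [entropy] is defined. *)
Lemma integral_countable (nu : probability V R) (f : V -> \bar R) :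
  (forall x, 0 <= f x) ->
  \int[nu]_x f x = \esum_(x in [set: V]) (f x * nu [set x]).
Proof.
move=> f0; pose t i := \int[nu]_(x in fiber i) f x.
have t0 i : 0 <= t i by apply: integral_ge0.
have <- : \bigcup_i fiber i = setT.
  by apply/seteqP; split => // x _; exists (e x).
rewrite ge0_integral_bigcup//; last 2 first.
- by apply: measurable_funTS; exact: measurable_fun_countable.
- by move=> i j _ _ [x [/= <- <-]].
rewrite -/t nneseries_esumT//.
rewrite (_ : \esum_(i in _) _ = \esum_(i in range e) t i).
  rewrite esum_image; last by move=> x y _ _ /e_inj.
  have -> : \bigcup_i fiber i = setT.
    by apply/seteqP; split => // x _; exists (e x).
  apply: eq_esum => x _; rewrite /t fiberE.
  transitivity (\int[nu]_(y in [set x]) f x); last by rewrite integral_cst.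
  by apply: eq_integral => y /set_mem ->.
rewrite [RHS]esum_mkcond; apply: eq_esum => i _.
case: ifPn => //; rewrite notin_setE => /fiber0; rewrite /t => ->.
by rewrite integral_set0.
Qed.

End countable.

(** * Bounds for one code *)

Section gaussian_bounds.
Local Open Scope ereal_scope.
Context (R : realType) (N : nat).
Local Notation G := (N.-tuple R).
Local Notation gN := (@gaussN R N).
Context dS (S1 : measurableType dS) (tau : probability S1 R)
  dU (U : measurableType dU) (kappa : probability U R) (pi1 : probability nat R)
  dV (V : measurableType dV).
Variables (v : U -> V) (in1 : 'I_N -> nat * V * S1 -> R) (in2 : 'I_N -> U -> R)
  (w2 : U -> nat) (hd hc P : R).
Hypotheses (mv : measurable_fun setT v)
  (min1 : forall i, measurable_fun setT (in1 i))
  (min2 : forall i, measurable_fun setT (in2 i))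
  (mw2 : measurable_fun setT w2).
Local Notation theta := (U * (nat * S1))%type.
Local Notation space := (theta * (G * (G * G)))%type.
Local Notation theta_law := (theta_law tau kappa pi1).
Local Notation space_law := (space_law N tau kappa pi1).
Let x1 i (th : theta) : R := in1 i (th.2.1, v th.1, th.2.2).
Let x2 i (th : theta) : R := in2 i th.1.
Hypotheses
  (power1 : forall i, \int[theta_law]_th (x1 i th ^+ 2)%:E <= P%:E)
  (power2 : forall i, \int[theta_law]_th (x2 i th ^+ 2)%:E <= P%:E).

Definition scaled_input d (T : measurableType d) (h : R) (f : 'I_N -> T -> R) (x : T) : G :=
  [tuple (h * f i x)%R | i < N].

Lemma measurable_scaled_input d (T : measurableType d) (h : R) (f : 'I_N -> T -> R) :
  (forall i, measurable_fun setT (f i)) -> measurable_fun setT (scaled_input h f).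
Proof.
move=> mf; apply/measurable_fun_tnthP => i.
rewrite (_ : _ \o _ = fun x => h * f i x)%R.
  by apply: measurable_funM => //; exact: mf.
by apply/funext => x; rewrite /= tnth_mktuple.
Qed.

Local Notation a := (scaled_input hd in1).
Local Notation b := (scaled_input hc in2).
Local Notation c := (scaled_input hd in2).

Let ma : measurable_fun setT a. Proof. exact: measurable_scaled_input. Qed.
Let mb : measurable_fun setT b. Proof. exact: measurable_scaled_input. Qed.
Let mc : measurable_fun setT c. Proof. exact: measurable_scaled_input. Qed.

Let mx1 i : measurable_fun setT (x1 i).
Proof. by apply: (measurable_fun_comp (min1 i)); measurability. Qed.

Let mx2 i : measurable_fun setT (x2 i).
Proof. by apply: (measurable_fun_comp (min2 i)); measurability. Qed.

Let out1_tnth (x : space) i : tnth (out1 v a b x) i =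
  (hc * x2 i x.1 + (hd * x1 i x.1 + tnth x.2.1 i))%R.
Proof. by rewrite /out1 /direct !tnth_mktuple. Qed.

Let out2_tnth (x : space) i : tnth (out2 c x) i = (hd * x2 i x.1 + tnth x.2.2.1 i)%R.
Proof. by rewrite /out2 !tnth_mktuple. Qed.

Let side_tnth (x : space) i : tnth (side v a x) i = (hd * x1 i x.1 + tnth x.2.2.2 i)%R.
Proof. by rewrite /side /direct !tnth_mktuple. Qed.

Let mout1 : measurable_fun setT (out1 v a b : space -> G).
Proof. exact: (measurable_out1 mv ma mb (@measurable_id _ _ _)). Qed.

Let mout2 : measurable_fun setT (out2 c : space -> G).
Proof. exact: (measurable_out2 mc (@measurable_id _ _ _)). Qed.

Let mside : measurable_fun setT (side v a : space -> G).
Proof. exact: (measurable_side mv ma (@measurable_id _ _ _)). Qed.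

Let correlation i : exists2 k : R, (`|k| <= P)%R & forall p q : R,
  \int[theta_law]_t ((p * x1 i t + q * x2 i t) ^+ 2)%:E
  <= ((p ^+ 2 + q ^+ 2) * P + 2 * p * q * k)%:E.
Proof. exact: quadratic_moment_bound. Qed.

(** A correlation is fixed for each letter separately; the coefficients and deviations of the test
    densities vary with the letter accordingly. *)
Let k i : R := s2val (cid2 (correlation i)).

Let kP i : (`|k i| <= P)%R. Proof. exact: s2valP (cid2 (correlation i)). Qed.

Let residual_bound (r : space -> R) i (p q c1 c2 c3 v0 : R) :
  (forall x, r x = p * x1 i x.1 + q * x2 i x.1 + c1 * tnth x.2.1 i
    + c2 * tnth x.2.2.1 i + c3 * tnth x.2.2.2 i)%R ->
  ((p ^+ 2 + q ^+ 2) * P + 2 * p * q * k i + (c1 ^+ 2 + c2 ^+ 2 + c3 ^+ 2) = v0)%R ->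
  \int[space_law]_x (r x ^+ 2)%:E <= v0%:E.
Proof.
move=> rE <-; under eq_integral do rewrite rE.
exact: (residual_moment i (mx1 i) (mx2 i) (s2valP' (cid2 (correlation i)))).
Qed.

Let noise2_sqr i : \int[space_law]_x (tnth x.2.2.1 i ^+ 2)%:E = 1.
Proof.
rewrite integral_space_law; last 2 first.
- apply/measurable_EFinP; apply: measurable_funX; apply: measurable_fun_tnth.
  by measurability.
- by move=> x; rewrite lee_fin sqr_ge0.
rewrite -[RHS](integral_probability_cst theta_law).
apply: eq_integral => th _ /=.
rewrite -[RHS](integral_probability_cst gN).
apply: eq_integral => z1 _ /=.
under eq_integral do rewrite integral_probability_cst.
rewrite (integral_gaussN_tnth i (F := fun z : R => (z ^+ 2)%:E)).
- exact: integral_gauss1_sqr.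
- by apply/measurable_EFinP; exact: exprn_measurable.
- by move=> z; rewrite lee_fin sqr_ge0.
Qed.

Let noise3_sqr i : \int[space_law]_x (tnth x.2.2.2 i ^+ 2)%:E = 1.
Proof.
rewrite integral_space_law; last 2 first.
- apply/measurable_EFinP; apply: measurable_funX; apply: measurable_fun_tnth.
  by measurability.
- by move=> x; rewrite lee_fin sqr_ge0.
rewrite -[RHS](integral_probability_cst theta_law).
apply: eq_integral => th _ /=.
rewrite -[RHS](integral_probability_cst gN).
apply: eq_integral => z1 _ /=.
rewrite -[RHS](integral_probability_cst gN).
apply: eq_integral => z2 _ /=.
rewrite (integral_gaussN_tnth i (F := fun z : R => (z ^+ 2)%:E)).
- exact: integral_gauss1_sqr.
- by apply/measurable_EFinP; exact: exprn_measurable.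
- by move=> z; rewrite lee_fin sqr_ge0.
Qed.

Let sg (vr : 'I_N -> R) i := Num.sqrt (vr i).

Let sg_ge1 vr : (forall i, 1 <= vr i)%R -> forall i, (1 <= sg vr i)%R.
Proof. by move=> v1 i; rewrite -[leLHS]sqrtr1 ler_wsqrtr. Qed.

Let sg_sqr vr : (forall i, 1 <= vr i)%R -> forall i, (sg vr i ^+ 2 = vr i)%R.
Proof. by move=> v1 i; rewrite sqr_sqrtr// (le_trans _ (v1 i)). Qed.

Let ln_sg vr : (forall i, 1 <= vr i)%R ->
  forall i, (ln (sg vr i) = ln 2 * (2^-1 * log2 (vr i)))%R.
Proof.
move=> v1 i; have ln2 : ln 2 != 0%R :> R by rewrite gt_eqF// ln_gt0// ltr1n.
have s0 : (0 < sg vr i)%R by rewrite (lt_le_trans _ (sg_ge1 v1 i)).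
rewrite /log2 mulrCA [(ln 2 * _)%R]mulrC divfK// -(sg_sqr v1) expr2 lnM ?posrE//.
by field.
Qed.

Let sum_rate vr (B : R) : (forall i, 1 <= vr i)%R ->
  (forall i, 2^-1 * log2 (vr i) <= B)%R ->
  (\sum_(i < N) ln (sg vr i) <= N%:R * (ln 2 * B))%R.
Proof.
move=> v1 vB; rewrite mulr_natl -[X in (_ *+ X)%R](card_ord N) -sumr_const.
apply: ler_sum => i _; rewrite (ln_sg v1).
by rewrite ler_wpM2l// ln_ge0// ler1n.
Qed.

Definition combine (p q : 'I_N -> R) (y y' : G) : G :=
  [tuple (p i * tnth y i + q i * tnth y' i)%R | i < N].

Lemma measurable_combine d (T : measurableType d) (p q : 'I_N -> R) (f g : T -> G) :
  measurable_fun setT f -> measurable_fun setT g ->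
  measurable_fun setT (fun x => combine p q (f x) (g x)).
Proof.
move=> mf mg; apply/measurable_fun_tnthP => i.
rewrite (_ : _ \o _ = fun x => p i * tnth (f x) i + q i * tnth (g x) i)%R.
  by apply: measurable_funD; apply: measurable_funM => //; exact: measurable_fun_tnth.
by apply/funext => x; rewrite /= tnth_mktuple.
Qed.

Let mean_side (vr : 'I_N -> R) (m : space -> G) (p q c1 c2 c3 : 'I_N -> R) :
  measurable_fun setT m -> (forall i, 1 <= vr i)%R ->
  (forall i x, tnth (side v a x) i - tnth (m x) i =
    p i * x1 i x.1 + q i * x2 i x.1 + c1 i * tnth x.2.1 i
    + c2 i * tnth x.2.2.1 i + c3 i * tnth x.2.2.2 i)%R ->
  (forall i, (p i ^+ 2 + q i ^+ 2) * P + 2 * p i * q i * k i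
    + (c1 i ^+ 2 + c2 i ^+ 2 + c3 i ^+ 2) = vr i)%R ->
  mean_le space_law (fun x => (- ln (gauss_density (sg vr) (m x) (side v a x))
    + ln (lik (direct v a x.1) (side v a x)))%:E) (\sum_(i < N) ln (sg vr i))%R.
Proof.
move=> mm v1 resE varE; apply: (mean_le_gauss (sg_ge1 v1)) => //.
- by apply: (measurable_direct mv ma); measurability.
- by move=> i; rewrite (sg_sqr v1); exact: residual_bound (resE i) (varE i).
- move=> i; rewrite -[RHS](noise3_sqr i); apply: eq_integral => x _.
  by rewrite side_tnth tnth_mktuple; congr (_%:E); rewrite /x1/=; ring.
Qed.

Let mean_out2 (vr : 'I_N -> R) (m : space -> G) (p q c1 c2 c3 : 'I_N -> R) :
  measurable_fun setT m -> (forall i, 1 <= vr i)%R ->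
  (forall i x, tnth (out2 c x) i - tnth (m x) i =
    p i * x1 i x.1 + q i * x2 i x.1 + c1 i * tnth x.2.1 i
    + c2 i * tnth x.2.2.1 i + c3 i * tnth x.2.2.2 i)%R ->
  (forall i, (p i ^+ 2 + q i ^+ 2) * P + 2 * p i * q i * k i
    + (c1 i ^+ 2 + c2 i ^+ 2 + c3 i ^+ 2) = vr i)%R ->
  mean_le space_law (fun x => (- ln (gauss_density (sg vr) (m x) (out2 c x))
    + ln (lik (c x.1.1) (out2 c x)))%:E) (\sum_(i < N) ln (sg vr i))%R.
Proof.
move=> mm v1 resE varE; apply: (mean_le_gauss (sg_ge1 v1)) => //.
- by apply: (measurable_fun_comp mc); measurability.
- by move=> i; rewrite (sg_sqr v1); exact: residual_bound (resE i) (varE i).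
- move=> i; rewrite -[RHS](noise2_sqr i); apply: eq_integral => x _.
  by rewrite out2_tnth tnth_mktuple; congr (_%:E); rewrite /x2/=; ring.
Qed.

Variables (M1 M2 : nat) (dec1 dec2 : G -> nat).
Hypotheses (M1_gt0 : (0 < M1)%N) (mdec1 : measurable_fun setT dec1)
  (pi1M : forall m, pi1 [set m] <= (M1%:R^-1)%:E).
Hypotheses (M2_gt0 : (0 < M2)%N) (mdec2 : measurable_fun setT dec2).

Lemma message1_rate (e : R) :
  mean_le space_law (fun x : space =>
    (- ln (guess M1 dec1 x.1.2.1 (vadd (b x.1.1) (side v a x))))%:E) e ->
  (ln (M1%:R : R) <= e + N%:R * (ln 2 * (2^-1 * log2 (1 + hd ^+ 2 * P))))%R.
Proof.
move=> me; pose vr (_ : 'I_N) := var2 hd P.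
have v1 i : (1 <= vr i)%R by exact: (var2_ge1 hd (kP i)).
pose zero : G := [tuple 0%R | _ < N].
apply: (@le_trans _ _ (e + \sum_(i < N) ln (sg vr i))%R); last first.
  by rewrite lerD2l; exact: sum_rate.
apply: (message1_bound mv ma mb mc M1_gt0 mdec1 pi1M
  (D := fun p => gauss_density (sg vr) zero p.2)) me _.
- by apply: (measurable_gauss_density (sg_ge1 v1)); measurability.
- by move=> p; exact: (gauss_density_gt0 (sg_ge1 v1)).
- by move=> u y /=; rewrite integral_gauss_density.
(* With nothing conditioned on, the residual is [side] itself: coefficient [hd] on the first input
   and 1 on the genie noise. *)
apply: (mean_side (m := fun=> zero) (p := fun=> hd) (q := fun=> 0%R)
  (c1 := fun=> 0%R) (c2 := fun=> 0%R) (c3 := fun=> 1%R)) => // i => [x|].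
  by rewrite side_tnth tnth_mktuple; ring.
by rewrite /vr /var2; ring.
Qed.

Section secrecy.
Variables (PW : probability nat R) (PY : probability G R) (f : nat * G -> R).
Hypotheses (PWM : forall m, PW [set m] <= (M2%:R^-1)%:E)
  (mf : measurable_fun setT f) (f_ge0 : forall p, (0 <= f p)%R).
Hypothesis fE : forall F : nat * G -> \bar R,
  measurable_fun setT F -> (forall p, 0 <= F p) ->
  \int[space_law]_x F (w2 x.1.1, out1 v a b x)
  = \int[prob_prod PW PY]_p (F p * (f p)%:E).
Variables (e2 l : R).
Hypotheses
  (me2 : mean_le space_law (fun x : space =>
    (- ln (guess M2 dec2 (w2 x.1.1) (out2 c x)))%:E) e2)
  (ml : mean_le space_law (fun x : space =>
    (ln (pos_density f (w2 x.1.1, out1 v a b x)))%:E) l).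

Lemma message2_rate (B : R) :
  (forall k, `|k| <= P -> 2^-1 * log2 (var2_given1 hd hc P k) <= B)%R ->
  (ln (M2%:R : R) <= e2 + N%:R * (ln 2 * B) + l)%R.
Proof.
move=> kB; pose vr i := var2_given1 hd hc P (k i).
have v1 i : (1 <= vr i)%R by exact: var2_given1_ge1.
pose al i := (cov12 hd hc P (k i) / var1 hd hc P (k i))%R.
pose m (y : G) := combine al (fun=> 0%R) y y.
apply: (@le_trans _ _ (e2 + \sum_(i < N) ln (sg vr i) + l)%R); last first.
  by rewrite lerD2r lerD2l; apply: sum_rate => // i; exact: kB.
apply: (message2_bound mv ma mb mc mw2 M2_gt0 mdec2 PWM mf f_ge0 fE me2 ml
  (D := fun p => gauss_density (sg vr) (m p.1) p.2)).
- apply: (measurable_gauss_density (sg_ge1 v1)); last by measurability.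
  by apply: measurable_combine; measurability.
- by move=> p; exact: (gauss_density_gt0 (sg_ge1 v1)).
- by move=> y /=; rewrite integral_gauss_density.
apply: (mean_out2 (m := fun x => m (out1 v a b x)) (p := fun i => (- (al i * hd))%R)
  (q := fun i => (hd - al i * hc)%R) (c1 := fun i => (- al i)%R)
  (c2 := fun=> 1%R) (c3 := fun=> 0%R)) => //.
- by apply: measurable_combine; exact: mout1.
- by move=> i x; rewrite out2_tnth tnth_mktuple out1_tnth; ring.
- by move=> i; exact: var2_given1E.
Qed.

Lemma sum_messages_rate (e1 e1' h1 h2 B : R) :
  (forall x : V, measurable [set x]) -> measurable_fun setT (signal_mass kappa v) ->
  mean_le space_law (fun x : space =>
    (- ln (guess M1 dec1 x.1.2.1 (vadd (b x.1.1) (side v a x))))%:E) e1 ->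
  mean_le space_law (fun x : space =>
    (- ln (guess M1 dec1 x.1.2.1 (out1 v a b x)))%:E) e1' ->
  mean_le space_law (fun x : space =>
    neg_ln (M1%:R * message_mass pi1 x.1.2.1)%R) h1 ->
  mean_le space_law (fun x : space => neg_ln (signal_mass kappa v (v x.1.1))) h2 ->
  (forall k, `|k| <= P -> 2^-1 * log2 (vars_given2 hd hc P k)
    + 2^-1 * log2 (var2_given_s1 hd hc P k) <= B)%R ->
  (ln (M1%:R : R) + ln (M2%:R : R)
    <= e1 + e1' + e2 + N%:R * (ln 2 * B) + l + h1 + h2)%R.
Proof.
move=> mV1 mmass me1 me1' mh1 mh2 kB.
pose vr i := vars_given2 hd hc P (k i); pose vr' i := var2_given_s1 hd hc P (k i).
have v1 i : (1 <= vr i)%R by exact: vars_given2_ge1.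
have v1' i : (1 <= vr' i)%R by exact: var2_given_s1_ge1.
pose al i := (cov12 hd hc P (k i) / var2 hd P)%R.
pose be i := ((var1 hd hc P (k i) * (hd ^+ 2 * k i)
  - cov1s hd hc P (k i) * cov12 hd hc P (k i)) / det1s hd hc P (k i))%R.
pose ga i := ((var2 hd P * cov12 hd hc P (k i)
  - cov1s hd hc P (k i) * (hd ^+ 2 * k i)) / det1s hd hc P (k i))%R.
(* The quantity estimated from the second output is [s + hc x2], but [D1] is a density of [s]: its
   mean is the linear estimate minus the interference [b u]. *)
pose m (u : U) (y : G) := combine al (fun=> - 1)%R y (b u).
pose m' (y1 s : G) := combine be ga s y1.
have mm d (T : measurableType d) (f1 : T -> U) (f2 : T -> G) :
    measurable_fun setT f1 -> measurable_fun setT f2 ->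
    measurable_fun setT (fun x => m (f1 x) (f2 x)).
  by move=> mf1 mf2; apply: measurable_combine => //; exact: measurable_fun_comp.
have mean1 : mean_le space_law (fun x : space =>
    (- ln (gauss_density (sg vr) (m x.1.1 (out2 c x)) (side v a x))
     + ln (lik (direct v a x.1) (side v a x)))%:E) (\sum_(i < N) ln (sg vr i))%R.
  apply: (mean_side (m := fun x => m x.1.1 (out2 c x)) (p := fun=> hd)
    (q := fun i => (hc - al i * hd)%R) (c1 := fun=> 0%R) (c2 := fun i => (- al i)%R)
    (c3 := fun=> 1%R)) => //.
  - by apply: mm; [measurability|exact: mout2].
  - by move=> i x; rewrite side_tnth tnth_mktuple out2_tnth tnth_mktuple /x2; ring.
  - by move=> i; exact: vars_given2E.
have mean2 : mean_le space_law (fun x : space =>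
    (- ln (gauss_density (sg vr') (m' (out1 v a b x) (side v a x)) (out2 c x))
     + ln (lik (c x.1.1) (out2 c x)))%:E) (\sum_(i < N) ln (sg vr' i))%R.
  apply: (mean_out2 (m := fun x => m' (out1 v a b x) (side v a x))
    (p := fun i => (- ((be i + ga i) * hd))%R) (q := fun i => (hd - ga i * hc)%R)
    (c1 := fun i => (- ga i)%R) (c2 := fun=> 1%R) (c3 := fun i => (- be i)%R)) => //.
  - by apply: measurable_combine; [exact: mside|exact: mout1].
  - by move=> i x; rewrite out2_tnth tnth_mktuple out1_tnth side_tnth; ring.
  - by move=> i; exact: var2_given_s1E.
have := mean_leD mean1 mean2.
set S := (\sum_(i < N) ln (sg vr i) + _)%R => mean12.
have SB : (S <= N%:R * (ln 2 * B))%R.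
  rewrite /S -big_split/= mulr_natl -[X in (_ *+ X)%R](card_ord N) -sumr_const.
  apply: ler_sum => i _; rewrite (ln_sg v1) (ln_sg v1') -mulrDr.
  by rewrite ler_wpM2l ?kB// ln_ge0// ler1n.
apply: (@le_trans _ _ (e1 + e1' + e2 + S + l + h1 + h2)%R); last first.
  by rewrite !lerD2r lerD2l.
apply: (sum_messages_bound mv ma mb mc mw2 M1_gt0 mdec1 pi1M M2_gt0 mdec2 PWM mf
  f_ge0 fE me2 ml (D1 := fun p => gauss_density (sg vr) (m p.1.1 p.1.2) p.2)
  (D2 := fun p => gauss_density (sg vr') (m' p.1.1 p.1.2) p.2)) => //.
- apply: (measurable_gauss_density (sg_ge1 v1)); last by measurability.
  by apply: mm; measurability.
- by move=> p; exact: (gauss_density_gt0 (sg_ge1 v1)).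
- by move=> u y /=; rewrite integral_gauss_density.
- apply: (measurable_gauss_density (sg_ge1 v1')); last by measurability.
  by apply: measurable_combine; measurability.
- by move=> p; exact: (gauss_density_gt0 (sg_ge1 v1')).
- by move=> u y /=; rewrite integral_gauss_density.
rewrite (_ : (fun x : space => _) = (fun x : space =>
  (- ln (gauss_density (sg vr) (m x.1.1 (out2 c x)) (side v a x))
     + ln (lik (direct v a x.1) (side v a x)))%:E +
  (- ln (gauss_density (sg vr') (m' (out1 v a b x) (side v a x)) (out2 c x))
     + ln (lik (c x.1.1) (out2 c x)))%:E)) //.
apply/funext => x; rewrite -EFinD; congr (_%:E); rewrite /=; ring.
Qed.

End secrecy.

End gaussian_bounds.

(** * The bounds for a code in terms of its error probabilities and its leakage *)

Section code_bounds.
Local Open Scope ereal_scope.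
Context (R : realType) (N : nat) (c : Defs.code R N) (s : sources c).
Variables (hd hc P CG : R) (M1 M2 : nat) (info : R).
Local Notation G := (N.-tuple R).
Local Notation gN := (@gaussN R N).
Local Notation U := (nat * S2 c)%type.
Local Notation V := (N.-tuple nat).
Hypotheses (M1_gt0 : (0 < M1)%N) (M2_gt0 : (0 < M2)%N)
  (spec : sources_spec s M1 M2) (power : power_constraint s P)
  (coop_le : coop_constraint s CG)
  (infoE : mutual_information (W2 s) (@Y1 _ _ _ s hd hc : {mfun _ >-> _}) = info%:E).

Let in1 i (p : nat * V * S1 c) : R := enc1 c i p.
Let in2 i (u : U) : R := enc2 c i u.
Let signal (u : U) : V := [tuple coop c n u | n < N].
Let message (u : U) : nat := u.1.

Local Notation theta_law := (theta_law (local_law s) (secret_law s) (message_law s)).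
Local Notation space_law := (space_law N (local_law s) (secret_law s) (message_law s)).
Local Notation space := (U * (nat * S1 c) * (G * (G * G)))%type.
Local Notation a := (scaled_input hd in1).
Local Notation b := (scaled_input hc in2).
Local Notation c2 := (scaled_input hd in2).

Let msignal : measurable_fun setT signal.
Proof.
apply/measurable_fun_tnthP => i.
rewrite (_ : _ \o _ = (coop c i : _ -> _))//.
by apply/funext => u; rewrite /= tnth_mktuple.
Qed.

Let min1 i : measurable_fun setT (in1 i). Proof. by []. Qed.
Let min2 i : measurable_fun setT (in2 i). Proof. by []. Qed.
Let mmessage : measurable_fun setT message. Proof. exact: measurable_fst. Qed.
Let mdec1 : measurable_fun setT (dec1 c). Proof. by []. Qed.
Let mdec2 : measurable_fun setT (dec2 c). Proof. by []. Qed.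
Let ma : measurable_fun setT a. Proof. exact: measurable_scaled_input. Qed.
Let mb : measurable_fun setT b. Proof. exact: measurable_scaled_input. Qed.
Let mc2 : measurable_fun setT c2. Proof. exact: measurable_scaled_input. Qed.

Let indep : mutually_independent (Pr s) (@source_sigma R N c s).
Proof. by case: spec. Qed.
Let Z1N n : standard_normal (Z1 s n). Proof. by case: spec. Qed.
Let Z2N n : standard_normal (Z2 s n). Proof. by case: spec. Qed.

Let integral_theta (F : U * (nat * S1 c) -> \bar R) :
  measurable_fun setT F -> (forall x, 0 <= F x) ->
  \int[theta_law]_th F th = \int[Pr s]_w F (secret w, (W1 s w, T1 s w)).
Proof.
move=> mF F0.
rewrite (integral_sources indep Z1N Z2N (F := fun u w _ _ => F (u, w)))//; last first.
  by apply: (measurable_fun_comp mF); measurability.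
apply: eq_integral => th _; rewrite !integral_probability_cst.
by case: th.
Qed.

Let integral_space (F : U -> nat * S1 c -> G -> G -> \bar R) :
  measurable_fun setT (fun p : U * (nat * S1 c) * (G * G) =>
    F p.1.1 p.1.2 p.2.1 p.2.2) ->
  (forall u w z1 z2, 0 <= F u w z1 z2) ->
  \int[space_law]_x F x.1.1 x.1.2 x.2.1 x.2.2.1
  = \int[Pr s]_w F (secret w) (W1 s w, T1 s w) (noise1 w) (noise2 w).
Proof.
move=> mF F0; rewrite (integral_sources indep Z1N Z2N mF F0).
rewrite (@integral_space_law _ N _ _ _ _ _ _ _
  (fun x => F x.1.1 x.1.2 x.2.1 x.2.2.1)); last 2 first.
- by apply: (measurable_fun_comp (f := fun x : space => (x.1, (x.2.1, x.2.2.1))) mF);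
    measurability.
- by move=> x; exact: F0.
apply: eq_integral => th _; apply: eq_integral => z1 _; apply: eq_integral => z2 _.
exact: (integral_probability_cst gN (F th.1 th.2 z1 z2)).
Qed.

(** The genie noise takes the place of the noise at receiver 1. Both have law [gaussN] and are
    independent of the users, so the decoder of receiver 1 errs equally often on the genie version
    of its output. *)
Let integral_space3 (F : U -> nat * S1 c -> G -> \bar R) :
  measurable_fun setT (fun p : U * (nat * S1 c) * G => F p.1.1 p.1.2 p.2) ->
  (forall u w z, 0 <= F u w z) ->
  \int[space_law]_x F x.1.1 x.1.2 x.2.2.2
  = \int[Pr s]_w F (secret w) (W1 s w, T1 s w) (noise1 w).
Proof.
move=> mF F0.
rewrite (integral_sources indep Z1N Z2N (F := fun u w z _ => F u w z)); last 2 first.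
- by apply: (measurable_fun_comp (f := fun p : U * (nat * S1 c) * (G * G) =>
    (p.1, p.2.1)) mF); measurability.
- by move=> u w z1 _; exact: F0.
rewrite (@integral_space_law _ N _ _ _ _ _ _ _
  (fun x => F x.1.1 x.1.2 x.2.2.2)); last 2 first.
- by apply: (measurable_fun_comp (f := fun x : space => (x.1, x.2.2.2)) mF);
    measurability.
- by move=> x; exact: F0.
apply: eq_integral => th _ /=.
transitivity (\int[gN]_z F th.1 th.2 z).
  by rewrite !integral_probability_cst.
by apply: eq_integral => z1 _; rewrite integral_probability_cst.
Qed.

Let Y1E (w : Omega s) : Y1 hd hc w
  = vadd (b (secret w)) (vadd (a (W1 s w, signal (secret w), T1 s w)) (noise1 w)).
Proof.
apply: eq_from_tnth => i; rewrite !tnth_mktuple /X1 /X2 /in1 /in2.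
by rewrite [RHS]addrCA addrA.
Qed.

Let Y2E (w : Omega s) : Y2 hd w = vadd (c2 (secret w)) (noise2 w).
Proof. by apply: eq_from_tnth => i; rewrite !tnth_mktuple. Qed.

Let power1 i : \int[theta_law]_th (in1 i (th.2.1, signal th.1, th.2.2) ^+ 2)%:E <= P%:E.
Proof.
rewrite (integral_theta (F := fun th => (in1 i (th.2.1, signal th.1, th.2.2) ^+ 2)%:E)).
- by have [+ _] := power i; rewrite unlock.
- apply/measurable_EFinP; apply: measurable_funX.
  by apply: (measurable_fun_comp (min1 i)); measurability.
- by move=> x; rewrite lee_fin sqr_ge0.
Qed.

Let power2 i : \int[theta_law]_th (in2 i th.1 ^+ 2)%:E <= P%:E.
Proof.
rewrite (integral_theta (F := fun th => (in2 i th.1 ^+ 2)%:E)).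
- by have [_] := power i; rewrite unlock.
- apply/measurable_EFinP; apply: measurable_funX.
  by apply: (measurable_fun_comp (min2 i)); measurability.
- by move=> x; rewrite lee_fin sqr_ge0.
Qed.

Let error_integral d (T : measurableType d) (Q : probability T R) (f g : T -> nat) :
  measurable_fun setT f -> measurable_fun setT g ->
  \int[Q]_t (f t != g t)%:R%:E <= (fine (Q [set t | f t <> g t]))%:E.
Proof.
move=> mf mg.
have mE : measurable [set t | f t <> g t].
  rewrite (_ : [set _ | _] = (fun t => f t != g t) @^-1` [set true]).
    rewrite -[X in measurable X]setTI.
    by apply: (measurable_neg (measurable_fun_eqn mf mg)).
  by apply/seteqP; split => t /=; [move/eqP|move/eqP].
rewrite fineK ?fin_num_measure// -[X in Q X]setIT -integral_indic//.
rewrite le_eqVlt; apply/orP; left; apply/eqP; apply: eq_integral => t _.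
rewrite indicE; case: (eqVneq (f t) (g t)) => [ft|/eqP ft].
  by rewrite memNset// => /(_ ft).
by rewrite mem_set.
Qed.

Let err1 : R := fine (error1 s hd hc).
Let err2 : R := fine (error2 s hd).

Let mean_guess1 : mean_le space_law (fun x : space =>
    (- ln (guess M1 (dec1 c) x.1.2.1 (out1 signal a b x)))%:E)
  (ln 2 + ln M1%:R * err1)%R.
Proof.
apply: mean_le_guess => //.
- by measurability.
- by apply: (measurable_out1 msignal ma mb); measurability.
rewrite (integral_space (F := fun u w z1 z2 =>
  (dec1 c (vadd (b u) (vadd (a (w.1, signal u, w.2)) z1)) != w.1)%:R%:E)) /=.
- apply: le_trans (error_integral (f := dec1 c \o @Y1 _ _ _ s hd hc) (Pr s) _ _) => //=.
  by under eq_integral do rewrite -Y1E.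
- apply/measurable_EFinP.
  apply: (measurable_fun_comp (g := fun b : bool => (b%:R : R))) => //.
  apply: measurable_neg; apply: measurable_fun_eqn; last by measurability.
  by apply: (measurable_fun_comp mdec1); measurability.
- by move=> *; rewrite lee_fin.
Qed.

Let mean_guess1' : mean_le space_law (fun x : space =>
    (- ln (guess M1 (dec1 c) x.1.2.1 (vadd (b x.1.1) (side signal a x))))%:E)
  (ln 2 + ln M1%:R * err1)%R.
Proof.
apply: mean_le_guess => //.
- by measurability.
- apply: measurable_vadd; first by measurability.
  by apply: (measurable_side msignal ma); measurability.
rewrite (integral_space3 (F := fun u w z1 =>
  (dec1 c (vadd (b u) (vadd (a (w.1, signal u, w.2)) z1)) != w.1)%:R%:E)) /=.
- apply: le_trans (error_integral (f := dec1 c \o @Y1 _ _ _ s hd hc) (Pr s) _ _) => //=.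
  by under eq_integral do rewrite -Y1E.
- apply/measurable_EFinP.
  apply: (measurable_fun_comp (g := fun b : bool => (b%:R : R))) => //.
  apply: measurable_neg; apply: measurable_fun_eqn; last by measurability.
  by apply: (measurable_fun_comp mdec1); measurability.
- by move=> *; rewrite lee_fin.
Qed.

Let measurable_Y2 : measurable_fun setT (@Y2 _ _ _ s hd).
Proof.
rewrite (_ : @Y2 _ _ _ s hd = fun w => vadd (c2 (secret w)) (noise2 w)); last exact/funext.
apply: measurable_vadd => //; exact: (measurable_fun_comp mc2).
Qed.

Let mean_guess2 : mean_le space_law (fun x : space =>
    (- ln (guess M2 (dec2 c) (message x.1.1) (out2 c2 x)))%:E)
  (ln 2 + ln M2%:R * err2)%R.
Proof.
apply: mean_le_guess => //.
- by apply: (measurable_fun_comp mmessage); measurability.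
- by apply: (measurable_out2 mc2); measurability.
rewrite (integral_space (F := fun u w z1 z2 =>
  (dec2 c (vadd (c2 u) z2) != message u)%:R%:E)) /=.
- apply: le_trans (error_integral (f := dec2 c \o @Y2 _ _ _ s hd) (Pr s) _ _) => //=.
    by under eq_integral do rewrite -Y2E.
  by apply: measurableT_comp.
- apply/measurable_EFinP.
  apply: (measurable_fun_comp (g := fun b : bool => (b%:R : R))) => //.
  apply: measurable_neg; apply: measurable_fun_eqn; last by measurability.
  by apply: (measurable_fun_comp mdec2); measurability.
- by move=> *; rewrite lee_fin.
Qed.

Let message_lawE m :
  message_law s [set m] = (if (m < M1)%N then M1%:R^-1 else 0)%:E.
Proof. by case: spec => u1 _ _ _ _; exact: u1. Qed.

Let message_law_le m : message_law s [set m] <= (M1%:R^-1)%:E.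
Proof. by rewrite message_lawE; case: ifP; rewrite lee_fin. Qed.

Let secret_message_le m : distribution (Pr s) (W2 s) [set m] <= (M2%:R^-1)%:E.
Proof.
rewrite (_ : distribution _ _ _ = (if (m < M2)%N then M2%:R^-1 else 0)%:E).
  by case: ifP; rewrite lee_fin.
by case: spec => _ u2 _ _ _; exact: u2.
Qed.

Lemma message1_code_bound :
  (ln (M1%:R : R) <= ln 2 + ln M1%:R * err1
    + N%:R * (ln 2 * (2^-1 * log2 (1 + hd ^+ 2 * P))))%R.
Proof.
exact: (message1_rate msignal min1 min2 power1 power2 M1_gt0 mdec1 message_law_le
  mean_guess1').
Qed.

Let mout1 : measurable_fun setT (out1 signal a b : space -> G).
Proof. exact: (measurable_out1 msignal ma mb (@measurable_id _ _ _)). Qed.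

Let Y1RV : {RV (Pr s) >-> G} := (@Y1 _ _ _ s hd hc : {mfun _ >-> _}).

Let joint_law_space (F : nat * G -> \bar R) :
  measurable_fun setT F -> (forall p, 0 <= F p) ->
  \int[space_law]_x F (message x.1.1, out1 signal a b x)
  = \int[distribution (Pr s) (joint_rv (W2 s) Y1RV)]_p F p.
Proof.
move=> mF F0; rewrite ge0_integral_distribution//.
rewrite (integral_space (F := fun u w z1 _ =>
  F (message u, vadd (b u) (vadd (a (w.1, signal u, w.2)) z1)))); last 2 first.
- by apply: (measurable_fun_comp mF); measurability.
- by move=> *; exact: F0.
by apply: eq_integral => w _; rewrite -Y1E.
Qed.

Let density_exists := kl_divergence_density infoE.
Let f := sval (cid density_exists).
Let mf : measurable_fun setT f.
Proof. by case: (svalP (cid density_exists)). Qed.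
Let f_ge0 p : (0 <= f p)%R.
Proof. by case: (svalP (cid density_exists)). Qed.

Let fE (F : nat * G -> \bar R) : measurable_fun setT F -> (forall p, 0 <= F p) ->
  \int[space_law]_x F (message x.1.1, out1 signal a b x)
  = \int[prob_prod (distribution (Pr s) (W2 s)) (distribution (Pr s) Y1RV)]_p
      (F p * (f p)%:E).
Proof.
move=> mF F0; rewrite joint_law_space//.
by case: (svalP (cid density_exists)) => _ _ + _; exact.
Qed.

Let mean_density : mean_le space_law (fun x : space =>
  (ln (pos_density f (message x.1.1, out1 signal a b x)))%:E) (ln 2 * info)%R.
Proof.
case: (svalP (cid density_exists)) => _ _ _.
apply: (mean_le_comp (g := fun x : space => (message x.1.1, out1 signal a b x))).
  apply: measurable_fun_pair; last exact: mout1.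
  by apply: (measurable_fun_comp mmessage); measurability.
exact: joint_law_space.
Qed.

Lemma message2_code_bound (B : R) :
  (forall k, `|k| <= P -> 2^-1 * log2 (var2_given1 hd hc P k) <= B)%R ->
  (ln (M2%:R : R) <= ln 2 + ln M2%:R * err2 + N%:R * (ln 2 * B) + ln 2 * info)%R.
Proof.
exact: (message2_rate msignal min1 min2 mmessage power1 power2 M2_gt0 mdec2
  secret_message_le mf f_ge0 fE mean_guess2 mean_density).
Qed.

Let neg_ln_ge0 (t : R) : (t <= 1)%R -> 0 <= neg_ln t.
Proof.
move=> t1; rewrite /neg_ln; case: eqP => // _.
by rewrite lee_fin oppr_ge0 ln_le0.
Qed.

(** For the uniform message, [M1 * message_mass] is 1 on the support; the value [+oo] off the
    support is met with probability 0. *)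
Let mean_message : mean_le space_law (fun x : space =>
  neg_ln (M1%:R * message_mass (message_law s) x.1.2.1)%R) 0.
Proof.
pose D m := neg_ln (M1%:R * message_mass (message_law s) m)%R.
have M1n : (M1%:R != 0 :> R)%R by rewrite pnatr_eq0 -lt0n.
have massE m : message_mass (message_law s) m = (if (m < M1)%N then M1%:R^-1 else 0)%R.
  by rewrite /message_mass message_lawE.
have D0 m : 0 <= D m.
  apply: neg_ln_ge0; rewrite massE; case: ifP => _; last by rewrite mulr0.
  by rewrite mulfV.
have mD : measurable_fun setT D by [].
apply: mean_le_nonneg => [|x|].
- by apply: (measurable_fun_comp mD); measurability.
- exact: D0.
rewrite (integral_space (F := fun u w z1 z2 => D w.1)); last 2 first.
- by apply: (measurable_fun_comp mD); measurability.
- by move=> *; exact: D0.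
rewrite [leLHS](_ : _ = \int[message_law s]_m D m); last first.
  by rewrite ge0_integral_distribution.
rewrite (integral_countable (e := id))//.
rewrite esum1// => m _; rewrite [X in _ * X]message_lawE /D massE.
case: ifP => _; last by rewrite mule0.
by rewrite mulfV// /neg_ln oner_eq0 ln1 oppr0 mul0e.
Qed.

Let measurable_singleton (x : V) : measurable [set x].
Proof.
rewrite (_ : [set x] = \bigcap_(i in [set: 'I_N]) ((fun y => tnth y i) @^-1` [set tnth x i])).
  apply: fin_bigcap_measurable => // i _.
  by rewrite -[_ @^-1` _]setTI; exact: measurable_tnth.
apply/seteqP; split => [y -> i _//|y yx]; apply: eq_from_tnth => i.
exact: yx.
Qed.

HB.instance Definition _ := isMeasurableFun.Build _ _ _ _ (@V21 _ _ _ s)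
  (@measurable_V21 _ _ _ s).

Let mass := signal_mass (secret_law s) signal.

(** The mean of minus the logarithm of the mass of the signal is its entropy; the factor [ln 2]
    converts bits to natural units. *)
Let mean_signal : mean_le space_law (fun x : space => neg_ln (mass (signal x.1.1)))
  (ln 2 * (N%:R * CG))%R.
Proof.
have ln2 : (0 < ln 2 :> R)%R by rewrite ln_gt0// ltr1n.
have e_inj : injective (pickle : V -> nat) := pcan_inj pickleK.
have mass_le1 x : (mass x <= 1)%R.
  rewrite -lee_fin fineK ?fin_num_measure//; last first.
    by rewrite -[_ @^-1` _]setTI; exact: msignal.
  apply: probability_le1.
  by rewrite -[_ @^-1` _]setTI; exact: msignal.
pose D x := neg_ln (mass x).
have D0 x : 0 <= D x by exact: neg_ln_ge0.
have mD : measurable_fun setT D by apply: (measurable_fun_countable e_inj).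
apply: mean_le_nonneg => [|x|].
- by apply: (measurable_fun_comp mD); apply: (measurable_fun_comp msignal); measurability.
- exact: D0.
rewrite (integral_space (F := fun u w z1 z2 => D (signal u))); last 2 first.
- by apply: (measurable_fun_comp mD); measurability.
- by move=> *; exact: D0.
rewrite [leLHS](_ : _ =
    \int[distribution (Pr s) (@V21 _ _ _ s : {mfun _ >-> _})]_x D x); last first.
  by rewrite ge0_integral_distribution.
set I := \int[_]_x D x.
have : (ln 2)^-1%:E * I <= (N%:R * CG)%:E.
  rewrite /I -ge0_integralZl//; last by rewrite lee_fin invr_ge0 ltW.
  rewrite (integral_countable e_inj measurable_singleton); last first.
    by move=> x; rewrite mule_ge0// lee_fin invr_ge0 ltW.
  apply: le_trans coop_le; rewrite /entropy le_eqVlt; apply/orP; left; apply/eqP.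
  apply: eq_esum => x _; rewrite /= /D -/(mass x).
  have -> : distribution (Pr s) (@V21 _ _ _ s : {mfun _ >-> _}) [set x] = (mass x)%:E.
    apply/esym/fineK.
    exact: (fin_num_measure (distribution (Pr s) (@V21 _ _ _ s : {mfun _ >-> _})) _
      (measurable_singleton x)).
  rewrite -[X in log2 X]/(mass x) -[X in (X * log2 _)%R]/(mass x).
  (* At an atom of mass 0 the product of [+oo] and 0 is 0, in accordance with [0 log 0 = 0]. *)
  rewrite /neg_ln; case: eqP => [->|_]; first by rewrite mule0 mul0r oppr0.
  by rewrite -!EFinM; congr (_%:E); rewrite /log2; ring.
move=> /(lee_wpmul2l (x := (ln 2)%:E)) /=; rewrite muleA -!EFinM mulfV ?gt_eqF// mul1e.
by apply; rewrite lee_fin ltW.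
Qed.

Lemma sum_messages_code_bound (B : R) :
  (forall k, `|k| <= P -> 2^-1 * log2 (vars_given2 hd hc P k)
    + 2^-1 * log2 (var2_given_s1 hd hc P k) <= B)%R ->
  (ln (M1%:R : R) + ln (M2%:R : R) <=
    (ln 2 + ln M1%:R * err1) + (ln 2 + ln M1%:R * err1) + (ln 2 + ln M2%:R * err2)
    + N%:R * (ln 2 * B) + ln 2 * info + 0 + ln 2 * (N%:R * CG))%R.
Proof.
have e_inj : injective (pickle : V -> nat) := pcan_inj pickleK.
apply: (sum_messages_rate msignal min1 min2 mmessage power1 power2 M1_gt0 mdec1
  message_law_le M2_gt0 mdec2 secret_message_le mf f_ge0 fE mean_guess2 mean_density
  _ _ mean_guess1' mean_guess1 mean_message mean_signal).
- exact: measurable_singleton.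
- exact: (measurable_fun_countable e_inj).
Qed.

End code_bounds.

(** * Bounds for rates *)

Section rates.
Context (R : realType).

Let ln2_gt0 : 0 < ln 2 :> R. Proof. by rewrite ln_gt0// ltr1n. Qed.

(** Since [2 ^ (N r) >= 1], rounding up at most doubles it, which costs one bit in the logarithm. *)
Lemma message_countP (N : nat) (r : R) : 0 <= r ->
  [/\ (0 < message_count N r)%N, N%:R * r * ln 2 <= ln (message_count N r)%:R
    & ln (message_count N r)%:R <= (N%:R * r + 1) * ln 2].
Proof.
move=> r0; set p : R := 2 `^ (N%:R * r).
have p1 : 1 <= p.
  by rewrite -(powRr0 2) ler_powR ?ler1n// mulr_ge0.
have p0 : 0 < p by exact: lt_le_trans p1.
have lnp : ln p = N%:R * r * ln 2 by rewrite ln_powR.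
have cE : (message_count N r)%:R = (Num.ceil p)%:~R :> R.
  rewrite /message_count -/p natr_absz ger0_norm//.
  by rewrite ceil_ge0 (lt_trans _ p0)// ltrN10.
have lo : p <= (message_count N r)%:R by rewrite cE ceil_ge.
have hi : (message_count N r)%:R <= p * 2.
  have /andP[+ _] := ceil_itv p; rewrite cE intrB; lra.
have c0 : 0 < (message_count N r)%:R :> R by exact: lt_le_trans lo.
split; first by rewrite -(ltr0n R).
- by rewrite -lnp ler_ln ?posrE.
- by rewrite mulrDl mul1r -lnp -lnM ?posrE// ler_ln ?posrE// mulr_gt0.
Qed.

Section achievable_pair.
Variables (hd hc P CG r1 r2 : R).
Hypotheses (r1_ge0 : 0 <= r1) (r2_ge0 : 0 <= r2).
Variables (N : nat -> nat) (c : forall k, Defs.code R (N k)) (s : forall k, sources (c k)).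
Hypotheses (N_oo : N k @[k --> \oo] --> \oo)
  (spec : forall k,
    sources_spec (s k) (message_count (N k) r1) (message_count (N k) r2))
  (power : forall k, power_constraint (s k) P)
  (coop_le : forall k, coop_constraint (s k) CG)
  (err1_0 : error1 (s k) hd hc @[k --> \oo] --> 0%E)
  (err2_0 : error2 (s k) hd @[k --> \oo] --> 0%E)
  (leak_0 : leakage (s k) hd hc @[k --> \oo] --> 0%E).

Let e1 k := fine (error1 (s k) hd hc).
Let e2 k := fine (error2 (s k) hd).
Let leak k := fine (leakage (s k) hd hc).
Let n k : R := (N k)%:R^-1.

Let N_gt0 : \forall k \near \oo, (0 < N k)%N.
Proof. by move/cvgnyPge : N_oo => /(_ 1%N). Qed.

Let n_0 : n k @[k --> \oo] --> 0.
Proof.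
apply/(@gtr0_cvgV0 R _ _ _ (fun k => (N k)%:R)); last exact/cvgrnyP.
by near=> k; rewrite ltr0n; near: k; exact: N_gt0.
Unshelve. all: by end_near. Qed.

Let e1_0 : e1 k @[k --> \oo] --> 0. Proof. exact: fine_cvg. Qed.
Let e2_0 : e2 k @[k --> \oo] --> 0. Proof. exact: fine_cvg. Qed.
Let leak0 : leak k @[k --> \oo] --> 0. Proof. exact: fine_cvg. Qed.

(** Convergence of the leakage to 0 makes it finite from some index on, which is what supplies the
    density of the secrecy argument. *)
Let info_fin : \forall k \near \oo,
  mutual_information (W2 (s k)) (@Y1 _ _ _ (s k) hd hc : {mfun _ >-> _})
  = ((N k)%:R * leak k)%:E.
Proof.
have lfin := cvg_is_fine leak_0.
near=> k; have Nk : ((N k)%:R : R) != 0.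
  by rewrite pnatr_eq0 -lt0n; near: k; exact: N_gt0.
rewrite EFinM /leak fineK; last by near: k; exact: lfin.
by rewrite /leakage muleA -EFinM mulfV// mul1e.
Unshelve. all: by end_near. Qed.

Let error_ge0 k : 0 <= e1 k /\ 0 <= e2 k.
Proof. by split; apply: fine_ge0. Qed.

(** Divided by [N * ln 2], the decoding loss is at most [1 / N + (r + 1 / N) * e], which vanishes in
    the limit. *)
Let rate_bound k (r e : R) (M := message_count (N k) r) : (0 < N k)%N ->
  0 <= r -> 0 <= e -> ln 2 + ln M%:R * e <= (N k)%:R * ln 2 * (n k + (r + n k) * e).
Proof.
move=> Nk r0 e0; have [_ _ hi] := message_countP (N k) r0.
have Nk0 : (N k)%:R != 0 :> R by rewrite pnatr_eq0 -lt0n.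
rewrite [leRHS](_ : _ = ln 2 + ((N k)%:R * r + 1) * ln 2 * e); last first.
  by rewrite /n; field.
by rewrite lerD2l ler_wpM2r.
Qed.

Lemma rate1_bound : r1 <= 2^-1 * log2 (1 + hd ^+ 2 * P).
Proof.
set A := 2^-1 * _.
have lim : n k + (r1 + n k) * e1 k + A @[k --> \oo] --> 0 + (r1 + 0) * 0 + A.
  apply: cvgD; last exact: cvg_cst.
  by apply: cvgD => //; apply: cvgM => //; apply: cvgD => //; exact: cvg_cst.
rewrite mulr0 !add0r in lim; apply: (cvgr_to_ge lim).
near=> k; have Nk : (0 < N k)%N by near: k; exact: N_gt0.
have NL : 0 < (N k)%:R * ln 2 :> R by rewrite mulr_gt0// ltr0n.
have [M0 lo _] := message_countP (N k) r1_ge0.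
have := @message1_code_bound R _ _ _ hd hc P _ _ M0 (@spec k) (@power k).
have [e10 _] := error_ge0 k; have := rate_bound Nk r1_ge0 e10.
rewrite -/A -/(e1 k) => h1 h2; rewrite -(ler_pM2l NL); lra.
Unshelve. all: by end_near. Qed.

Lemma rate2_bound (B : R) :
  (forall k, `|k| <= P -> 2^-1 * log2 (var2_given1 hd hc P k) <= B) -> r2 <= B.
Proof.
move=> kB.
have lim : n k + (r2 + n k) * e2 k + B + leak k @[k --> \oo]
    --> 0 + (r2 + 0) * 0 + B + 0.
  apply: cvgD => //; apply: cvgD; last exact: cvg_cst.
  by apply: cvgD => //; apply: cvgM => //; apply: cvgD => //; exact: cvg_cst.
rewrite mulr0 !add0r addr0 in lim; apply: (cvgr_to_ge lim).
near=> k; have Nk : (0 < N k)%N by near: k; exact: N_gt0.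
have NL : 0 < (N k)%:R * ln 2 :> R by rewrite mulr_gt0// ltr0n.
have [M0 lo _] := message_countP (N k) r2_ge0.
have infoE : mutual_information (W2 (s k)) (@Y1 _ _ _ (s k) hd hc : {mfun _ >-> _})
  = ((N k)%:R * leak k)%:E by near: k; exact: info_fin.
have := message2_code_bound M0 (@spec k) (@power k) infoE kB.
have [_ e20] := error_ge0 k; have := rate_bound Nk r2_ge0 e20.
rewrite -/(e2 k) => h1 h2; rewrite -(ler_pM2l NL); lra.
Unshelve. all: by end_near. Qed.

Lemma sum_rate_bound (B : R) :
  (forall k, `|k| <= P -> 2^-1 * log2 (vars_given2 hd hc P k)
    + 2^-1 * log2 (var2_given_s1 hd hc P k) <= B) -> r1 + r2 <= B + CG.
Proof.
move=> kB.
(* The term of receiver 1 occurs twice: its decoder is applied to its own output and to the genie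
   version of it. *)
have lim : (n k + (r1 + n k) * e1 k) + (n k + (r1 + n k) * e1 k)
      + (n k + (r2 + n k) * e2 k) + (B + CG) + leak k @[k --> \oo]
    --> (0 + (r1 + 0) * 0) + (0 + (r1 + 0) * 0) + (0 + (r2 + 0) * 0) + (B + CG) + 0.
  apply: cvgD => //; apply: cvgD; last exact: cvg_cst.
  by apply: cvgD; first apply: cvgD; apply: cvgD => //; apply: cvgM => //;
    apply: cvgD => //; exact: cvg_cst.
rewrite !mulr0 !add0r addr0 in lim; apply: (cvgr_to_ge lim).
near=> k; have Nk : (0 < N k)%N by near: k; exact: N_gt0.
have NL : 0 < (N k)%:R * ln 2 :> R by rewrite mulr_gt0// ltr0n.
have [M10 lo1 _] := message_countP (N k) r1_ge0.
have [M20 lo2 _] := message_countP (N k) r2_ge0.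
have infoE : mutual_information (W2 (s k)) (@Y1 _ _ _ (s k) hd hc : {mfun _ >-> _})
  = ((N k)%:R * leak k)%:E by near: k; exact: info_fin.
have := sum_messages_code_bound M10 M20 (@spec k) (@power k) (@coop_le k) infoE kB.
have [e10 e20] := error_ge0 k.
have := rate_bound Nk r1_ge0 e10; have := rate_bound Nk r2_ge0 e20.
rewrite -/(e1 k) -/(e2 k) => h1 h2 h3; rewrite -(ler_pM2l NL); lra.
Unshelve. all: by end_near. Qed.

End achievable_pair.

(** The preimage of a closed half-line is closed, so it contains the closure of any set that it
    contains; this brings in the rate pairs that are only limits of achievable ones. *)
Lemma closure_le (T : topologicalType) (S : set T) (f : T -> R) (B : R) :
  continuous f -> (forall x, S x -> f x <= B) -> forall x, closure S x -> f x <= B.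
Proof.
move=> cf SB x clx.
have clB : closed (f @^-1` [set y | y <= B]).
  by apply: preimage_closed; [move=> y _; exact: cf|exact: closed_le].
have : closure (f @^-1` [set y | y <= B]) x by exact: closureS clx.
by rewrite -((closure_id _).1 clB).
Qed.

End rates.

Theorem theorem6 (R : realType) (hd hc P CG : R) (P_gt0 : 0 < P)
    (CG_ge0 : 0 <= CG) (R1 R2 : R)
    (R1R2 : secrecy_capacity_region hd hc P CG (R1, R2)) :
  let SNR := hd ^+ 2 * P in
  let INR := hc ^+ 2 * P in
  [/\ R1 <= 2^-1 * log2 (1 + SNR),
      exists2 m, is_max `[-1, 1] (R2_bound SNR INR) m & R2 <= m
    & exists2 m, is_max `[-1, 1] (sum_bound SNR INR) m & R1 + R2 <= m + CG].
Proof.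
move=> SNR INR.
(* Both maxima depend on [hd], [hc] and [P] but not on the codes, so the same bounds hold on the
   whole closure. *)
have [m2 max2 le2] := R2_bound_max hd hc P_gt0.
have [m3 max3 le3] := sum_bound_max hd hc P_gt0.
have split_spec (r : R * R) (N : nat -> nat) (c : forall k, Defs.code R (N k))
    (s : forall k, sources (c k)) :
  (forall k, [/\ sources_spec (s k) (message_count (N k) r.1) (message_count (N k) r.2),
     power_constraint (s k) P & coop_constraint (s k) CG]) ->
  [/\ forall k, sources_spec (s k) (message_count (N k) r.1) (message_count (N k) r.2),
    forall k, power_constraint (s k) P & forall k, coop_constraint (s k) CG].
  by move=> sp; split => k; case: (sp k).
split; [|exists m2 => //|exists m3 => //].
- apply: (closure_le (f := fst) _ _ R1R2) => [x|r /=]; first exact: cvg_fst.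
  move=> [r1 r2 [N [c [s [N_oo [/split_spec[sp pw _] [err1 err2 leak]]]]]]].
  exact: (rate1_bound r1 N_oo sp pw err1).
- apply: (closure_le (f := snd) _ _ R1R2) => [x|r /=]; first exact: cvg_snd.
  move=> [r1 r2 [N [c [s [N_oo [/split_spec[sp pw _] [err1 err2 leak]]]]]]].
  exact: (rate2_bound r2 N_oo sp pw err2 leak le2).
- apply: (closure_le (f := fun r : R * R => r.1 + r.2) _ _ R1R2) => [x|r /=].
    by apply: cvgD; [exact: cvg_fst|exact: cvg_snd].
  move=> [r1 r2 [N [c [s [N_oo [/split_spec[sp pw cp] [err1 err2 leak]]]]]]].
  exact: (sum_rate_bound r1 r2 N_oo sp pw cp err1 err2 leak le3).
Qed.
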